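(* Let $\Omega, a, b, c, g, \theta$ be as specified in the context, with $\theta<-1$, $b\ge 0$ and $c\ge 0$ a.e. in $\Omega$. Set $\overline h:=\max_{\mathbf{x}\in\partial\Omega}g(\mathbf{x})^{\frac{2}{1+\theta}}$ and $\nu:=-\theta\,\overline h^{-(1+\theta)}$. Define $\Psi_0\in H^1(\Omega)$ as the weak solution of $$-\nabla\cdot a\nabla\Psi_0+(b+c\nu)\Psi_0=0\ \text{ in }\Omega,\qquad \Psi_0=g^{\frac{2}{1+\theta}}\ \text{ on }\partial\Omega,$$ and, for $n\ge1$, $\Psi_n\in H^1(\Omega)$ as the weak solution of the linear problem $$-\nabla\cdot a\nabla\Psi_n+(b+c\nu)\Psi_n=-c\left(\Psi_{n-1}^{-\theta}-\nu\Psi_{n-1}\right)\ \text{ in }\Omega,\qquad \Psi_n=g^{\frac{2}{1+\theta}}\ \text{ on }\partial\Omega .$$ Then the sequence $\{\Psi_n\}_{n\ge0}$ converges to the unique positive weak solution $\Psi$ of $$\nabla\cdot a\nabla\Psi = b\,\Psi + c\,|\Psi|^{-(1+\theta)}\Psi \ \text{ in }\Omega,\qquad \Psi = g^{\frac{2}{1+\theta}}\ \text{ on }\partial\Omega .$$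
   Context: Setting: $d\in\{2,3\}$; $\Omega\subset\mathbb{R}^d$ is a bounded, simply connected domain with $C^2$ boundary. $K_0,K_1$ are positive constants. $a\in C^{0,1}(\overline\Omega)$ (a diffusion coefficient), $\sigma_{x,a}\in L^\infty(\Omega)$ and $g\in C^1(\overline\Omega)$ (only its restriction to $\partial\Omega$ is used as boundary datum) satisfy $K_0<a,\sigma_{x,a},g<K_1$. $\theta\in\mathbb{R}\setminus\{-1\}$ and $\mu\in\mathbb{R}$ are constants, $b:=-\frac{2}{1+\theta}\mu\,\sigma_{x,a}$, and $c\in L^\infty(\Omega)$ is real-valued. Weak solution of the semilinear problem: $\Psi\in H^1(\Omega)$ with trace $g^{2/(1+\theta)}$ such that, for every $\phi\in H^1_0(\Omega)$, $(b\Psi+c|\Psi|^{-(1+\theta)}\Psi)\phi$ is integrable and $\int_\Omega a\nabla\Psi\cdot\nabla\phi\,d\mathbf{x} = -\int_\Omega (b\Psi+c|\Psi|^{-(1+\theta)}\Psi)\phi\,d\mathbf{x}$. Positive means $\Psi>0$ a.e. in $\Omega$. *)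

(* Defs.v *)
From HB Require Import structures.
From mathcomp Require Import all_boot all_order all_algebra.
From mathcomp Require Import all_classical all_reals all_analysis.
Import Order.TTheory GRing.Theory Num.Theory.
Import numFieldNormedType.Exports.

Set Implicit Arguments.
Unset Strict Implicit.
Unset Printing Implicit Defensive.

Local Open Scope classical_set_scope.
Local Open Scope ring_scope.

(* Borel sigma-algebra of R^n, generated by the coordinates. *)
Definition rV_coord_sets (R : realType) (n : nat) : set (set 'rV[R]_n) :=
  [set A | exists (i : 'I_n) (B : set (measurableTypeR R)),
    measurable B /\ A = (fun x : 'rV[R]_n => x 0 i) @^-1` B].

Definition rV_display (R : realType) (n : nat) : measure_display :=
  sigma_display (@rV_coord_sets R n).

Section rV_measurable.
Variables (R : realType) (n : nat).

Let rV_set0 : <<s @rV_coord_sets R n >> set0.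
Proof. exact: sigma_algebra0. Qed.

Let rV_setC A : <<s @rV_coord_sets R n >> A -> <<s @rV_coord_sets R n >> (~` A).
Proof. exact: sigma_algebraC. Qed.

Let rV_bigcup (F : (set 'rV[R]_n)^nat) :
  (forall i, <<s @rV_coord_sets R n >> (F i)) ->
  <<s @rV_coord_sets R n >> (\bigcup_i (F i)).
Proof. exact: sigma_algebra_bigcup. Qed.

HB.instance Definition _ := @isMeasurable.Build (rV_display R n)
  'rV[R]_n <<s @rV_coord_sets R n >> rV_set0 rV_setC rV_bigcup.
End rV_measurable.

Definition rV_cons (R : realType) (n : nat) (p : measurableTypeR R * 'rV[R]_n) :
  'rV[R]_n.+1 := row_mx (p.1 : R)%:M p.2.

(* n-dimensional Lebesgue measure (on Borel sets), as an iterated product. *)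
Fixpoint lebesgue_rV (R : realType) (n : nat) : set 'rV[R]_n -> \bar R :=
  match n with
  | 0%N => \d_(0 : 'rV[R]_0)
  | m.+1 => pushforward (@lebesgue_measure R \x @lebesgue_rV R m)%E (@rV_cons R m)
  end.

Section lebesgue_rV_measure.
Variable R : realType.

Lemma measurable_rV_coord n (i : 'I_n) :
  measurable_fun setT (fun x : 'rV[R]_n => (x 0 i : measurableTypeR R)).
Proof.
move=> _ Y mY; rewrite setTI; apply: sub_sigma_algebra.
by exists i, Y.
Qed.

Lemma measurable_fun_rVP d (T : measurableType d) n (f : T -> 'rV[R]_n) :
  (forall i, measurable_fun setT (fun x => (f x 0 i : measurableTypeR R))) ->
  measurable_fun setT f.
Proof.
move=> mf; apply: (@measurability _ _ _ _ _ _ (@rV_coord_sets R n)) => //.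
move=> _ [_ [i [B [mB ->]]] <-].
exact: mf.
Qed.

Lemma measurable_rV_cons n : measurable_fun setT (@rV_cons R n).
Proof.
apply: measurable_fun_rVP => i; rewrite /rV_cons.
case: (split_ordP (i : 'I_(1 + n))) => j ->{i}.
  rewrite [X in measurable_fun _ X](_ : _ = fst); first exact: measurable_fst.
  by apply/funext => x; rewrite [LHS]row_mxEl ord1 mxE eqxx mulr1n.
rewrite [X in measurable_fun _ X](_ : _ =
  (fun y : 'rV[R]_n => (y 0 j : measurableTypeR R)) \o snd).
  by apply: measurableT_comp => //; exact: measurable_rV_coord.
by apply/funext => x; rewrite [LHS]row_mxEr.
Qed.

Definition rV_uncons n (x : 'rV[R]_n.+1) : measurableTypeR R * 'rV[R]_n :=
  (x 0 0, @rsubmx R 1 1 n x).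

Lemma rV_consK n : cancel (@rV_cons R n) (@rV_uncons n).
Proof.
move=> [t y]; rewrite /rV_uncons /rV_cons /= row_mxKr; congr pair.
have -> : (0 : 'I_n.+1) = lshift n (0 : 'I_1) by exact/val_inj.
by rewrite [LHS]row_mxEl mxE eqxx mulr1n.
Qed.

Lemma measurable_rV_uncons n : measurable_fun setT (@rV_uncons n).
Proof.
apply: measurable_fun_pair; first exact: measurable_rV_coord.
apply: measurable_fun_rVP => i; rewrite [X in measurable_fun _ X](_ : _ =
  (fun x : 'rV[R]_n.+1 => (x 0 (rshift 1 i) : measurableTypeR R))).
  exact: measurable_rV_coord.
by apply/funext => x; rewrite mxE.
Qed.

Lemma lebesgue_rV_sigma_finite_measure n :
  exists m : {sigma_finite_measure set 'rV[R]_n -> \bar R},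
    (m : set 'rV[R]_n -> \bar R) = @lebesgue_rV R n.
Proof.
elim: n => [|n [m mE]].
  by exists (\d_(0 : 'rV[R]_0) : {sigma_finite_measure set _ -> \bar R}).
pose l : {sigma_finite_measure set (measurableTypeR R) -> \bar R} :=
  @lebesgue_measure R.
pose pm : {measure set (measurableTypeR R * 'rV[R]_n)%type -> \bar R} :=
  (l \x m)%E.
pose nu0 : {measure set 'rV[R]_n.+1 -> \bar R} := pushforward pm (@rV_cons R n).
pose nu := nu0 (@measurable_rV_cons n).
have nu_sf : sigma_finite setT nu.
  have /sigma_finiteP[F [FT ndF Foo]] := sigma_finiteT l.
  have /sigma_finiteP[G [GT ndG Goo]] := sigma_finiteT m.
  exists (fun k => @rV_uncons n @^-1` (F k `*` G k)).
    apply/esym; rewrite -subTset => x _.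
    have [i _ Fi] : (\bigcup_i F i) (rV_uncons x).1 by rewrite -FT.
    have [j _ Gj] : (\bigcup_i G i) (rV_uncons x).2 by rewrite -GT.
    exists (maxn i j) => //; split.
      by move: Fi; exact/subsetPset/ndF/leq_maxl.
    by move: Gj; exact/subsetPset/ndG/leq_maxr.
  move=> k; have [mF Fk] := Foo k; have [mG Gk] := Goo k; split.
    rewrite -[X in measurable X]setTI.
    by apply: measurable_rV_uncons => //; exact: measurableX.
  rewrite /nu /nu0 /= /pushforward -comp_preimage.
  rewrite (_ : _ \o _ = id) ?preimage_id; last exact/funext/rV_consK.
  by rewrite /pm /= product_measure1E// lte_mul_pinfty// ge0_fin_numE.
pose nus : {sigma_finite_measure set 'rV[R]_n.+1 -> \bar R} :=
  HB.pack (Measure.sort nu) (Measure.class nu)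
    (Measure_isSigmaFinite.Build _ _ _ (Measure.sort nu) nu_sf).
by exists nus; rewrite /= -mE.
Qed.

Let lebesgue_rV0 n : @lebesgue_rV R n set0 = 0%E.
Proof. by have [m <-] := lebesgue_rV_sigma_finite_measure n. Qed.

Let lebesgue_rV_ge0 n A : (0 <= @lebesgue_rV R n A)%E.
Proof. by have [m <-] := lebesgue_rV_sigma_finite_measure n. Qed.

Let lebesgue_rV_sigma_additive n : semi_sigma_additive (@lebesgue_rV R n).
Proof.
have [m <-] := lebesgue_rV_sigma_finite_measure n.
exact: measure_semi_sigma_additive.
Qed.

HB.instance Definition _ n := isMeasure.Build _ _ _ (@lebesgue_rV R n)
  (lebesgue_rV0 n) (@lebesgue_rV_ge0 n) (@lebesgue_rV_sigma_additive n).

Let lebesgue_rV_sigma_finite n : sigma_finite setT (@lebesgue_rV R n).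
Proof.
have [m <-] := lebesgue_rV_sigma_finite_measure n.
exact: sigma_finiteT.
Qed.

HB.instance Definition _ n := Measure_isSigmaFinite.Build _ _ _
  (@lebesgue_rV R n) (@lebesgue_rV_sigma_finite n).

End lebesgue_rV_measure.

Arguments lebesgue_rV {R} n _.

Section domains.
Variables (R : realType) (d : nat).
Implicit Types (Omega : set 'rV[R]_d) (u : 'rV[R]_d -> R).

Definition boundary (A : set 'rV[R]_d) : set 'rV[R]_d := closure A `\` A°.

Definition simply_connected (A : set 'rV[R]_d) : Prop :=
  (forall x y, A x -> A y -> exists p : R -> 'rV[R]_d,
     [/\ {within `[0, 1], continuous p}, p @` `[0, 1] `<=` A,
         p 0 = x & p 1 = y]) /\
  (forall p : R -> 'rV[R]_d,
     {within `[0, 1], continuous p} -> p @` `[0, 1] `<=` A -> p 0 = p 1 ->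
     exists H : R * R -> 'rV[R]_d,
       [/\ {within `[0, 1] `*` `[0, 1], continuous H},
           H @` (`[0, 1] `*` `[0, 1]) `<=` A,
           (forall t, t \in `[0, 1] -> H (t, 0) = p t /\ H (t, 1) = p 0) &
           (forall s, s \in `[0, 1] -> H (0, s) = p 0 /\ H (1, s) = p 0)]).

End domains.

Section differentiable_classes.
Variables (R : realType) (n : nat).
Implicit Types (A : set 'rV[R]_n) (u : 'rV[R]_n -> R).

Definition partial (i : 'I_n) u : 'rV[R]_n -> R :=
  fun x => 'D_(delta_mx 0 i) u x.

Definition C1 u : Prop :=
  continuous u /\ forall i,
    (forall x, derivable u x (delta_mx 0 i)) /\ continuous (partial i u).

Definition C2 u : Prop := C1 u /\ forall i, C1 (partial i u).

(* C^1 of the closure of the open set A: u is continuous on the closure and its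
   first derivatives in A extend continuously to the closure. *)
Definition C1_closure A u : Prop :=
  {within closure A, continuous u} /\ forall i,
    (forall x, A x -> derivable u x (delta_mx 0 i)) /\
    exists v : 'rV[R]_n -> R,
      {within closure A, continuous v} /\ {in A, v =1 partial i u}.

Definition C1_compact_support A u : Prop :=
  [/\ C1 u, compact (closure [set x | u x != 0]) &
      closure [set x | u x != 0] `<=` A].

End differentiable_classes.

Section boundary_charts.
Variables (R : realType) (d : nat).
Implicit Types (Omega : set 'rV[R]_d).

(* A local description of Omega as one side of the graph of gamma, after
   relabelling and reorienting the coordinate axes: in the neighbourhood
   ball chart_center chart_radius (a cube, for the sup norm of 'rV), Omega is
   the set of points whose coordinate chart_axis, up to the sign chart_sign,
   is greater than gamma of the other coordinates. *)
Record chart := Chart {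
  chart_center : 'rV[R]_d;
  chart_radius : R;
  chart_axis : 'I_d;
  chart_sign : bool;
  chart_graph : 'rV[R]_d.-1 -> R }.

Definition chart_ball (k : chart) : set 'rV[R]_d :=
  ball (chart_center k) (chart_radius k).

Definition C2_chart Omega (k : chart) : Prop :=
  [/\ 0 < chart_radius k, C2 (chart_graph k) &
      Omega `&` chart_ball k =
      [set x | chart_ball k x /\
         chart_graph k (col' (chart_axis k) x) <
           (-1) ^+ chart_sign k * x 0 (chart_axis k)]].

Definition C2_boundary Omega : Prop :=
  forall x, boundary Omega x ->
    exists k, C2_chart Omega k /\ chart_center k = x.

(* The point of the graph above y. *)
Definition chart_point (k : chart) (y : 'rV[R]_d.-1) : 'rV[R]_d :=
  \row_j if unlift (chart_axis k) j is Some l then y 0 l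
         else (-1) ^+ chart_sign k * chart_graph k y.

(* The integral of f over the part of the boundary in the chart, with respect
   to the surface measure. *)
Definition chart_surface_integral (k : chart) (f : 'rV[R]_d -> R) : \bar R :=
  (\int[lebesgue_rV d.-1]_(y in chart_point k @^-1` chart_ball k)
     (f (chart_point k y) *
      Num.sqrt (1 + \sum_i partial i (chart_graph k) y ^+ 2))%:E)%E.

End boundary_charts.

(* Elements of L^p and H^1 are represented by Borel functions, considered up to
   almost everywhere equality on Omega. Test functions are C^1 with compact
   support; mollification shows that smooth ones give the same weak gradients
   and the same closure H10. *)
Section sobolev.
Variables (R : realType) (d : nat) (Omega : set 'rV[R]_d).
Notation mu := (lebesgue_rV d).
Implicit Types (u v phi h : 'rV[R]_d -> R).

Definition sqnorm_L2 u : \bar R :=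
  (\int[mu]_(x in Omega) ((u x) ^+ 2)%:E)%E.

Definition L2 u : Prop :=
  measurable_fun Omega u /\ (sqnorm_L2 u < +oo)%E.

Definition Linfty u : Prop :=
  measurable_fun Omega u /\
  exists M, {ae mu, forall x, Omega x -> `|u x| <= M}.

Definition is_weak_gradient u (G : 'I_d -> 'rV[R]_d -> R) : Prop :=
  forall i, L2 (G i) /\
    forall phi, C1_compact_support Omega phi ->
      \int[mu]_(x in Omega) (u x * partial i phi x) =
      - \int[mu]_(x in Omega) (G i x * phi x).

Definition H1 u : Prop := L2 u /\ exists G, is_weak_gradient u G.

(* A weak gradient of u; it is unique up to almost everywhere equality. *)
Definition weak_gradient u : 'I_d -> 'rV[R]_d -> R :=
  xget (fun _ _ => 0) [set G | is_weak_gradient u G].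

Definition sqnorm_H1 u : \bar R :=
  (sqnorm_L2 u + \sum_(i < d) sqnorm_L2 (weak_gradient u i))%E.

Definition cvg_H1 (u_ : nat -> 'rV[R]_d -> R) u : Prop :=
  sqnorm_H1 (u_ n \- u) @[n --> \oo] --> 0%E.

Definition H10 u : Prop :=
  H1 u /\ exists phi_ : nat -> 'rV[R]_d -> R,
    (forall n, C1_compact_support Omega (phi_ n)) /\ cvg_H1 phi_ u.

(* The trace operator is the continuous extension to H^1, with values in L^2 of
   the boundary, of the restriction of C^1 functions to the boundary. *)
Definition has_trace u h : Prop :=
  exists u_ : nat -> 'rV[R]_d -> R,
    [/\ forall n, C1_closure Omega (u_ n), cvg_H1 u_ u &
        forall k, C2_chart Omega k ->
          chart_surface_integral k (fun x => (u_ n x - h x) ^+ 2)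
            @[n --> \oo] --> 0%E].

(* Weak formulation of div (a grad u) = f in Omega, u = h on the boundary, where
   f is usually an expression in u itself. *)
Definition weak_solution (a : 'rV[R]_d -> R) (f : 'rV[R]_d -> R) h u : Prop :=
  [/\ H1 u, has_trace u h &
    forall phi, H10 phi ->
      mu.-integrable Omega (fun x => (f x * phi x)%:E) /\
      \int[mu]_(x in Omega)
        (a x * \sum_(i < d) weak_gradient u i x * weak_gradient phi i x) =
      - \int[mu]_(x in Omega) (f x * phi x)].

Definition ae_positive u : Prop := {ae mu, forall x, Omega x -> 0 < u x}.

Definition ae_equal u v : Prop := {ae mu, forall x, Omega x -> u x = v x}.

End sobolev.

Section problem.
Variables (R : realType) (d : nat) (Omega : set 'rV[R]_d).
Variables (a b c g : 'rV[R]_d -> R) (theta : R).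
Implicit Types Psi : 'rV[R]_d -> R.

Definition bdry_datum : 'rV[R]_d -> R := fun x => g x `^ (2 / (1 + theta)).

Definition positive_weak_solution Psi : Prop :=
  weak_solution Omega a
    (fun x => b x * Psi x + c x * `|Psi x| `^ (- (1 + theta)) * Psi x)
    bdry_datum Psi /\
  ae_positive Omega Psi.

(* The supremum is attained when g is continuous and positive on the compact
   set boundary Omega. *)
Definition h_max : R := sup (bdry_datum @` boundary Omega).

Definition nu_max : R := - theta * h_max `^ (- (1 + theta)).

(* powR is 1 at negative reals: the power of Psi_ n below has its usual meaning
   only where Psi_ n is nonnegative. *)
Definition iterates (Psi_ : nat -> 'rV[R]_d -> R) : Prop :=
  weak_solution Omega a
    (fun x => (b x + c x * nu_max) * Psi_ 0%N x) bdry_datum (Psi_ 0%N) /\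
  forall n, weak_solution Omega a
    (fun x => (b x + c x * nu_max) * Psi_ n.+1 x +
              c x * (Psi_ n x `^ (- theta) - nu_max * Psi_ n x))
    bdry_datum (Psi_ n.+1).

End problem.

(* Main.v *)
(* The weak solutions with boundary datum h = g^(2/(1+theta)) are the functions
   h + w with w in the closure H0 of the compactly supported C^1 functions. That
   a function of zero trace belongs to H0 is proved with cutoffs of width delta
   along the boundary: Hardy's inequality on the segments crossing the strip
   { height < delta } bounds the integral of u^2 there by delta times the trace
   plus delta^2 times the gradient on the strip.

   Write q = - theta and k t = nu t - t^q. On [0, h_max] the function k is
   nondecreasing with k' <= nu, so testing the equations with smooth
   truncations of the solution gives 0 <= Psi_n <= h_max. Testing the
   difference of the equations for Psi_m and Psi_n with Psi_m - Psi_n gives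
     X_(m,n) + Y_(m,n) / 2 <= Y_(m-1,n-1) / 2,
   where X_(m,n) is the integral of a |grad (Psi_m - Psi_n)|^2 and Y_(m,n) that
   of c nu (Psi_m - Psi_n)^2. Since Y <= C X by Poincare's inequality, this is
   a geometric decay, hence (Psi_n) is Cauchy; the limit solves the semilinear
   problem. It is positive because testing with a smooth version of
   (1 - Psi / delta)_+ bounds the measure of { Psi = 0 } by that of
   { 0 < Psi < delta }, and unique because the right-hand side is monotone. *)

From HB Require Import structures.
Require Import Defs.
From mathcomp Require Import all_boot all_order all_algebra.
From mathcomp Require Import all_classical all_reals all_analysis.
From mathcomp Require Import measurable_realfun ring lra.
Import Order.TTheory GRing.Theory Num.Theory.
Import numFieldNormedType.Exports.
Local Open Scope classical_set_scope.
Local Open Scope ring_scope.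

Set Implicit Arguments.
Unset Strict Implicit.
Unset Printing Implicit Defensive.

(** * Lebesgue measure on R^n *)

(** The map t |-> nu t - t^q is neither bounded nor Lipschitz on the whole line, and [powR] takes
    the value 1 at negative reals. The iteration is therefore run with [shifted_power], which first
    clamps its argument to [0, h_max]. Each linear step then has a bounded forcing term, and its
    solution lies between 0 and h_max whatever the previous iterate was; once these bounds are known
    the clamp is the identity and the given iterates are recovered. Since the clamped map vanishes
    at 0, Psi_0 is the step that starts from the zero function, so one recursion covers all
    iterates.

    Truncations have a bounded Lipschitz derivative because the weak gradient and the trace of F(u)
    are obtained from approximants of class C^1 up to the boundary, along which F' has to converge
    as well.

    With Y <= D X, the displayed inequality gives Y_(m,n) <= D / (D + 2) Y_(m-1,n-1). The datum
    g^(2/(1+theta)) is of class C^1 up to the boundary because g > K0 > 0 on the closure, so it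
    serves as its own extension into Omega. *)

Section rV_topology.
Variables (R : realType) (n : nat).
Implicit Types (A : set 'rV[R]_n) (x y : 'rV[R]_n) (e : R).

Lemma rV_ballP x e y : ball x e y <-> 0 < e /\ forall i, `|x 0 i - y 0 i| < e.
Proof.
split=> [[e0 H]|[e0 H]]; first by split=> // i; exact: H.
by split => // i j; rewrite ord1; exact: H.
Qed.

Lemma rV_measurable_ball x e : measurable (ball x e).
Proof.
have [e0|e0] := ltP 0 e; last first.
  rewrite (_ : ball x e = set0)//; apply/seteqP; split => // y /rV_ballP[].
  by rewrite ltNge e0.
rewrite (_ : ball x e = \bigcap_(i in [set: 'I_n])
    ((fun y : 'rV[R]_n => (y 0 i : measurableTypeR R)) @^-1` ball (x 0 i) e)).
  apply: fin_bigcap_measurable => // i _.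
  rewrite -[X in measurable X]setTI.
  apply: measurable_rV_coord => //; apply: open_measurable; exact: ball_open.
apply/seteqP; split => y.
  by move=> /rV_ballP[_ H] i _ /=; exact: H.
by move=> H; apply/rV_ballP; split => // i; exact: (H i).
Qed.

(** Rational centers with radii 1/(m+1) give countably many balls, enumerated by [pickle]; a code
    that names no ball inside [A] yields the empty set. *)
Lemma rV_open_bigcup_ball A : open A -> exists B : nat -> set 'rV[R]_n,
  (forall k, B k = set0 \/ exists x e, 0 < e /\ B k = ball x e) /\
  A = \bigcup_k B k.
Proof.
move=> oA.
pose q2r (q : 'rV[rat]_n) : 'rV[R]_n := map_mx (@ratr R) q.
pose B (j : nat) := if unpickle j is Some (q, m) then
   if `[< ball (q2r q) (m : nat).+1%:R^-1 `<=` A >] then ball (q2r q) m.+1%:R^-1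
   else set0 else set0.
exists B; split=> [k|].
  rewrite /B; case: unpickle => [[q m]|]; last by left.
  case: ifPn => _; last by left.
  by right; exists (q2r q), m.+1%:R^-1.
apply/seteqP; split => [x Ax|x [k _]]; last first.
  rewrite /B; case: unpickle => [[q m]|//].
  by case: ifPn => [/asboolP H /H|].
have /nbhs_ballP[e /= e0 eA] : nbhs x A by exact: open_nbhs_nbhs.
(* A ball of radius below [e / 2] that contains x stays inside [ball x e]. *)
have [m me] : exists m, m.+1%:R^-1 < e / 2.
  have := near_infty_natSinv_lt (PosNum (divr_gt0 e0 (ltr0n _ 2))).
  by move=> [m _ H]; exists m; exact: (H m (leqnn _)).
have m0 : 0 < m.+1%:R^-1 :> R by rewrite invr_gt0.
have /choice[q Hq] : forall i, exists q : rat, x 0 i < ratr q < x 0 i + m.+1%:R^-1.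
  move=> i; have [|q /andP[q1 q2]] := @rat_in_itvoo R (x 0 i) (x 0 i + m.+1%:R^-1).
    by rewrite ltrDl.
  by exists q; move: q1 q2; rewrite !bnd_simp => -> ->.
have xb : ball (q2r (\row_i q i)) m.+1%:R^-1 x.
  apply/rV_ballP; split => // i; rewrite !mxE.
  by have /andP[q1 q2] := Hq i; rewrite gtr0_norm ?subr_gt0// ltrBlDl.
exists (pickle (\row_i q i, m)) => //=; rewrite /B pickleK.
case: ifPn => // /asboolP[] y yb; apply: eA.
rewrite (splitr e); apply: (@ball_triangle _ _ (q2r (\row_i q i))).
  by apply: ball_sym; apply: le_ball xb; exact: ltW.
by apply: le_ball yb; exact: ltW.
Qed.

Lemma rV_open_measurable A : open A -> measurable A.
Proof.
move=> /rV_open_bigcup_ball[B [HB ->]]; apply: bigcup_measurable => k _.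
by have [->|[x [e [_ ->]]]] := HB k; [exact: measurable0|exact: rV_measurable_ball].
Qed.

Lemma rV_continuous_measurable A (f : 'rV[R]_n -> R) :
  open A -> {within A, continuous f} -> measurable_fun A f.
Proof.
move=> oA /continuousP cf.
apply: (measurability _ (RGenOpens.measurableE R)).
move=> _ [_ [a [b ->] <-]]; apply: rV_open_measurable.
have := cf _ (interval_open _ _).
by rewrite open_setSI//; exact.
Qed.

End rV_topology.

(** * Tonelli's theorem along an arbitrary coordinate axis *)

Section rV_tonelli.
Variable R : realType.
Local Open Scope ereal_scope.

Definition rV_insert n (i : 'I_n.+1) (t : R) (y : 'rV[R]_n) : 'rV[R]_n.+1 :=
  \row_j if unlift i j is Some l then y 0%R l else t.

Lemma rV_insert_id n (i : 'I_n.+1) t y : rV_insert i t y 0%R i = t.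
Proof. by rewrite mxE unlift_none. Qed.

Lemma rV_insert_lift n (i : 'I_n.+1) t y j : rV_insert i t y 0%R (lift i j) = y 0%R j.
Proof. by rewrite mxE liftK. Qed.

Lemma col'_rV_insert n (i : 'I_n.+1) t y : col' i (rV_insert i t y) = y.
Proof. by apply/rowP => j; rewrite mxE rV_insert_lift. Qed.

Lemma rV_insert_col' n (i : 'I_n.+1) (x : 'rV[R]_n.+1) :
  rV_insert i (x 0%R i) (col' i x) = x.
Proof.
by apply/rowP => j; rewrite !mxE; case: unliftP => [k ->|->//]; rewrite mxE.
Qed.

Lemma measurable_rV_insert n (i : 'I_n.+1) :
  measurable_fun [set: measurableTypeR R * 'rV[R]_n]
    (fun p : measurableTypeR R * 'rV[R]_n => rV_insert i p.1 p.2).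
Proof.
apply: measurable_fun_rVP => j; case: (unliftP i j) => [k ->|->].
  rewrite [X in measurable_fun _ X](_ : _ =
    (fun y : 'rV[R]_n => (y 0%R k : measurableTypeR R)) \o snd).
    by apply: measurableT_comp => //; exact: measurable_rV_coord.
  by apply/funext => -[t y] /=; rewrite rV_insert_lift.
rewrite [X in measurable_fun _ X](_ : _ = fst); first exact: measurable_fst.
by apply/funext => -[t y] /=; rewrite rV_insert_id.
Qed.

Lemma rV_consE n t (y : 'rV[R]_n) : rV_cons (t, y) = rV_insert 0%R t y.
Proof.
apply/rowP => j; rewrite /rV_cons /=.
case: (unliftP 0%R j) => [k ->|->]; rewrite ?rV_insert_lift ?rV_insert_id.
  have -> : lift 0%R k = rshift 1 k by exact/val_inj.
  exact: row_mxEr.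
have -> : (0%R : 'I_n.+1) = lshift n (0%R : 'I_1) by exact/val_inj.
by rewrite [LHS]row_mxEl mxE eqxx mulr1n.
Qed.

(** The two insertions commute; this is what lets an induction on the dimension peel off coordinate
    0 while another coordinate is being integrated. *)
Lemma rV_insert_cons n (j : 'I_n.+1) s t (z : 'rV[R]_n) :
  rV_insert (lift 0%R j) s (rV_cons (t, z)) = rV_cons (t, rV_insert j s z).
Proof.
rewrite !rV_consE; apply/rowP => k.
case: (unliftP 0%R k) => [{}k ->|->].
  rewrite rV_insert_lift; case: (unliftP j k) => [l ->|->].
    rewrite rV_insert_lift.
    have -> : lift 0%R (lift j l) = lift (lift 0%R j) (lift 0%R l).
      by apply/val_inj; rewrite /= /bump /= !add1n ltnS addnS.
    by rewrite !rV_insert_lift.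
  by rewrite !rV_insert_id.
have e : (0%R : 'I_n.+2) = lift (lift 0%R j) 0%R by exact/val_inj.
by rewrite [in LHS]e rV_insert_lift !rV_insert_id.
Qed.

Let leb : {sigma_finite_measure set (measurableTypeR R) -> \bar R} := @lebesgue_measure R.
Let lebn n : {sigma_finite_measure set 'rV[R]_n -> \bar R} := @lebesgue_rV R n.

Lemma measurable_fun_rV_section n (i : 'I_n.+1) (f : 'rV[R]_n.+1 -> \bar R) :
  measurable_fun setT f -> (forall x, 0 <= f x) ->
  measurable_fun setT (fun y : 'rV[R]_n => \int[leb]_t f (rV_insert i t y)).
Proof.
move=> mf f0.
pose F (p : measurableTypeR R * 'rV[R]_n) := f (rV_insert i p.1 p.2).
have mF : measurable_fun setT F.
  by apply: measurableT_comp => //; exact: measurable_rV_insert.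
have := @measurable_fun_fubini_tonelli_G _ _ _ _ R leb F mF.
by apply => p; exact: f0.
Qed.

Lemma ge0_integral_rV_cons n (f : 'rV[R]_n.+1 -> \bar R) :
  measurable_fun setT f -> (forall x, 0 <= f x) ->
  \int[lebesgue_rV n.+1]_x f x = \int[leb]_t \int[lebesgue_rV n]_y f (rV_cons (t, y)).
Proof.
move=> mf f0.
have mF : measurable_fun setT (f \o @rV_cons R n).
  by apply: measurableT_comp => //; exact: measurable_rV_cons.
rewrite -(@fubini_tonelli1 _ _ _ _ R leb (lebn n) (f \o @rV_cons R n))//; last first.
  by move=> p; exact: f0.
have := @ge0_integral_pushforward _ _ _ _ R _ (@measurable_rV_cons R n)
  (leb \x lebn n)%E setT f.
rewrite preimage_setT; apply => //.
Qed.

(** The measure is an iterated product that splits off coordinate 0. For [i = 0] only the order of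
    integration changes; for [i = lift 0 j], coordinate 0 is peeled off on both sides and the
    induction hypothesis is applied under that integral. *)
Lemma tonelli_rV_insert n (i : 'I_n.+1) (f : 'rV[R]_n.+1 -> \bar R) :
  measurable_fun setT f -> (forall x, 0 <= f x) ->
  \int[lebesgue_rV n.+1]_x f x =
  \int[lebesgue_rV n]_y \int[leb]_t f (rV_insert i t y).
Proof.
elim: n i f => [|n IH] i f mf f0; rewrite ge0_integral_rV_cons//.
  rewrite ord1; under eq_integral do under eq_integral do rewrite rV_consE.
  pose F (p : measurableTypeR R * 'rV[R]_0) := f (rV_insert 0%R p.1 p.2).
  rewrite (@fubini_tonelli _ _ _ _ R leb (lebn 0) F)//.
    by apply: measurableT_comp => //; exact: measurable_rV_insert.
  by move=> p; exact: f0.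
case: (unliftP 0%R i) => [j ->|->]; last first.
  under eq_integral do under eq_integral do rewrite rV_consE.
  pose F (p : measurableTypeR R * 'rV[R]_n.+1) := f (rV_insert 0%R p.1 p.2).
  rewrite (@fubini_tonelli _ _ _ _ R leb (lebn n.+1) F)//.
    by apply: measurableT_comp => //; exact: measurable_rV_insert.
  by move=> p; exact: f0.
rewrite [RHS]ge0_integral_rV_cons; last 2 first.
  exact: measurable_fun_rV_section.
  by move=> y; apply: integral_ge0.
apply: eq_integral => t _.
under [RHS]eq_integral do under eq_integral do rewrite rV_insert_cons.
apply: (IH j (fun y => f (rV_cons (t, y)))) => //.
apply: measurableT_comp => //.
rewrite [X in measurable_fun _ X](_ : _ = @rV_cons R n.+1 \o pair t)//.
apply: measurableT_comp; first exact: measurable_rV_cons.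
exact: measurable_pair1.
Qed.

Lemma lebesgue_rV_cube_lty n (M : R) :
  lebesgue_rV n [set x : 'rV[R]_n | forall i, (`|x 0 i| <= M)%R] < +oo.
Proof.
elim: n => [|n IH].
  have -> : [set x : 'rV[R]_0 | forall i, (`|x 0%R i| <= M)%R] = setT.
    by apply/seteqP; split => // x _ [].
  by rewrite /= diracT ltry.
rewrite /= /pushforward.
have -> : @rV_cons R n @^-1` [set x | forall i, (`|x 0%R i| <= M)%R] =
  (`[(- M)%R, M] : set (measurableTypeR R)) `*`
  [set x : 'rV[R]_n | forall i, (`|x 0%R i| <= M)%R].
  apply/seteqP; split => -[t y] /=.
    move=> H; split.
      by have := H 0%R; rewrite rV_consE rV_insert_id in_itv/= ler_norml.
    by move=> j; have := H (lift 0%R j); rewrite rV_consE rV_insert_lift.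
  rewrite in_itv/= => -[H1 H2] j; rewrite rV_consE.
  case: (unliftP 0%R j) => [k ->|->]; rewrite ?rV_insert_lift ?rV_insert_id//.
  by rewrite ler_norml.
rewrite product_measure1E//=; last first.
  rewrite (_ : mkset _ = \bigcap_(i in [set: 'I_n])
    ((fun y : 'rV[R]_n => (y 0%R i : measurableTypeR R)) @^-1` `[(- M)%R, M])).
    apply: fin_bigcap_measurable => // i _.
    by rewrite -[X in measurable X]setTI; exact: measurable_rV_coord.
  apply/seteqP; split => y /=.
    by move=> H i _ /=; rewrite in_itv/= -ler_norml.
  by move=> H i; have := H i I; rewrite /= in_itv/= -ler_norml.
apply: lte_mul_pinfty => //.
by rewrite lebesgue_measure_itv /=; case: ifP.
Qed.

End rV_tonelli.

Lemma lebesgue_rV_bounded_lty (R : realType) n (A : set 'rV[R]_n) :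
  measurable A -> bounded_set A -> (lebesgue_rV n A < +oo)%E.
Proof.
move=> mA [M [_ HM]].
apply: le_lt_trans (lebesgue_rV_cube_lty n (M + 1)).
apply: le_measure; rewrite ?inE//.
  rewrite (_ : mkset _ = \bigcap_(i in [set: 'I_n])
    ((fun y : 'rV[R]_n => (y 0 i : measurableTypeR R)) @^-1` `[(- (M + 1)), (M + 1)])).
    apply: fin_bigcap_measurable => // i _.
    by rewrite -[X in measurable X]setTI; exact: measurable_rV_coord.
  apply/seteqP; split => y /=.
    by move=> H i _ /=; rewrite in_itv/= -ler_norml.
  by move=> H i; have := H i I; rewrite /= in_itv/= -ler_norml.
move=> x Ax i.
have := HM (M + 1); rewrite ltrDl => /(_ ltr01 _ Ax).
apply: le_trans.
rewrite [leRHS]mx_normrE.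
exact: (le_bigmax _ (fun ij : 'I_1 * 'I_n => `|x ij.1 ij.2|) (0, i)).
Qed.

(** The set function [lebesgue_rV] typed as a measure, in the form expected by results that quantify
    over measures; the two are convertible. *)
Definition leb_rV (R : realType) n : {measure set 'rV[R]_n -> \bar R} := @lebesgue_rV R n.

(** * Square integrable functions *)

Section real_sequences.
Variable R : realType.
Implicit Types (f g : nat -> R) (l : R).

Lemma ler_sqr_norm (x y : R) : (x ^+ 2 <= y ^+ 2) = (`|x| <= `|y|).
Proof.
by rewrite -(real_normK (num_real x)) -(real_normK (num_real y)) ler_pXn2r// nnegrE.
Qed.

Lemma cvg_dist_le f g l : (forall n, `|f n - l| <= g n) ->
  g n @[n --> \oo] --> 0 -> f n @[n --> \oo] --> l.
Proof.
move=> fg g0; apply/subr_cvg0.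
apply: (@squeeze_cvgr _ _ _ _ (fun n => - g n) g) => //.
  by apply: nearW => n; rewrite -ler_norml.
by rewrite -oppr0; exact: cvgN.
Qed.

Lemma cvg_ge0_le f g : (forall n, 0 <= f n <= g n) ->
  g n @[n --> \oo] --> 0 -> f n @[n --> \oo] --> 0.
Proof.
move=> fg; apply: cvg_dist_le => n; have /andP[f0 ?] := fg n.
by rewrite subr0 ger0_norm.
Qed.

Lemma cvg0_ltP f : (forall n, 0 <= f n) -> f n @[n --> \oo] --> 0 <->
  forall e, 0 < e -> exists N, forall n, (N <= n)%N -> f n < e.
Proof.
move=> f0; split=> [/cvgr0_norm_lt h e e0|h].
  have [N _ H] := h e e0; exists N => n Nn.
  by have := H n Nn; rewrite ger0_norm.
apply/cvgr0Pnorm_lt => e e0; have [N H] := h e e0.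
by exists N => // n /= /H; rewrite ger0_norm.
Qed.

Lemma EFin_cvg f l : f n @[n --> \oo] --> l -> (f n)%:E @[n --> \oo] --> l%:E.
Proof. by move=> h; apply: cvg_EFin => //; exact: nearW. Qed.

Lemma cvgr_to_ge f l (a : R) : f n @[n --> \oo] --> l ->
  (forall n, a <= f n) -> a <= l.
Proof.
move=> h H; have hc : cvgn f by apply/cvg_ex; exists l.
by rewrite -(cvg_lim _ h)//; apply: limr_ge => //; exact: nearW.
Qed.

End real_sequences.

Section square_integrable.
Context d (T : measurableType d) (R : realType).
Variables (mu : {measure set T -> \bar R}) (D : set T).
Hypotheses (mD : measurable D) (muD : (mu D < +oo)%E).
Implicit Types (u v w f g : T -> R).

Definition summable f := mu.-integrable D (EFin \o f).

Definition sqint u : Prop :=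
  measurable_fun D u /\ (\int[mu]_(x in D) ((u x) ^+ 2)%:E < +oo)%E.

Definition nrm2 u : R := \int[mu]_(x in D) (u x ^+ 2).

Lemma sqint_meas u : sqint u -> measurable_fun D u. Proof. by case. Qed.

Lemma summable_meas f : summable f -> measurable_fun D f.
Proof. by move=> /measurable_int/measurable_EFinP. Qed.

Lemma measurable_sqr u : measurable_fun D u ->
  measurable_fun D (fun x => (u x ^+ 2)%:E).
Proof. by move=> mu_; apply/measurable_EFinP; exact: measurable_funX. Qed.

Lemma sqintP u : sqint u <-> measurable_fun D u /\ summable (fun x => u x ^+ 2).
Proof.
split=> -[mu_ h]; split => //.
  apply/integrableP; split; first exact: measurable_sqr.
  by under eq_integral do rewrite /= ger0_norm ?sqr_ge0//.
move/integrableP : h => [_].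
by under eq_integral do rewrite /= ger0_norm ?sqr_ge0//.
Qed.

Lemma summable_fin_num f : summable f -> (\int[mu]_(x in D) (f x)%:E)%E \is a fin_num.
Proof. exact: integrable_fin_num. Qed.

Lemma sqnormE u : sqint u -> (\int[mu]_(x in D) ((u x) ^+ 2)%:E)%E = (nrm2 u)%:E.
Proof. by move=> /sqintP[_ /summable_fin_num h]; rewrite fineK. Qed.

Lemma nrm2_ge0 u : 0 <= nrm2 u.
Proof. by apply: Rintegral_ge0 => x _; exact: sqr_ge0. Qed.

Lemma summable_le f g : measurable_fun D f -> summable g ->
  {ae mu, forall x, D x -> `|f x| <= g x} -> summable f.
Proof.
move=> mf ig fg; apply/integrableP; split; first exact/measurable_EFinP.
have /integrableP[mg] := ig; apply: le_lt_trans; apply: ae_ge0_le_integral => //.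
- by apply/measurable_EFinP/measurableT_comp.
- by apply/measurable_EFinP/measurableT_comp => //; exact/measurable_EFinP.
- apply: filterS fg => x h Dx /=; rewrite lee_fin.
  by apply: (le_trans (h Dx)); exact: ler_norm.
Qed.

Lemma summableD f g : summable f -> summable g -> summable (fun x => f x + g x).
Proof. by move=> sf sg; have := integrableD mD sf sg; exact: eq_integrable. Qed.

Lemma summableN f : summable f -> summable (fun x => - f x).
Proof. by move=> sf; have := integrableN sf; exact: eq_integrable. Qed.

Lemma summableB f g : summable f -> summable g -> summable (fun x => f x - g x).
Proof. by move=> sf sg; apply: summableD => //; exact: summableN. Qed.

Lemma summableZ (k : R) f : summable f -> summable (fun x => k * f x).
Proof. by move=> sf; have := integrableZl mD k sf; exact: eq_integrable. Qed.

Lemma summable_sum n (F : 'I_n -> T -> R) : (forall i, summable (F i)) ->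
  summable (fun x => \sum_(i < n) F i x).
Proof.
move=> h; have := @integrable_sum _ _ _ mu D mD 'I_n (index_enum 'I_n) xpredT
  (fun i => EFin \o F i) (fun i _ => h i).
by apply: eq_integrable => // x _; rewrite /= sumEFin.
Qed.

Lemma Rintegral_sum n (F : 'I_n -> T -> R) : (forall i, summable (F i)) ->
  \int[mu]_(x in D) (\sum_(i < n) F i x) = \sum_(i < n) \int[mu]_(x in D) F i x.
Proof.
elim: n F => [|n IH] F h.
  rewrite big_ord0 -[RHS](mul0r (fine (mu D))) -Rintegral_cst//.
  by apply: eq_Rintegral => x _; rewrite big_ord0.
rewrite big_ord_recr/= -IH//.
rewrite -RintegralD//; [|by apply: summable_sum => i; exact: h|exact: h].
by apply: eq_Rintegral => x _; rewrite big_ord_recr.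
Qed.

Lemma RintegralN f : summable f -> \int[mu]_(x in D) (- f x) = - \int[mu]_(x in D) f x.
Proof.
move=> sf; rewrite -[RHS]mulN1r -RintegralZl//.
by apply: eq_Rintegral => x _; rewrite mulN1r.
Qed.

Lemma ae_le_Rintegral f g : summable f -> summable g ->
  {ae mu, forall x, D x -> f x <= g x} ->
  \int[mu]_(x in D) f x <= \int[mu]_(x in D) g x.
Proof.
move=> sf sg fg; rewrite -subr_ge0 -RintegralB//.
(* The positive part agrees with [g - f] almost everywhere and is nonnegative everywhere. *)
pose h x := Num.max (g x - f x) 0.
have mf := summable_meas sf; have mg := summable_meas sg.
have mgf : measurable_fun D (fun x => g x - f x) by exact: measurable_funB.
have mh : measurable_fun D h by apply: measurable_maxr.
have -> : \int[mu]_(x in D) (g x - f x) = \int[mu]_(x in D) h x.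
  congr fine; apply: ae_eq_integral => //; try exact/measurable_EFinP.
  apply: filterS fg => x H Dx; rewrite /h max_l// subr_ge0; exact: H.
by apply: Rintegral_ge0 => x _; rewrite /h le_max lexx orbT.
Qed.

Lemma ae_eq_Rintegral f g : measurable_fun D f -> measurable_fun D g ->
  {ae mu, forall x, D x -> f x = g x} ->
  \int[mu]_(x in D) f x = \int[mu]_(x in D) g x.
Proof.
move=> mf mg fg; congr fine; apply: ae_eq_integral => //; try exact/measurable_EFinP.
by apply: filterS fg => x H Dx; rewrite H.
Qed.

Lemma Rintegral_eq0_ae f : summable f -> {ae mu, forall x, D x -> 0 <= f x} ->
  \int[mu]_(x in D) f x <= 0 -> {ae mu, forall x, D x -> f x = 0}.
Proof.
move=> sf f0 If.
have mf := summable_meas sf.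
have e : (\int[mu]_(x in D) `|(f x)%:E|)%E = (\int[mu]_(x in D) (f x)%:E)%E.
  apply: ae_eq_integral => //.
  - by apply/measurable_EFinP; exact: measurableT_comp.
  - exact/measurable_EFinP.
  by apply: filterS f0 => x H Dx; rewrite /= ger0_norm// H.
have I0 : (\int[mu]_(x in D) `|(f x)%:E|)%E = 0%E.
  apply/eqP; rewrite eq_le integral_ge0// andbT e.
  by rewrite -(fineK (summable_fin_num sf)) lee_fin.
have /(ae_eq_integral_abs mu mD) : measurable_fun D (EFin \o f) by exact/measurable_EFinP.
move=> [/(_ I0) h _].
by apply: filterS h => x H Dx; have [] := H Dx.
Qed.

Lemma sqint_mul u v : sqint u -> sqint v -> summable (fun x => u x * v x).
Proof.
move=> /sqintP[mu_ su] /sqintP[mv sv].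
apply: (@summable_le _ (fun x => u x ^+ 2 + v x ^+ 2)).
- exact: measurable_funM.
- exact: summableD.
- apply: aeW => x _; rewrite normrM -(real_normK (num_real (u x))).
  rewrite -(real_normK (num_real (v x))).
  have : 0 <= (`|u x| - `|v x|) ^+ 2 by exact: sqr_ge0.
  have := normr_ge0 (u x); have := normr_ge0 (v x); nra.
Qed.

Lemma sqint_le u v : measurable_fun D u -> sqint v ->
  {ae mu, forall x, D x -> `|u x| <= `|v x|} -> sqint u.
Proof.
move=> mu_ /sqintP[mv sv] uv; apply/sqintP; split => //.
apply: summable_le sv _; first exact: measurable_funX.
apply: filterS uv => x H Dx; rewrite ger0_norm ?sqr_ge0//.
by rewrite ler_sqr_norm; exact: H.
Qed.

Lemma summable_bounded f (M : R) : measurable_fun D f ->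
  {ae mu, forall x, D x -> `|f x| <= M} -> summable f.
Proof.
move=> mf fM; apply: (@summable_le _ (cst M)) => //.
apply/integrableP; split; first by apply/measurable_EFinP; exact: measurable_cst.
rewrite (_ : (fun x => _) = cst `|M|%:E)//.
by rewrite integral_cst//= lte_mul_pinfty.
Qed.

Lemma sqint_bounded f (M : R) : measurable_fun D f ->
  {ae mu, forall x, D x -> `|f x| <= M} -> sqint f.
Proof.
move=> mf fM; apply/sqintP; split => //.
apply: (@summable_bounded _ (M ^+ 2)); first exact: measurable_funX.
apply: filterS fM => x H Dx; rewrite normrX lerXn2r ?nnegrE//; last exact: H.
by apply: le_trans (H Dx).
Qed.

Lemma sqintZ (k : R) u : sqint u -> sqint (fun x => k * u x).
Proof.
move=> /sqintP[mu_ su]; apply/sqintP; split; first exact: measurable_funM.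
by have := summableZ (k ^+ 2) su; apply: eq_integrable => // x _; rewrite /= exprMn.
Qed.

Lemma sqintN u : sqint u -> sqint (fun x => - u x).
Proof.
move=> /(sqintZ (-1)); congr sqint; by apply/funext => x; rewrite mulN1r.
Qed.

Lemma sqintD u v : sqint u -> sqint v -> sqint (fun x => u x + v x).
Proof.
move=> su sv; have /sqintP[mu_ su2] := su; have /sqintP[mv sv2] := sv.
apply/sqintP; split; first exact: measurable_funD.
have suv := sqint_mul su sv.
have := summableD (summableD su2 sv2) (summableZ 2 suv).
by apply: eq_integrable => // x _; rewrite /= sqrrD; congr EFin; ring.
Qed.

Lemma sqintB u v : sqint u -> sqint v -> sqint (fun x => u x - v x).
Proof. by move=> su sv; apply: sqintD => //; exact: sqintN. Qed.

Lemma sqint_bmul (M : R) (m u : T -> R) : measurable_fun D m ->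
  {ae mu, forall x, D x -> `|m x| <= M} -> sqint u -> sqint (fun x => m x * u x).
Proof.
move=> mm mM su; apply: (sqint_le _ (sqintZ M su)).
  by apply: measurable_funM => //; exact: sqint_meas.
apply: filterS mM => x H Dx; rewrite !normrM ler_wpM2r//.
by apply: (le_trans (H Dx)); exact: ler_norm.
Qed.

Lemma nrm2_le u v : measurable_fun D u -> sqint v ->
  {ae mu, forall x, D x -> `|u x| <= `|v x|} -> nrm2 u <= nrm2 v.
Proof.
move=> mu_ sv uv; have /sqintP[_ su] := sqint_le mu_ sv uv.
move/sqintP : sv => [mv sv]; apply: ae_le_Rintegral => //.
by apply: filterS uv => x H Dx; rewrite ler_sqr_norm; exact: H.
Qed.

Lemma nrm2_ae_eq u v : measurable_fun D u -> measurable_fun D v ->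
  {ae mu, forall x, D x -> u x = v x} -> nrm2 u = nrm2 v.
Proof.
move=> mu_ mv uv; apply: ae_eq_Rintegral; try exact: measurable_funX.
by apply: filterS uv => x H Dx; rewrite H.
Qed.

Lemma nrm2Z (k : R) u : sqint u -> nrm2 (fun x => k * u x) = k ^+ 2 * nrm2 u.
Proof.
move=> /sqintP[_ su]; rewrite -RintegralZl//.
by apply: eq_Rintegral => x _; rewrite exprMn.
Qed.

Lemma nrm2N u : nrm2 (fun x => - u x) = nrm2 u.
Proof. by apply: eq_Rintegral => x _; rewrite sqrrN. Qed.

Lemma nrm2_cst0 : nrm2 (cst 0) = 0.
Proof.
rewrite /nrm2 -[RHS](mul0r (fine (mu D))) -Rintegral_cst//.
by apply: eq_Rintegral => x _; rewrite /= expr0n.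
Qed.

Lemma nrm2_subrr u : nrm2 (fun x => u x - u x) = 0.
Proof.
rewrite -[RHS]nrm2_cst0; apply: eq_Rintegral => x _.
by rewrite subrr.
Qed.

Lemma nrm2D_le u v : sqint u -> sqint v ->
  nrm2 (fun x => u x + v x) <= 2 * nrm2 u + 2 * nrm2 v.
Proof.
move=> su sv; have /sqintP[_ suv] := sqintD su sv.
move: su sv => /sqintP[_ su] /sqintP[_ sv].
rewrite -!RintegralZl// -RintegralD//; try exact: summableZ.
apply: le_Rintegral => //; first by apply: summableD; exact: summableZ.
move=> x _; have : 0 <= (u x - v x) ^+ 2 by exact: sqr_ge0.
nra.
Qed.

Lemma nrm2B_le u v : sqint u -> sqint v ->
  nrm2 (fun x => u x - v x) <= 2 * nrm2 u + 2 * nrm2 v.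
Proof.
by move=> su sv; rewrite -(nrm2N v); apply: nrm2D_le => //; exact: sqintN.
Qed.

Lemma nrm2_bmul (M : R) (m u : T -> R) : measurable_fun D m -> 0 <= M ->
  {ae mu, forall x, D x -> `|m x| <= M} -> sqint u ->
  nrm2 (fun x => m x * u x) <= M ^+ 2 * nrm2 u.
Proof.
move=> mm M0 mM su; rewrite -nrm2Z//; apply: nrm2_le.
- by apply: measurable_funM => //; exact: sqint_meas.
- exact: sqintZ.
- apply: filterS mM => x H Dx; rewrite !normrM ler_wpM2r//.
  by rewrite (ger0_norm M0); exact: H.
Qed.

Lemma nrm2_eq0 u : sqint u -> nrm2 u <= 0 -> {ae mu, forall x, D x -> u x = 0}.
Proof.
move=> /sqintP[_ su] u0.
have := @Rintegral_eq0_ae _ su _ u0; move=> /(_ _)[].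
  by apply: aeW => x _; exact: sqr_ge0.
move=> N h; exists N; move: h => [mN N0 h]; split => // x H; apply: h => /=.
by move=> K; apply: H => Dx; apply/eqP; rewrite -sqrf_eq0; apply/eqP/K.
Qed.

(** The polynomial t |-> N (t u + v) is nonnegative. It is evaluated at its minimizer, or, when
    [nrm2 u = 0], at the point where the remaining affine function would equal -1 if [I] were
    nonzero. *)
Lemma cauchy_schwarz u v : sqint u -> sqint v ->
  (\int[mu]_(x in D) (u x * v x)) ^+ 2 <= nrm2 u * nrm2 v.
Proof.
move=> su sv; have suv := sqint_mul su sv.
set I := \int[mu]_(x in D) _.
have key t : 0 <= t ^+ 2 * nrm2 u + 2 * t * I + nrm2 v.
  have -> : t ^+ 2 * nrm2 u + 2 * t * I + nrm2 v = nrm2 (fun x => t * u x + v x).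
    move: (su) (sv) => /sqintP[_ su2] /sqintP[_ sv2].
    rewrite -!RintegralZl// -!RintegralD//; try exact: summableZ; last first.
      by apply: summableD; exact: summableZ.
    by apply: eq_Rintegral => x _; ring.
  exact: nrm2_ge0.
have u0 := nrm2_ge0 u; have v0 := nrm2_ge0 v.
have [U0|U0] := ltP 0 (nrm2 u).
  have := key (- I / nrm2 u).
  rewrite -(ler_pM2r U0) mul0r.
  have -> : ((- I / nrm2 u) ^+ 2 * nrm2 u + 2 * (- I / nrm2 u) * I + nrm2 v) * nrm2 u
     = nrm2 u * nrm2 v - I ^+ 2 by field; rewrite gt_eqF.
  by rewrite subr_ge0.
have U : nrm2 u = 0 by apply/eqP; rewrite eq_le U0 u0.
have [I0|I0] := eqVneq I 0; first by rewrite I0 expr0n/= mulr_ge0.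
have := key (- (nrm2 v + 1) / (2 * I)).
rewrite U mulr0 add0r.
have -> : 2 * (- (nrm2 v + 1) / (2 * I)) * I = - (nrm2 v + 1) by field.
lra.
Qed.

Lemma holder_abs u v : sqint u -> sqint v ->
  `|\int[mu]_(x in D) (u x * v x)| <= Num.sqrt (nrm2 u) * Num.sqrt (nrm2 v).
Proof.
move=> su sv; rewrite -sqrtrM ?nrm2_ge0// -sqrtr_sqr ler_wsqrtr//.
exact: cauchy_schwarz.
Qed.

Lemma cvg_Rintegral_mul (u_ : nat -> T -> R) u v :
  (forall n, sqint (u_ n)) -> sqint u -> sqint v ->
  nrm2 (fun x => u_ n x - u x) @[n --> \oo] --> 0 ->
  \int[mu]_(x in D) (u_ n x * v x) @[n --> \oo] --> \int[mu]_(x in D) (u x * v x).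
Proof.
move=> su_ su sv cu.
pose g n := Num.sqrt (nrm2 (fun x => u_ n x - u x)) * Num.sqrt (nrm2 v).
apply: (@cvg_dist_le _ _ g) => [n|].
  rewrite -RintegralB//; try exact: sqint_mul.
  rewrite (_ : (fun x => _) = fun x => (u_ n x - u x) * v x).
    by apply: holder_abs => //; exact: sqintB.
  by apply/funext => x; rewrite mulrBl.
rewrite -(mul0r (Num.sqrt (nrm2 v))); apply: cvgM; last exact: cvg_cst.
rewrite -sqrtr0; apply: continuous_cvg => //; exact: sqrt_continuous.
Qed.

(** Dominated convergence with bound u^2: every point of [D] eventually leaves the sets. *)
Lemma cvg_nrm2_small (A : nat -> set T) u : sqint u ->
  (forall n, measurable (A n)) ->
  (forall x, D x -> exists N, forall n, (N <= n)%N -> ~ A n x) ->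
  nrm2 (fun x => \1_(A n) x * u x) @[n --> \oo] --> 0.
Proof.
move=> su mA hA; have /sqintP[mu_ su2] := su.
have mAu n : measurable_fun D (fun x => \1_(A n) x * u x).
  by apply: measurable_funM => //; exact: measurable_indic.
have := @dominated_convergence _ _ _ mu D mD
  (fun n x => ((\1_(A n) x * u x) ^+ 2)%:E) (cst 0%E) (fun x => ((u x) ^+ 2)%:E).
move=> []//.
- by move=> n; exact: measurable_sqr.
- apply: aeW => x Dx; have [N HN] := hA x Dx.
  apply: cvg_near_cst; exists N => // n /= Nn.
  by rewrite indicE memNset ?mul0r ?expr0n//; exact: HN.
- apply: aeW => x n Dx /=; rewrite lee_fin ger0_norm ?sqr_ge0//.
  rewrite exprMn ler_piMl ?sqr_ge0// indicE; case: (_ \in _); rewrite ?expr1n ?expr0n//.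
move=> _ _; rewrite integral0_eq// => h.
exact: (fine_cvg h).
Qed.

(** * Completeness of L^2 *)

Section completeness.
Variable u_ : nat -> T -> R.
Hypothesis su_ : forall n, sqint (u_ n).
Hypothesis cau : forall e, 0 < e -> exists N, forall m n, (N <= m)%N -> (N <= n)%N ->
  nrm2 (fun x => u_ m x - u_ n x) < e.

(** Riesz-Fischer. Along a subsequence whose increments have squared norm at most 16^-k, the sum of
    4^k times the squared increments is integrable, hence finite almost everywhere. At such points
    the increments are O(2^-k) and the subsequence converges. Fatou's lemma then shows that the
    whole sequence converges to this pointwise limit in L^2. *)
Lemma sqint_complete : exists2 u, sqint u &
  nrm2 (fun x => u_ n x - u x) @[n --> \oo] --> 0.
Proof.
have /choice[N HN] : forall k : nat, exists N, forall m n, (N <= m)%N -> (N <= n)%N ->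
  nrm2 (fun x => u_ m x - u_ n x) < (16 ^+ k)^-1.
  by move=> k; apply: cau; rewrite invr_gt0 exprn_gt0.
pose ph := fix ph k := if k is k'.+1 then maxn (ph k').+1 (N k) else N 0.
have phN k : (N k <= ph k)%N by case: k => //= k; exact: leq_maxr.
have phS k : (ph k < ph k.+1)%N by exact: leq_maxl.
have phk k : (k <= ph k)%N.
  by elim: k => // k IH; exact: leq_ltn_trans IH (phS k).
pose v k := u_ (ph k).
have sv k : sqint (v k) by exact: su_.
pose dv k x := v k.+1 x - v k x.
have sdv k : sqint (dv k) by exact: sqintB.
have ndv k : nrm2 (dv k) <= (16 ^+ k)^-1.
  by apply/ltW/HN; [exact: leq_trans (phN k) (ltnW (phS k))|exact: phN].
pose F k x := (4 ^+ k * dv k x ^+ 2)%:E.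
have F0 k x : (0 <= F k x)%E.
  by rewrite lee_fin; apply: mulr_ge0; [exact: exprn_ge0|exact: sqr_ge0].
have mF k : measurable_fun D (F k).
  apply/measurable_EFinP/measurable_funM => //.
  by apply: measurable_funX; exact: sqint_meas.
pose S x := (\sum_(0 <= k <oo) F k x)%E.
have IS : (\int[mu]_(x in D) S x < +oo)%E.
  rewrite integral_nneseries//.
  apply: (@le_lt_trans _ _ (\sum_(0 <= k <oo) ((1 * (4^-1) ^+ k)%:E))%E).
    apply: lee_nneseries => [k _ _|k _]; first by apply: integral_ge0.
    rewrite /F; under eq_integral do rewrite EFinM.
    rewrite ge0_integralZl_EFin ?exprn_ge0//; last 2 first.
    - by move=> x _; rewrite lee_fin sqr_ge0.
    - by apply: measurable_sqr; exact: sqint_meas.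
    rewrite sqnormE// -EFinM lee_fin mul1r.
    apply: (@le_trans _ _ (4 ^+ k * (16 ^+ k)^-1)); first by rewrite ler_wpM2l// exprn_ge0.
    by rewrite -exprVn -exprMn le_eqVlt; apply/orP; left; apply/eqP; congr (_ ^+ _); field.
  have /cvg_lim : (fun n => \sum_(0 <= k < n) (1 * (4^-1 : R) ^+ k)%:E)%E @ \oo --> ((1 / (1 - 4^-1))%:E : \bar R).
    rewrite (_ : (fun n => _) = EFin \o series (geometric 1 (4^-1))).
      apply: EFin_cvg; apply: cvg_geometric_series.
      by rewrite ger0_norm ?invr_ge0// invf_lt1 ?ltr1n//; lra.
    by apply/funext => n /=; rewrite sumEFin.
  by move=> ->//; rewrite ltry.
have mS : measurable_fun D S by apply: (ge0_emeasurable_sum (P := xpredT)).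
have Sfin : {ae mu, forall x, D x -> S x \is a fin_num}.
  apply: integrable_ae => //; apply/integrableP; split => //.
  rewrite (eq_integral S)// => x _; rewrite gee0_abs//; apply: nneseries_ge0 => *; exact: F0.
have cvgv x : S x \is a fin_num -> cvgn (fun k => v k x).
  move=> Sx.
  have hF k : `|dv k x| <= Num.sqrt (fine (S x)) * (2^-1) ^+ k.
    have : (F k x <= S x)%E.
      apply: le_trans (nneseries_lim_ge k.+1 (fun n _ _ => F0 n x)).
      by rewrite big_nat_recr//= leeDr// sume_ge0.
    rewrite -[in X in (_ <= X)%E](fineK Sx) lee_fin => h.
    rewrite -sqrtr_sqr -(@ger0_norm _ (2^-1 ^+ k)) ?exprn_ge0// -sqrtr_sqr -sqrtrM; last first.
      by rewrite fine_ge0//; exact: nneseries_ge0.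
    rewrite ler_wsqrtr// -exprM mulnC exprM -ler_pdivrMr ?exprn_gt0//.
    by rewrite -exprVn -exprVn invrK -natrX mulrC.
  have : cvgn (series (fun k => dv k x)).
    apply: normed_cvg; apply: (series_le_cvg _ _ hF) => //.
    apply: is_cvg_geometric_series.
    by rewrite ger0_norm ?invr_ge0// invf_lt1 ?ltr1n//; lra.
  move=> /cvg_ex[l Hl]; apply/cvg_ex; exists (l + v 0 x).
  rewrite (_ : (fun k => _) = (fun k => series (fun k => dv k x) k + v 0 x)).
    by apply: cvgD => //; exact: cvg_cst.
  apply/funext => k; by rewrite /series /= telescope_sumr// subrK.
(* The upper limit is measurable on all of [D] and equals the limit wherever the latter exists;
   [fine] replaces infinite values by 0. *)
pose u x := fine (limn_esup (fun k => (v k x)%:E)).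
have mu_ : measurable_fun D u.
  apply: measurableT_comp; first exact: fine_measurable.
  apply: measurable_fun_limn_esup => k; apply/measurable_EFinP; exact: sqint_meas.
have cvgu : {ae mu, forall x, D x -> v k x @[k --> \oo] --> u x}.
  apply: filterS Sfin => x H Dx; have /cvgv h := H Dx.
  have /cvg_ex[l hl] := h.
  have hE : (v k x)%:E @[k --> \oo] --> l%:E by exact: EFin_cvg.
  by rewrite /u is_cvg_limn_esupE ?(cvg_lim _ hE)//; apply/cvg_ex; exists l%:E.
have key e : 0 < e -> exists M, forall n, (M <= n)%N ->
    (\int[mu]_(x in D) ((u_ n x - u x) ^+ 2)%:E <= e%:E)%E.
  move=> e0; have [M HM] := cau e0; exists M => n Mn.
  have -> : (\int[mu]_(x in D) ((u_ n x - u x) ^+ 2)%:E =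
      \int[mu]_(x in D) limn_einf (fun k => ((u_ n x - v k x) ^+ 2)%:E))%E.
    apply: ae_eq_integral => //.
    - by apply: measurable_sqr; apply: measurable_funB => //; exact: sqint_meas.
    - apply: measurableT_comp => //; apply: measurable_fun_limn_esup => k.
      apply: measurableT_comp => //; apply: measurable_sqr.
      by apply: measurable_funB; exact: sqint_meas.
    - apply: filterS cvgu => x H Dx.
      have c : ((u_ n x - v k x) ^+ 2)%:E @[k --> \oo] --> ((u_ n x - u x) ^+ 2)%:E.
        apply: EFin_cvg; rewrite !expr2; apply: cvgM; apply: cvgB; (exact: cvg_cst || exact: H).
      by rewrite is_cvg_limn_einfE ?(cvg_lim _ c)//; apply/cvg_ex; eexists; exact: c.
  apply: le_trans (fatou _ _ _ _) _ => //.
    move=> k; apply: measurable_sqr; by apply: measurable_funB; exact: sqint_meas.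
    by move=> k x _; rewrite lee_fin sqr_ge0.
  apply: (le_trans (limn_einf_sup _)); rewrite limn_esup_lim.
  apply: lime_le; first exact: is_cvg_esups.
  exists M => // k /= Mk; apply: ge_ereal_sup => _ [j /= kj <-].
  rewrite sqnormE ?lee_fin; last exact: sqintB.
  by apply/ltW/HM => //; exact: leq_trans (leq_trans Mk kj) (phk j).
have su : sqint u.
  have [M HM] := key 1 ltr01.
  have -> : u = (fun x => u_ M x - (u_ M x - u x)) by apply/funext => x; ring.
  apply: sqintB => //; split; first by apply: measurable_funB => //; exact: sqint_meas.
  by apply: le_lt_trans (HM M (leqnn M)) _; rewrite ltry.
exists u => //; apply/cvg0_ltP => [n|e e0]; first exact: nrm2_ge0.
have [M HM] := key _ (divr_gt0 e0 (ltr0n _ 2)); exists M => n Mn.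
apply: (@le_lt_trans _ _ (e / 2)); last by rewrite ltr_pdivrMr// mulr_natr mulr2n ltrDl.
by rewrite -lee_fin -sqnormE ?HM//; exact: sqintB.
Qed.

End completeness.

End square_integrable.

(** * Functions of class C^1 *)

(** A directional derivative depends only on the restriction to a line, so it can be transferred
    between two spaces in which these restrictions agree. *)
Lemma is_derive_along (R : realType) (V W : normedModType R) (f : V -> R)
    (g : W -> R) (x v : V) (y w : W) (d : R) :
  (forall h : R, f (h *: v + x) = g (h *: w + y)) ->
  is_derive y w g d -> is_derive x v f d.
Proof.
move=> fg.
have e : (fun h : R => h^-1 *: ((f \o shift x) (h *: v) - f x)) =
         (fun h : R => h^-1 *: ((g \o shift y) (h *: w) - g y)).
  apply/funext => h /=; rewrite fg.
  by have := fg 0; rewrite !scale0r !add0r => ->.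
by move=> [dg dd]; split; rewrite ?/derivable ?/derive e.
Qed.

(** Differentiability of [f] is known along [v] only, which excludes the total chain rule;
    restricting [f] to the line leaves a composition of real functions. *)
Lemma is_derive_comp_real (R : realType) (V : normedModType R) (f : V -> R)
    (F : R -> R) (x v : V) (d D : R) :
  is_derive x v f d -> is_derive (f x) 1 F D -> is_derive x v (F \o f) (D * d).
Proof.
move=> df dF; pose p (h : R) := f (h *: v + x).
have dp : is_derive (0 : R) 1 p d.
  by apply: is_derive_along df => h; rewrite /p addr0 [_ *: 1]mulr1.
have p0 : p 0 = f x by rewrite /p scale0r add0r.
have dFp : is_derive (0 : R) 1 (F \o p) (D * d).
  by apply: is_derive1_comp; rewrite p0.
apply: is_derive_along dFp => h; rewrite /p /= addr0.
by congr (F (f (_ *: _ + _))); rewrite [_ *: 1]mulr1.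
Qed.

Section real_valued_derivatives.
Variables (R : realType) (V : normedModType R).
Implicit Types (f g : V -> R) (x v : V) (a b : R).

Lemma is_derive_addr f g x v a b : is_derive x v f a -> is_derive x v g b ->
  is_derive x v (fun y => f y + g y) (a + b).
Proof. by move=> df dg; exact: (@is_deriveD _ _ _ f g). Qed.

Lemma is_derive_subr f g x v a b : is_derive x v f a -> is_derive x v g b ->
  is_derive x v (fun y => f y - g y) (a - b).
Proof. by move=> df dg; exact: (@is_deriveB _ _ _ f g). Qed.

Lemma is_derive_mulr f g x v a b : is_derive x v f a -> is_derive x v g b ->
  is_derive x v (fun y => f y * g y) (a * g x + f x * b).
Proof.
move=> df dg; apply: (is_derive_eq (@is_deriveM _ _ f g _ _ _ _ df dg)).
by rewrite addrC /GRing.scale/= mulrC.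
Qed.

Lemma is_derive_cstr (r : R) x v : is_derive x v (fun=> r) 0.
Proof. exact: (@is_derive_cst _ _ _ r). Qed.

Lemma continuous_cstr (T : topologicalType) (r : R) (t : T) :
  {for t, continuous (fun=> r)}.
Proof. exact: cst_continuous. Qed.

Lemma near_eq_continuous (T : topologicalType) (f g : T -> R) (t : T) :
  (\near t, f t = g t) -> {for t, continuous f} -> {for t, continuous g}.
Proof.
move=> fg cf; rewrite /prop_for /continuous_at -(nbhs_singleton fg).
by apply: cvg_trans cf; exact: near_eq_cvg.
Qed.

Lemma is_derive_idr (t : R) : is_derive t (1 : R) (fun s : R => s) 1.
Proof. exact: is_derive_id. Qed.

End real_valued_derivatives.

Section C1_gradient.
Variables (R : realType) (n : nat).
Implicit Types (U A K : set 'rV[R]_n) (u v : 'rV[R]_n -> R)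
  (G H : 'I_n -> 'rV[R]_n -> R) (i : 'I_n).

(** Class C^1 on [U] with the gradient carried as data, so that sums, products and compositions
    compute it without passing through [partial]. *)
Definition C1g U u G : Prop :=
  (forall x, U x -> {for x, continuous u}) /\
  forall i x, U x -> is_derive x (delta_mx 0 i) u (G i x) /\ {for x, continuous (G i)}.

Lemma C1g_partial U u G i x : C1g U u G -> U x -> partial i u x = G i x.
Proof. by move=> [_ h] /(h i)[[_ ]]. Qed.

Lemma C1g_C1 u G : C1g setT u G -> C1 u.
Proof.
move=> h; have e i : partial i u = G i by apply/funext => x; exact: (C1g_partial i h).
case: h => c h; split=> [x|i]; first exact: c.
split; first by move=> x; have [[]] := h i x I.
by rewrite e => x; have [] := h i x I.
Qed.

Lemma C1_C1g u : C1 u -> C1g setT u (fun i => partial i u).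
Proof.
move=> [c h]; split=> [x _|i x _]; first exact: c.
have [h1 h2] := h i; split; last exact: h2.
by split => //; exact: h1.
Qed.

Lemma C1gS U A u G : A `<=` U -> C1g U u G -> C1g A u G.
Proof. by move=> AU [c h]; split => [x /AU|i x /AU]; [exact: c|exact: h]. Qed.

Lemma C1g_cst U (r : R) : C1g U (cst r) (fun _ => cst 0).
Proof.
split=> [x _|i x _]; first exact: cst_continuous.
by split; [exact: is_derive_cst|exact: cst_continuous].
Qed.

Lemma C1gD U u v G H : C1g U u G -> C1g U v H ->
  C1g U (fun x => u x + v x) (fun i x => G i x + H i x).
Proof.
move=> [cu hu] [cv hv]; split=> [x Ux|i x Ux].
  by exact: (continuousD (cu x Ux) (cv x Ux)).
have [du cG] := hu i x Ux; have [dv cH] := hv i x Ux; split.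
  exact: is_derive_addr.
exact: (continuousD cG cH).
Qed.

Lemma C1gM U u v G H : C1g U u G -> C1g U v H ->
  C1g U (fun x => u x * v x) (fun i x => G i x * v x + u x * H i x).
Proof.
move=> [cu hu] [cv hv]; split=> [x Ux|i x Ux].
  by exact: (continuousM (cu x Ux) (cv x Ux)).
have [du cG] := hu i x Ux; have [dv cH] := hv i x Ux; split.
  exact: is_derive_mulr.
exact: (continuousD (continuousM cG (cv x Ux)) (continuousM (cu x Ux) cH)).
Qed.

Lemma C1gZ U (k : R) u G : C1g U u G ->
  C1g U (fun x => k * u x) (fun i x => k * G i x).
Proof.
move=> h; have := C1gM (C1g_cst U k) h.
by under [X in C1g _ _ X]eq_fun do under eq_fun do rewrite mul0r add0r.
Qed.

Lemma C1gN U u G : C1g U u G -> C1g U (fun x => - u x) (fun i x => - G i x).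
Proof.
move=> /(C1gZ (-1)); under eq_fun do rewrite mulN1r.
by under [X in C1g _ _ X]eq_fun do under eq_fun do rewrite mulN1r.
Qed.

Lemma C1gB U u v G H : C1g U u G -> C1g U v H ->
  C1g U (fun x => u x - v x) (fun i x => G i x - H i x).
Proof. by move=> hu /C1gN; exact: C1gD. Qed.

Lemma C1g_comp U u G (F F' : R -> R) : C1g U u G ->
  (forall t : R, is_derive t (1 : R) F (F' t)) -> continuous F' ->
  C1g U (fun x => F (u x)) (fun i x => F' (u x) * G i x).
Proof.
move=> [cu hu] dF cF'; split=> [x Ux|i x Ux].
  apply: (@continuous_comp _ _ _ u F); first exact: cu.
  apply/differentiable_continuous/derivable1_diffP; by have [] := dF (u x).
have [du cG] := hu i x Ux; split; first exact: is_derive_comp_real.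
apply: (continuousM _ cG).
by apply: (@continuous_comp _ _ _ u F'); [exact: cu|exact: cF'].
Qed.

Lemma C1g_coord U j : C1g U (fun x => x 0 j) (fun i => cst (i == j)%:R).
Proof.
split=> [x _|i x _]; first exact: coord_continuous.
split; last exact: cst_continuous.
have d : is_derive (0 : R) 1 (fun t : R => t * (i == j)%:R + x 0 j) ((i == j)%:R).
  have d := is_derive_addr (is_derive_mulr (is_derive_idr (0 : R))
    (is_derive_cstr (i == j)%:R (0 : R) 1)) (is_derive_cstr (x 0 j) (0 : R) 1).
  by apply: is_derive_eq d _; rewrite mul1r mulr0 !addr0.
apply: is_derive_along d => h; rewrite !mxE eqxx/= addr0 [_ *: 1]mulr1.
by rewrite [in RHS]eq_sym.
Qed.

Lemma C1g_ext U u v G : open U -> {in U, u =1 v} -> C1g U u G -> C1g U v G.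
Proof.
move=> oU uv [cu hu].
have nuv x : U x -> \near x, u x = v x.
  by move=> Ux; apply: filterS (open_nbhs_nbhs (conj oU Ux)) => y Uy; apply/uv/mem_set.
split=> [x Ux|i x Ux].
  by apply: near_eq_continuous (cu x Ux); exact: nuv.
have [du cG] := hu i x Ux; split => //.
by apply: near_eq_is_derive du; exact: nuv.
Qed.

Lemma C1g_extg U u G H : open U -> (forall i, {in U, G i =1 H i}) ->
  C1g U u G -> C1g U u H.
Proof.
move=> oU GH [cu hu]; split=> // i x Ux.
have [du cG] := hu i x Ux; rewrite -(GH i x (mem_set Ux)); split => //.
apply: near_eq_continuous cG.
by apply: filterS (open_nbhs_nbhs (conj oU Ux)) => y Uy; apply/GH/mem_set.
Qed.

Lemma C1gU U A u G : C1g U u G -> C1g A u G -> C1g (U `|` A) u G.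
Proof.
move=> [cu hu] [ca ha]; split=> [x [|]|i x [|]]; by [exact: cu|exact: ca|exact: hu|exact: ha].
Qed.

(** The extension by 0 is of class C^1 on [U] and, being 0 there, on the complement of [K]; these
    two open sets cover the space. *)
Lemma C1g_patch U K u G : open U -> closed K -> K `<=` U ->
  (forall x, U x -> ~ K x -> u x = 0) -> C1g U u G ->
  C1g setT (u \_ U) (fun i => G i \_ U) /\
  forall i x, ~ K x -> (G i \_ U) x = 0.
Proof.
move=> oU cK KU u0 h.
have oC : open (~` K) by exact: closed_openC.
have z : {in ~` K, (u \_ U) =1 cst 0}.
  move=> x; rewrite inE => nK; rewrite patchE; case: ifPn => //; rewrite inE => Ux.
  exact: u0.
have hC : C1g (~` K) (u \_ U) (fun _ => cst 0).
  apply: (C1g_ext oC) (C1g_cst _ 0) => x /z /= ->//.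
have hU : C1g U (u \_ U) (fun i => G i \_ U).
  apply: (@C1g_extg _ _ G) => //.
    by move=> i x xU; rewrite patchE xU.
  by apply: (C1g_ext oU) h => x xU; rewrite patchE xU.
have G0 i x : ~ K x -> (G i \_ U) x = 0.
  move=> nK; rewrite patchE; case: ifPn => //; rewrite inE => Ux.
  have := C1g_partial i hC nK; have := C1g_partial i hU Ux.
  by rewrite patchE mem_set// => ->.
split => //.
rewrite (_ : setT = U `|` ~` K); last first.
  apply/seteqP; split => // x _; have [Kx|nK] := pselect (K x); first by left; exact: KU.
  by right.
apply: C1gU => //; apply: C1g_extg hC => // i x; rewrite inE => nK.
by rewrite G0.
Qed.

Lemma C1_compact_supportP U u : C1_compact_support U u ->
  C1g setT u (fun i => partial i u) /\
  exists K, [/\ compact K, K `<=` U, (forall x, ~ K x -> u x = 0) &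
     forall i x, ~ K x -> partial i u x = 0].
Proof.
move=> [/C1_C1g h cK KU]; split => //.
set K := closure _ in cK KU; exists K; split => //.
  move=> x nK; apply: contra_notP nK => /eqP ux; exact: subset_closure.
have clK : closed K by exact: closed_closure.
have hC : C1g (~` K) u (fun _ => cst 0).
  apply: (C1g_ext (closed_openC clK)) (C1g_cst _ 0) => x; rewrite inE /= => nK.
  by apply/esym; apply: contra_notP nK => /eqP ux; exact: subset_closure.
by move=> i x nK; rewrite (C1g_partial i hC nK).
Qed.

Lemma C1_compact_support_intro U K u : C1 u -> compact K -> K `<=` U ->
  (forall x, ~ K x -> u x = 0) -> C1_compact_support U u.
Proof.
move=> cu cK KU u0.
have clK : closed K by apply: compact_closed => //; exact: norm_hausdorff.
have sK : closure [set x | u x != 0] `<=` K.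
  rewrite [X in _ `<=` X](closure_id K).1//; apply: closureS => x /= ux.
  by apply: contrapT => /u0 /eqP; rewrite (negbTE ux).
split => //; last exact: subset_trans KU.
by apply: subclosed_compact cK sK; exact: closed_closure.
Qed.

Lemma C1_compact_support0 U : C1_compact_support U (cst 0).
Proof.
apply: (@C1_compact_support_intro _ set0) => //.
- exact: C1g_C1 (C1g_cst setT 0).
- exact: compact0.
Qed.

Lemma C1_compact_supportD U u v : C1_compact_support U u -> C1_compact_support U v ->
  C1_compact_support U (fun x => u x + v x).
Proof.
move=> hu hv.
have [gu [K [cK KU u0 _]]] := C1_compact_supportP hu.
have [gv [L [cL LU v0 _]]] := C1_compact_supportP hv.
apply: (@C1_compact_support_intro _ (K `|` L)).
- exact: C1g_C1 (C1gD gu gv).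
- exact: compactU.
- by move=> x [/KU|/LU].
- by move=> x /not_orP[nK nL]; rewrite u0// v0// addr0.
Qed.

Lemma C1_compact_supportZ U (k : R) u : C1_compact_support U u ->
  C1_compact_support U (fun x => k * u x).
Proof.
move=> hu; have [gu [K [cK KU u0 _]]] := C1_compact_supportP hu.
apply: (@C1_compact_support_intro _ K) => //.
- exact: C1g_C1 (C1gZ k gu).
- by move=> x nK; rewrite u0// mulr0.
Qed.

Lemma C1_compact_supportM U u v G : open U -> C1g U u G ->
  C1_compact_support U v -> C1_compact_support U ((fun x => u x * v x) \_ U) /\
  C1g setT ((fun x => u x * v x) \_ U)
    (fun i => (fun x => G i x * v x + u x * partial i v x) \_ U).
Proof.
move=> oU gu hv; have [gv [K [cK KU v0 _]]] := C1_compact_supportP hv.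
have clK : closed K by apply: compact_closed => //; exact: norm_hausdorff.
have [|h _] := C1g_patch oU clK KU _ (C1gM gu (C1gS (@subsetT _ U) gv)).
  by move=> x _ nK; rewrite v0// mulr0.
split => //; apply: (@C1_compact_support_intro _ K) => //; first exact: C1g_C1 h.
by move=> x nK; rewrite patchE v0// mulr0 if_same.
Qed.

End C1_gradient.

(** * Truncations and smooth steps of one real variable *)

Section real_C1.
Variable R : realType.
Implicit Types t : R.

Definition pos t := Num.max t 0.

Lemma pos_ge0 t : 0 <= pos t. Proof. by rewrite /pos le_max lexx orbT. Qed.
Lemma pos_le0 t : t <= 0 -> pos t = 0. Proof. by move=> ?; rewrite /pos max_r. Qed.
Lemma pos_gt0 t : 0 <= t -> pos t = t. Proof. by move=> ?; rewrite /pos max_l. Qed.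

Lemma pos_lip s t : `|pos s - pos t| <= `|s - t|.
Proof.
rewrite /pos; have [s0|s0] := leP s 0; have [t0|t0] := leP t 0.
- by rewrite subrr normr0.
- by rewrite sub0r normrN gtr0_norm// ler0_norm; lra.
- by rewrite subr0 gtr0_norm// ger0_norm; lra.
- by [].
Qed.

Lemma continuous_pos : continuous pos.
Proof.
move=> t; apply/cvgrPdist_lt => e e0; near=> s.
by apply: le_lt_trans (pos_lip _ _) _; near: s; apply: cvgr_dist_lt.
Unshelve. all: by end_near. Qed.

(** Squaring makes the positive part differentiable at 0, with Lipschitz derivative 2 t_+; the
    truncations and steps that follow are built from it. *)
Definition pos2 t := pos t ^+ 2.

Lemma is_derive_pos2 t : is_derive t 1 pos2 (2 * pos t).
Proof.
have [t0|t0|->] := ltgtP t 0.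
- rewrite pos_le0 ?ltW// mulr0.
  apply: (near_eq_is_derive _ (is_derive_cstr 0 t 1)).
  near=> s; rewrite /pos2 pos_le0 ?expr0n//; apply/ltW.
  by near: s; exact: lt_nbhsl.
- rewrite pos_gt0 ?ltW//.
  apply: (@near_eq_is_derive _ _ _ (fun s : R => s ^+ 2)).
    near=> s; rewrite /pos2 pos_gt0//; apply/ltW.
    by near: s; exact: lt_nbhsr.
  apply: is_derive_eq (is_derive_mulr (is_derive_idr t) (is_derive_idr t)) _.
  by rewrite mulr1 mul1r mulr_natl.
- rewrite pos_le0// mulr0.
  have h : (fun h : R => h^-1 *: ((pos2 \o shift 0) (h *: 1) - pos2 0)) @ 0^' --> (0 : R).
    apply/cvgrPdist_lt => e e0; near=> s.
    rewrite sub0r normrN /= addr0 [_ *: 1]mulr1 /pos2 (pos_le0 (lexx 0)) expr0n/= subr0.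
    have s0 : s != 0 by near: s; exact: nbhs_dnbhs_neq.
    rewrite [_ *: _]/(_ * _) normrM normfV mulrC ltr_pdivrMr ?normr_gt0//.
    rewrite ger0_norm ?sqr_ge0// expr2; apply: (@le_lt_trans _ _ (`|s| * `|s|)).
      have := pos_lip s 0; rewrite (pos_le0 (lexx 0)) !subr0 => h.
      have := pos_ge0 s; have := normr_ge0 s; have := ler_norm (pos s); nra.
    rewrite ltr_pM2r ?normr_gt0//.
    by near: s; exact: dnbhs0_lt.
  by split; [apply/cvg_ex; exists 0|exact/cvg_lim].
Unshelve. all: by end_near. Qed.

Lemma continuous_dpos2 : continuous (fun t => 2 * pos t).
Proof. by move=> t; exact: (continuousM (@continuous_cstr _ _ 2 t) (@continuous_pos t)). Qed.

Lemma pos2_ge0 t : 0 <= pos2 t. Proof. exact: sqr_ge0. Qed.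

(* The derivative lies in [0, 1], so that dbump^2 <= dbump in energy estimates. *)
Definition bump t := pos2 t / (1 + pos2 t).
Definition dbump t := 2 * pos t / (1 + pos2 t) ^+ 2.

Lemma is_derive_bump t : is_derive t 1 bump (dbump t).
Proof.
have s0 : 1 + pos2 t != 0 by rewrite gt_eqF// ltr_pwDl// pos2_ge0.
have dq : is_derive (pos2 t) 1 (fun s : R => 1 - (1 + s)^-1) ((1 + pos2 t) ^- 2).
  have d1 : is_derive (pos2 t) 1 (fun s : R => 1 + s) 1.
    by apply: is_derive_eq (is_derive_addr (is_derive_cstr _ _ _) (is_derive_idr _)) _; rewrite add0r.
  have d2 := @is_deriveV _ _ (pos2 t) 1 1 s0 d1.
  apply: is_derive_eq (is_derive_subr (is_derive_cstr _ _ _) d2) _.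
  by rewrite sub0r scaleNr opprK [_ *: 1]mulr1.
have := is_derive_comp_real (is_derive_pos2 t) dq.
rewrite (_ : _ \o _ = bump).
  by move=> h; apply: is_derive_eq h _; rewrite /dbump mulrC.
apply/funext => x /=; rewrite /bump.
have x0 : 1 + pos2 x != 0 by rewrite gt_eqF// ltr_pwDl// pos2_ge0.
by field.
Qed.

Lemma bump_ge0 t : 0 <= bump t.
Proof. by rewrite /bump divr_ge0// ?addr_ge0// pos2_ge0. Qed.

Lemma bump_lt1 t : bump t < 1.
Proof. by rewrite /bump ltr_pdivrMr ?mul1r ?ltrDr// ltr_pwDl// pos2_ge0. Qed.

Lemma bump_le0 t : t <= 0 -> bump t = 0.
Proof. by move=> t0; rewrite /bump /pos2 pos_le0// expr0n mul0r. Qed.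

Lemma bump_gt0 t : 0 < t -> 0 < bump t.
Proof.
move=> t0; have p0 : 0 < pos2 t by rewrite /pos2 pos_gt0 ?exprn_gt0// ltW.
by rewrite /bump divr_gt0// addr_gt0.
Qed.

Lemma dbump_ge0 t : 0 <= dbump t.
Proof. by rewrite /dbump divr_ge0 ?sqr_ge0// mulr_ge0// pos_ge0. Qed.

Lemma dbump_le1 t : dbump t <= 1.
Proof.
rewrite /dbump /pos2; have m0 := pos_ge0 t; move: (pos t) m0 => m m0.
rewrite ler_pdivrMr ?mul1r; last by rewrite exprn_gt0// ltr_pwDl// sqr_ge0.
nra.
Qed.

Lemma dbump_lip s t : `|dbump s - dbump t| <= 4 * `|s - t|.
Proof.
apply: (@le_trans _ _ (4 * `|pos s - pos t|)); last by rewrite ler_wpM2l// pos_lip.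
rewrite /dbump /pos2; have m0 := pos_ge0 s; have k0 := pos_ge0 t.
move: (pos s) (pos t) m0 k0 => m k m0 k0.
have mp : 0 < (1 + m ^+ 2) ^+ 2 by rewrite exprn_gt0// ltr_pwDl// sqr_ge0.
have kp : 0 < (1 + k ^+ 2) ^+ 2 by rewrite exprn_gt0// ltr_pwDl// sqr_ge0.
(* The factor [m - k] is taken out exactly; the remaining rational function is bounded by 4 for m, k
   >= 0. *)
have -> : 2 * m / (1 + m ^+ 2) ^+ 2 - 2 * k / (1 + k ^+ 2) ^+ 2 =
  (m - k) * (2 * (1 - 2 * m * k - m * k * (k ^+ 2 + k * m + m ^+ 2)) /
   ((1 + m ^+ 2) ^+ 2 * (1 + k ^+ 2) ^+ 2)).
  by field; rewrite !gt_eqF// ?ltr_pwDl ?sqr_ge0.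
rewrite normrM mulrC ler_wpM2r// ler_norml; apply/andP; split.
  rewrite ler_pdivlMr ?mulr_gt0//; nra.
rewrite ler_pdivrMr ?mulr_gt0//; nra.
Qed.

(** A transition of class C^1 from 0 on t <= 0 to 1 on t >= 1, made of two nested squared positive
    parts. *)
Definition step t := 1 - pos2 (1 - pos2 t).
Definition dstep t := 2 * pos (1 - pos2 t) * (2 * pos t).

Lemma is_derive_step t : is_derive t 1 step (dstep t).
Proof.
have d1 : is_derive t 1 (fun s => 1 - pos2 s) (- (2 * pos t)).
  apply: is_derive_eq (is_derive_subr (is_derive_cstr _ _ _) (is_derive_pos2 t)) _.
  by rewrite sub0r.
have d2 := is_derive_comp_real d1 (is_derive_pos2 (1 - pos2 t)).
apply: is_derive_eq (is_derive_subr (is_derive_cstr _ _ _) d2) _.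
by rewrite /dstep sub0r mulrN opprK.
Qed.

Lemma continuous_dstep : continuous dstep.
Proof.
have c2 : continuous pos2.
  by move=> x; apply: (continuousM (@continuous_pos x) (@continuous_pos x)).
move=> t; apply: (continuousM _ (@continuous_dpos2 t)).
apply: (continuousM (@continuous_cstr _ _ 2 t)).
apply: (@continuous_comp _ _ _ (fun s => 1 - pos2 s) pos); last exact: continuous_pos.
exact: (continuousB (@continuous_cstr _ _ 1 t) (c2 t)).
Qed.

Lemma step_le0 t : t <= 0 -> step t = 0.
Proof.
by move=> t0; rewrite /step /pos2 (pos_le0 t0) expr0n subr0 pos_gt0// expr1n subrr.
Qed.

Lemma step_ge1 t : 1 <= t -> step t = 1.
Proof.
move=> t1; rewrite /step {1}/pos2 pos_le0 ?expr0n ?subr0//.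
rewrite /pos2 pos_gt0; nra.
Qed.

Lemma step_ge0 t : 0 <= step t.
Proof.
rewrite /step subr_ge0; apply: (@le_trans _ _ (1 ^+ 2)); last by rewrite expr1n.
rewrite ler_pXn2r// ?nnegrE// ?pos_ge0//.
by rewrite /pos ge_max ler01 andbT lerBlDr lerDl pos2_ge0.
Qed.

Lemma step_le1 t : step t <= 1.
Proof. by rewrite /step lerBlDr lerDl pos2_ge0. Qed.

Lemma dstep_bound t : `|dstep t| <= 4.
Proof.
rewrite /dstep ger0_norm; last by rewrite !mulr_ge0// pos_ge0.
have m0 := pos_ge0 t; rewrite /pos2; move: (pos t) m0 => m m0.
have [m1|m1] := leP 1 m.
  rewrite (@pos_le0 (1 - m ^+ 2)) ?mulr0 ?mul0r//; nra.
rewrite pos_gt0; nra.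
Qed.

End real_C1.

(** * Integration by parts and the fundamental lemma *)

Section boxes.
Variables (R : realType) (n : nat).
Implicit Types (p q x : 'rV[R]_n).

Definition box p q : set 'rV[R]_n := [set x | forall i, p 0 i < x 0 i < q 0 i].

Lemma measurable_box p q : measurable (box p q).
Proof.
rewrite (_ : box p q = \bigcap_(i in [set: 'I_n])
  ((fun y : 'rV[R]_n => (y 0 i : measurableTypeR R)) @^-1` `]p 0 i, q 0 i[)).
  apply: fin_bigcap_measurable => // i _.
  by rewrite -[X in measurable X]setTI; exact: measurable_rV_coord.
apply/seteqP; split => x /=.
  by move=> H i _ /=; rewrite in_itv/=; exact: H.
by move=> H i; have := H i I; rewrite /= in_itv.
Qed.

Lemma box_setI p q p' q' : box p q `&` box p' q' =
  box (\row_i Num.max (p 0 i) (p' 0 i)) (\row_i Num.min (q 0 i) (q' 0 i)).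
Proof.
apply/seteqP; split => x /=.
  move=> [H H'] i; rewrite !mxE gt_max lt_min.
  by have /andP[-> ->] := H i; have /andP[-> ->] := H' i.
by move=> H; split=> i; have := H i; rewrite !mxE gt_max lt_min;
  move=> /andP[/andP[? ?] /andP[? ?]]; apply/andP.
Qed.

Lemma ball_box (c : 'rV[R]_n) (r : R) : 0 < r ->
  ball c r = box (\row_i (c 0 i - r)) (\row_i (c 0 i + r)).
Proof.
move=> r0; apply/seteqP; split=> x.
  move=> /rV_ballP[_ H] i; rewrite !mxE; have := H i.
  by rewrite ltr_norml; lra.
move=> H; apply/rV_ballP; split => // i; have := H i; rewrite !mxE ltr_norml; lra.
Qed.

(** Boxes are stable under intersection, as the Dynkin argument of the fundamental lemma requires.
    They generate the Borel sets since a half-space x_i > a is the union over k of the boxes with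
    lower bound a in coordinate i, -k in the others, and upper bounds k. *)
Lemma measurable_gen_box : @measurable _ 'rV[R]_n =
  <<s [set A | exists p q, A = box p q] >>.
Proof.
rewrite eqEsubset; split; last first.
  apply: smallest_sub; first exact: sigma_algebra_measurable.
  by move=> _ [p [q ->]]; exact: measurable_box.
apply: smallest_sub; first exact: smallest_sigma_algebra.
move=> _ [i [B [mB ->]]].
set G := [set A | _].
pose T' : measurableType _ := g_sigma_algebraType G.
have h : measurable_fun setT (fun x : T' => ((x : 'rV[R]_n) 0 i : measurableTypeR R)).
  apply: (measurability _ (RGenOInfty.measurableE R)).
  move=> _ [_ [a ->] <-]; rewrite setTI.
  rewrite (_ : _ @^-1` _ = \bigcup_(k : nat)
      box (\row_j if j == i then a else - k%:R) (\row_j k%:R)).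
    apply: bigcup_measurable => k _; apply: sub_sigma_algebra.
    by eexists; eexists; reflexivity.
  apply/seteqP; split => x /=.
    rewrite in_itv/= andbT => ax.
    pose M := \big[Num.max/0]_j `|(x : 'rV[R]_n) 0 j|.
    exists (Num.truncn M).+1 => // j; rewrite !mxE.
    have xM : `|(x : 'rV[R]_n) 0 j| < (Num.truncn M).+1%:R.
      apply: le_lt_trans (truncnS_gt _).
      exact: (le_bigmax _ (fun j => `|(x : 'rV[R]_n) 0 j|)).
    move: xM; rewrite ltr_norml => /andP[h1 h2].
    case: eqP => [e|_]; last by rewrite h1 h2.
    by rewrite h2 andbT e.
  move=> [k _ H]; rewrite in_itv/= andbT; have := H i.
  by rewrite !mxE eqxx => /andP[].
by have := h measurableT B mB; rewrite setTI.
Qed.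

Lemma open_box p q : open (box p q).
Proof.
rewrite openE => x xpq; pose r := \big[Num.min/1]_i Num.min (x 0 i - p 0 i) (q 0 i - x 0 i).
have r0 : 0 < r.
  apply: lt_bigmin => // i _; rewrite lt_min !subr_gt0.
  by have /andP[-> ->] := xpq i.
apply/nbhs_ballP; exists r => // y /rV_ballP[_ H] i.
have := H i; have : r <= Num.min (x 0 i - p 0 i) (q 0 i - x 0 i).
  exact: bigmin_le.
rewrite le_min => /andP[h1 h2]; rewrite ltr_norml; lra.
Qed.

Lemma compact_cbox p q : compact [set x : 'rV[R]_n | forall i, p 0 i <= x 0 i <= q 0 i].
Proof.
have := @rV_compact R n (fun i => `[p 0 i, q 0 i]%classic).
rewrite (_ : [set v | _] = [set x : 'rV[R]_n | forall i, p 0 i <= x 0 i <= q 0 i]).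
  by apply=> i; exact: segment_compact.
by apply/seteqP; split => x /= H i; have := H i; rewrite /= in_itv.
Qed.

End boxes.

Lemma continuous_rV (R : realType) (T : topologicalType) n (f : T -> 'rV[R]_n) (x : T) :
  (forall i, {for x, continuous (fun y => f y 0 i)}) -> {for x, continuous f}.
Proof.
move=> h; apply/cvg_ballP => e e0; near=> y; apply/rV_ballP; split => //.
near: y; apply: filter_forall => i.
by have /cvgrPdist_lt/(_ e e0) := h i.
Unshelve. all: by end_near. Qed.

Lemma within_open_continuous (R : realType) (T : topologicalType) (U : set T) (f : T -> R) :
  open U -> (forall x, U x -> {for x, continuous f}) -> {within U, continuous f}.
Proof. by move=> oU h; apply: continuous_in_subspaceT => x; rewrite inE => /h. Qed.

Lemma compact_image_bounded (R : realType) (T : topologicalType) (K : set T) (f : T -> R) :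
  compact K -> {within K, continuous f} -> exists2 M, 0 <= M & forall x, K x -> `|f x| <= M.
Proof.
move=> cK cf; have /compact_bounded[M [_ HM]] := continuous_compact cf cK.
exists (`|M| + 1); first by rewrite addr_ge0.
move=> x Kx; apply: (HM (`|M| + 1)); first by rewrite (le_lt_trans (ler_norm _))// ltrDl.
by exists x.
Qed.

Section divergence.
Variable R : realType.
Let leb : {sigma_finite_measure set (measurableTypeR R) -> \bar R} := @lebesgue_measure R.

(** By the fundamental theorem of calculus f' has integral 0 over an interval that contains its
    support. The conclusion is stated for positive and negative parts because Tonelli's theorem is
    applied to each of them. *)
Lemma integral_derive_compact (f f' : R -> R) (M : R) :
  (forall t : R, is_derive t (1 : R) f (f' t)) -> continuous f' ->
  (forall t, M <= `|t| -> f t = 0) -> (forall t, M <= `|t| -> f' t = 0) ->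
  (\int[leb]_t ((EFin \o f')^\+ t) = \int[leb]_t ((EFin \o f')^\- t))%E.
Proof.
move=> df cf' f0 f'0; pose L := `|M| + 1.
have L0 : 0 < L by rewrite ltr_wpDl.
have ML : M <= L by rewrite /L (le_trans (ler_norm _))// lerDl.
have LL : - L < L by lra.
have cwf' : {within `[- L, L], continuous f'} by exact: continuous_subspaceT.
have I0 : (\int[leb]_(x in `[(- L)%R, L]) (f' x)%:E = 0)%E.
  rewrite (@continuous_FTC2 _ _ f)//.
  - have -> : f L = 0 by apply: f0; rewrite ger0_norm// ltW.
    have -> : f (- L) = 0 by apply: f0; rewrite normrN ger0_norm// ltW.
    by rewrite subee.
  - have cf x : f z @[z --> x] --> f x.
      by apply/differentiable_continuous/derivable1_diffP; have [] := df x.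
    split.
    + by move=> x _; have [] := df x.
    + exact/cvg_at_right_filter/cf.
    + exact/cvg_at_left_filter/cf.
  - by move=> x _; rewrite derive1E; have [_ ->] := df x.
have fi : leb.-integrable `[- L, L] (EFin \o f').
  by apply: continuous_compact_integrable => //; exact: segment_compact.
have ext (g : R -> \bar R) : (forall t, L <= `|t| -> g t = 0%E) ->
    (\int[leb]_t g t = \int[leb]_(t in `[(- L)%R, L]) g t)%E.
  move=> g0; rewrite [RHS]integral_mkcond; apply: eq_integral => t _.
  rewrite patchE; case: ifPn => //; rewrite notin_setE/= in_itv/= -ler_norml => /negP.
  by rewrite -ltNge => /ltW/g0.
have f'L t : L <= `|t| -> f' t = 0 by move=> h; apply: f'0; exact: le_trans h.
rewrite !ext; last 2 first.
  by move=> t /f'L h; rewrite funenegE/= h oppr0 maxxx.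
  by move=> t /f'L h; rewrite funeposE/= h maxxx.
move: I0; rewrite integralE => /eqP; rewrite sube_eq ?add0e; last 2 first.
- by apply: integrable_pos_fin_num => //; exact: measurable_itv.
- by apply: fin_num_adde_defr.
by move=> /eqP.
Qed.

Variable n : nat.
Implicit Types (i : 'I_n.+1) (U : set 'rV[R]_n.+1).

Lemma rV_insertD i (h t : R) (y : 'rV[R]_n) :
  rV_insert i (h + t) y = h *: delta_mx 0 i + rV_insert i t y.
Proof.
apply/rowP => j; rewrite !mxE eqxx/=.
case: (unliftP i j) => [k ->|->]; last by rewrite eqxx mulr1.
by rewrite eq_sym (negbTE (neq_lift _ _)) mulr0 add0r.
Qed.

Lemma continuous_rV_insert i (y : 'rV[R]_n) : continuous (fun t : R => rV_insert i t y).
Proof.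
move=> t; apply: continuous_rV => j; case: (unliftP i j) => [k ->|->].
  rewrite (_ : (fun s => rV_insert i s y 0 (lift i k)) = cst (y 0 k)); first exact: cst_continuous.
  by apply/funext => s; rewrite rV_insert_lift.
rewrite (_ : (fun s => rV_insert i s y 0 i) = id); first exact: cvg_id.
by apply/funext => s; rewrite rV_insert_id.
Qed.

Lemma is_derive_rV_insert i (y : 'rV[R]_n) (t : R) (w : 'rV[R]_n.+1 -> R) d :
  is_derive (rV_insert i t y) (delta_mx 0 i) w d ->
  is_derive t (1 : R) (fun s => w (rV_insert i s y)) d.
Proof.
by apply: is_derive_along => h; rewrite -rV_insertD [_ *: 1]mulr1.
Qed.

(** Along every line parallel to axis [i] the positive and negative parts of the derivative have the
    same integral; Tonelli's theorem carries this equality to the whole space. *)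
Lemma integral_partial (w : 'rV[R]_n.+1 -> R) G (K : set 'rV[R]_n.+1) i :
  C1g setT w G -> compact K ->
  (forall x, ~ K x -> w x = 0) -> (forall x, ~ K x -> G i x = 0) ->
  \int[leb_rV R n.+1]_x (G i x) = 0.
Proof.
move=> [cw hw] cK w0 G0.
have [M M0 HM] := compact_image_bounded (f := fun x : 'rV[R]_n.+1 => x 0 i) cK
  (continuous_subspaceT (@coord_continuous _ _ _ 0 i)).
have out t y : M + 1 <= `|t| -> ~ K (rV_insert i t y).
  by move=> Mt /HM; rewrite rV_insert_id; lra.
have mG : measurable_fun setT (EFin \o G i).
  apply/measurable_EFinP; apply: rV_continuous_measurable; first exact: openT.
  by apply: continuous_subspaceT => x; have [] := hw i x I.
have e : (\int[lebesgue_rV n.+1]_x (EFin \o G i)^\+ x =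
          \int[lebesgue_rV n.+1]_x (EFin \o G i)^\- x)%E.
  rewrite (@tonelli_rV_insert _ _ i); [|exact: measurable_funepos|by []].
  rewrite (@tonelli_rV_insert _ _ i); [|exact: measurable_funeneg|by []].
  apply: eq_integral => y _.
  transitivity (\int[leb]_t (EFin \o (fun t => G i (rV_insert i t y)))^\+ t)%E.
    by apply: eq_integral => t _; rewrite !funeposE.
  transitivity (\int[leb]_t (EFin \o (fun t => G i (rV_insert i t y)))^\- t)%E; last first.
    by apply: eq_integral => t _; rewrite !funenegE.
  apply: (@integral_derive_compact (fun t => w (rV_insert i t y)) _ (M + 1)).
  - by move=> t; apply: is_derive_rV_insert; have [] := hw i (rV_insert i t y) I.
  - move=> t; apply: (@continuous_comp _ _ _ (fun t => rV_insert i t y) (G i)).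
      exact: continuous_rV_insert.
    by have [] := hw i (rV_insert i t y) I.
  - by move=> t /(out _ y)/w0.
  - by move=> t /(out _ y)/G0.
rewrite /Rintegral integralE /leb_rV e.
(* When [I] is infinite, the difference is an infinite value, which [fine] sends to 0. *)
set I := integral _ _ _; have I0 : (0 <= I)%E by apply: integral_ge0.
by case: I I0 => //= r _; rewrite subrr.
Qed.

End divergence.

Section weak_derivatives.
Variables (R : realType) (n : nat) (Omega : set 'rV[R]_n.+1).
Hypotheses (oOmega : open Omega) (bOmega : bounded_set Omega).
Notation mu := (leb_rV R n.+1).
Implicit Types (u v phi : 'rV[R]_n.+1 -> R) (i : 'I_n.+1).

Lemma mOmega : measurable Omega. Proof. exact: rV_open_measurable. Qed.
Lemma muOmega : (mu Omega < +oo)%E.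
Proof. exact: lebesgue_rV_bounded_lty mOmega bOmega. Qed.

Lemma C1g_measurable u G : C1g Omega u G ->
  measurable_fun Omega u /\ forall i, measurable_fun Omega (G i).
Proof.
move=> [cu h]; split=> [|i].
  by apply: rV_continuous_measurable => //; exact: within_open_continuous.
apply: rV_continuous_measurable => //; apply: within_open_continuous => // x Ox.
by have [] := h i x Ox.
Qed.

Lemma C1_compact_support_bounded phi : C1_compact_support Omega phi ->
  exists2 M, 0 <= M & forall x, `|phi x| <= M /\ forall i, `|partial i phi x| <= M.
Proof.
move=> /C1_compact_supportP[[cphi h] [K [cK KO p0 d0]]].
have [M M0 HM] := compact_image_bounded cK
  (@continuous_subspaceT _ _ K phi (fun x => cphi x I)).
have /choice[N HN] : forall i, exists N, forall x, `|partial i phi x| <= N.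
  move=> i; have [N N0 HN] := compact_image_bounded cK
    (@continuous_subspaceT _ _ K (partial i phi) (fun x => (h i x I).2)).
  exists N => x; have [/HN//|/(d0 i) ->] := pselect (K x); by rewrite normr0.
exists (M + \sum_i `|N i|); first by rewrite addr_ge0// sumr_ge0.
move=> x; split=> [|i].
  apply: (@le_trans _ _ M); last by rewrite lerDl sumr_ge0.
  by have [/HM//|/p0 ->] := pselect (K x); rewrite normr0.
apply: (le_trans (HN i x)); apply: (le_trans (ler_norm _)).
by rewrite (bigD1 i)//= addrCA lerDl addr_ge0// sumr_ge0.
Qed.

Lemma C1_compact_support_sqint phi : C1_compact_support Omega phi ->
  sqint mu Omega phi /\ forall i, sqint mu Omega (partial i phi).
Proof.
move=> hp; have [M M0 HM] := C1_compact_support_bounded hp.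
have /C1_compact_supportP[gp _] := hp.
have [mp md] := C1g_measurable (C1gS (@subsetT _ Omega) gp).
split=> [|i]; apply: (@sqint_bounded _ _ _ mu Omega mOmega muOmega _ M) => //;
  by apply: aeW => x _; have [] := HM x.
Qed.

(** The product of [u] and [phi], extended by 0, is of class C^1 with compact support, so its i-th
    derivative integrates to 0. The function [u] may behave arbitrarily near the boundary. *)
Lemma Rintegral_by_parts u G phi i : C1g Omega u G ->
  sqint mu Omega u -> (forall i, sqint mu Omega (G i)) ->
  C1_compact_support Omega phi ->
  \int[mu]_(x in Omega) (u x * partial i phi x) =
  - \int[mu]_(x in Omega) (G i x * phi x).
Proof.
move=> gu su sG hp; have [sp sdp] := C1_compact_support_sqint hp.
have s1 := sqint_mul mOmega (sG i) sp; have s2 := sqint_mul mOmega su (sdp i).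
have [h1 h2] := C1_compact_supportM oOmega gu hp.
have [_ [K [cK KO w0 dw0]]] := C1_compact_supportP h1.
have dw x : ~ K x ->
    ((fun x0 => G i x0 * phi x0 + u x0 * partial i phi x0) \_ Omega) x = 0.
  by move=> nK; rewrite -(dw0 i x nK) (C1g_partial i h2 I).
have := integral_partial h2 cK w0 dw; rewrite -Rintegral_mkcond.
by rewrite RintegralD//; [move=> /eqP; rewrite addrC addr_eq0 => /eqP|exact: mOmega].
Qed.

(** Approximates the indicator of the open box from inside: the factor of a face vanishes within
    distance 1/k of it and is 1 from distance 2/k on. *)
Definition box_bump (p q : 'rV[R]_n.+1) (k : nat) (x : 'rV[R]_n.+1) : R :=
  \prod_i (step (k%:R * (x 0 i - p 0 i) - 1) * step (k%:R * (q 0 i - x 0 i) - 1)).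

Lemma C1g_prod (I : Type) (r : seq I) (U : set 'rV[R]_n.+1) (F : I -> 'rV[R]_n.+1 -> R) :
  (forall j, exists G, C1g U (F j) G) -> exists G, C1g U (fun x => \prod_(j <- r) F j x) G.
Proof.
move=> h; elim: r => [|j r [G IH]].
  by exists (fun _ => cst 0); under eq_fun do rewrite big_nil; exact: C1g_cst.
have [H hH] := h j; eexists; under eq_fun do rewrite big_cons; exact: C1gM hH IH.
Qed.

Lemma box_bump_C1 p q k : exists G, C1g setT (box_bump p q k) G.
Proof.
apply: C1g_prod => i.
have c := C1g_coord (@setT 'rV[R]_n.+1) i.
have c1 := C1gB (C1gZ k%:R (C1gB c (C1g_cst setT (p 0 i)))) (C1g_cst setT 1).
have c2 := C1gB (C1gZ k%:R (C1gB (C1g_cst setT (q 0 i)) c)) (C1g_cst setT 1).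
eexists; apply: C1gM.
  exact: C1g_comp c1 (@is_derive_step R) (@continuous_dstep R).
exact: C1g_comp c2 (@is_derive_step R) (@continuous_dstep R).
Qed.

Lemma box_bump_ge0_le1 p q k x : 0 <= box_bump p q k x <= 1.
Proof.
apply: (big_ind (fun y => 0 <= y <= 1)); first by rewrite ler01 lexx.
  by move=> y z /andP[? ?] /andP[? ?]; rewrite mulr_ge0//= mulr_ile1.
by move=> i _; rewrite mulr_ge0 ?step_ge0//= mulr_ile1 ?step_ge0 ?step_le1.
Qed.

Lemma box_bump_compact_support p q k : box p q `<=` Omega ->
  C1_compact_support Omega (box_bump p q k).
Proof.
move=> pqO; have [G hG] := box_bump_C1 p q k.
(* For k = 0 every factor is [step (-1) = 0]. *)
have [->|k0] := posnP k.
  have -> : box_bump p q 0 = cst 0; last exact: C1_compact_support0.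
  apply/funext => x; rewrite /box_bump big_ord_recl/= mul0r sub0r step_le0 ?mul0r//.
have k0' : 0 < k%:R :> R by rewrite ltr0n.
pose K := [set x : 'rV[R]_n.+1 | forall i,
  (\row_i (p 0 i + k%:R^-1)) 0 i <= x 0 i <= (\row_i (q 0 i - k%:R^-1)) 0 i].
apply: (@C1_compact_support_intro _ _ _ K).
- exact: C1g_C1 hG.
- exact: compact_cbox.
- move=> x Kx; apply: pqO => i; have := Kx i; rewrite !mxE.
  have : 0 < k%:R^-1 :> R by rewrite invr_gt0.
  lra.
- move=> x nK; have [i Hi] : exists i, ~~ (p 0 i + k%:R^-1 <= x 0 i <= q 0 i - k%:R^-1).
    apply: contra_notP nK => h i; rewrite !mxE; apply/negPn/negP => hi; apply: h.
    by exists i.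
  rewrite /box_bump (bigD1 i)//= [X in X * _](_ : _ = 0) ?mul0r//.
  move: Hi; rewrite negb_and -!ltNge => /orP[h|h].
    rewrite step_le0 ?mul0r// subr_le0 mulrC -ler_pdivlMr// mul1r.
    by rewrite lerBlDl ltW.
  rewrite (@step_le0 _ (_ * (q 0 i - _) - 1)) ?mulr0// subr_le0 mulrC -ler_pdivlMr// mul1r.
  by rewrite lerBlDl -lerBlDr ltW.
Qed.

Lemma box_bump_cvg p q x : box_bump p q k x @[k --> \oo] --> (\1_(box p q) x : R).
Proof.
rewrite indicE; have [xb|xb] := boolP (x \in box p q); last first.
  apply: cvg_near_cst; apply: nearW => k; rewrite /box_bump.
  have [i Hi] : exists i, ~~ (p 0 i < x 0 i < q 0 i).
    move/negP : xb; rewrite inE; apply: contra_notP => h i.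
    by apply/negPn/negP => hi; apply: h; exists i.
  rewrite (bigD1 i)//= [X in X * _](_ : _ = 0) ?mul0r//.
  move: Hi; rewrite negb_and -!leNgt => /orP[h|h].
    rewrite step_le0 ?mul0r// subr_le0; apply: (@le_trans _ _ 0) => //.
    by rewrite mulr_ge0_le0 ?subr_le0.
  rewrite (@step_le0 _ (_ * (q 0 i - _) - 1)) ?mulr0// subr_le0; apply: (@le_trans _ _ 0) => //.
  by rewrite mulr_ge0_le0 ?subr_le0.
apply: cvg_near_cst; move: xb; rewrite inE => xb.
have h i : \forall k \near \oo, 2 <= k%:R * (x 0 i - p 0 i) /\ 2 <= k%:R * (q 0 i - x 0 i).
  have /andP[h1 h2] := xb i.
  have g (e : R) : 0 < e -> \forall k \near \oo, 2 <= k%:R * e.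
    move=> e0; near=> k; rewrite -ler_pdivrMr//.
    by near: k; exact: nbhs_infty_ger.
  have g1 := g (x 0 i - p 0 i); have g2 := g (q 0 i - x 0 i).
  by apply: filterS2 (g1 _) (g2 _); rewrite ?subr_gt0.
have H := @filter_forall _ _ _ _ _ h; near=> k.
have Hk : forall i, 2 <= k%:R * (x 0 i - p 0 i) /\ 2 <= k%:R * (q 0 i - x 0 i).
  by near: k; exact: H.
rewrite /box_bump big1// => i _; have [h1 h2] := Hk i.
by rewrite !step_ge1 ?mul1r//; lra.
Unshelve. all: by end_near. Qed.

Lemma integral_box0 f p q : summable mu Omega f ->
  (forall phi, C1_compact_support Omega phi -> \int[mu]_(x in Omega) (f x * phi x) = 0) ->
  box p q `<=` Omega -> \int[mu]_(x in box p q) f x = 0.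
Proof.
move=> sf f0 pqO; have mf := summable_meas sf.
rewrite -(setIidr pqO) Rintegral_mkcondr.
have [si e] : summable mu Omega (fun x => f x * \1_(box p q) x) /\
  (\int[mu]_(x in Omega) (f x * box_bump p q k x)%:E)%E @[k --> \oo] -->
    (\int[mu]_(x in Omega) (f x * \1_(box p q) x)%:E)%E.
  have mb k : measurable_fun Omega (fun x => f x * box_bump p q k x).
    apply: measurable_funM => //; have [G hG] := box_bump_C1 p q k.
    by have [] := C1g_measurable (C1gS (@subsetT _ Omega) hG).
  have mi : measurable_fun Omega (fun x => f x * \1_(box p q) x).
    by apply: measurable_funM => //; apply: measurable_indic; exact: measurable_box.
  have [] := @dominated_convergence _ _ _ mu Omega mOmega
    (fun k x => (f x * box_bump p q k x)%:E) (fun x => (f x * \1_(box p q) x)%:E)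
    (fun x => `|f x|%:E) => //.
  - by move=> k; exact/measurable_EFinP.
  - exact/measurable_EFinP.
  - apply: aeW => x Ox; apply: EFin_cvg; apply: cvgM; first exact: cvg_cst.
    exact: box_bump_cvg.
  - have := integrable_norm sf; exact.
  - apply: aeW => x k Ox; rewrite lee_fin normrM ler_piMr//.
    by have /andP[b0 b1] := box_bump_ge0_le1 p q k x; rewrite ger0_norm.
rewrite -(fineK (summable_fin_num mOmega si)) in e.
have := fine_cvg e; rewrite (_ : fine \o _ = cst 0); last first.
  apply/funext => k /=; rewrite -[RHS](f0 (box_bump p q k))//.
  exact: box_bump_compact_support.
move=> /(_ _) e0.
have c0 : (0 : R) @[_ --> \oo] --> (0 : R) by exact: cvg_cst.
have h := cvg_unique (@Rhausdorff R) e0 c0.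
transitivity (\int[mu]_(x in Omega) (f x * \1_(box p q) x)); last exact: (h _).
by apply: eq_Rintegral => x _; rewrite patchE indicE; case: ifP; rewrite ?mulr1 ?mulr0.
Qed.

(** Testing with [box_bump] shows that [f] integrates to 0 over every box inside [Omega]. Inside a
    ball contained in [Omega] this extends to all measurable sets by Dynkin's lemma, in particular
    to the sets where f > 0 and f < 0, which are therefore null. Countably many such balls cover
    [Omega]. *)
Lemma fundamental_lemma f : summable mu Omega f ->
  (forall phi, C1_compact_support Omega phi -> \int[mu]_(x in Omega) (f x * phi x) = 0) ->
  {ae mu, forall x, Omega x -> f x = 0}.
Proof.
move=> sf f0.
have key c r : 0 < r -> ball c r `<=` Omega ->
    {ae mu, forall x, ball c r x -> f x = 0}.
  move=> r0 bO; set Q := ball c r; have mQ : measurable Q by exact: rV_measurable_ball.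
  (* Balls of the sup norm are boxes. *)
  have QE : Q = box (\row_i (c 0 i - r)) (\row_i (c 0 i + r)) by exact: ball_box.
  have sS (A : set 'rV[R]_n.+1) : measurable A -> A `<=` Omega -> summable mu A f.
    by move=> mA AO; exact: (integrableS mOmega mA AO sf).
  have IQ : \int[mu]_(x in Q) f x = 0 by rewrite QE; apply: integral_box0 => //; rewrite -QE.
  have H A : measurable A -> \int[mu]_(x in A `&` Q) f x = 0.
    rewrite measurable_gen_box; apply: (dynkin_induction (G := [set A | exists p q, A = box p q])
      (P := fun A => \int[mu]_(x in A `&` Q) f x = 0)).
    - exact: measurable_gen_box.
    - by move=> _ _ [p [q ->]] [p' [q' ->]]; rewrite box_setI; eexists; eexists.
    - by rewrite setTI.
    - move=> _ [p [q ->]]; rewrite QE box_setI; apply: integral_box0 => //.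
      by rewrite -box_setI -QE; apply: subset_trans bO => x [].
    - move=> S mS S0; have := IQ.
      rewrite {1}(_ : Q = (S `&` Q) `|` (~` S `&` Q)); last by rewrite -setIUl setUCr setTI.
      rewrite Rintegral_setU; [by rewrite S0 add0r|exact: measurableI| | |].
      + by apply: measurableI => //; exact: measurableC.
      + by rewrite -setIUl setUCr setTI; exact: sS.
      + by apply/disj_setPS => x [[? _] []].
    - move=> F mF tF F0; rewrite setI_bigcupl.
      rewrite /Rintegral integral_bigcup//.
      + rewrite eseries0// => k _ _.
        have := F0 k; rewrite /Rintegral => h.
        by rewrite -(fineK (integrable_fin_num _ (sS _ _ _))) ?h//;
          [exact: measurableI|exact: measurableI|move=> x [_ /bO]].
      + exact: trivIset_setIr.
      + by move=> k; exact: measurableI.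
      + apply: sS; first by apply: bigcup_measurable => k _; exact: measurableI.
        by move=> x [k _ [_ /bO]].
  (* With s = 1 and s = -1 this treats the sets where f > 0 and f < 0 together. *)
  have sg (s : R) : `|s| = 1 -> {ae mu, forall x, Q x -> 0 < s * f x -> False}.
    move=> s1; pose A := Omega `&` [set x | 0 < s * f x].
    have mA : measurable A.
      have : measurable_fun Omega (fun x => s * f x).
        by apply: measurable_funM => //; exact: summable_meas sf.
      move=> /(_ mOmega `]0, +oo[%classic (measurable_itv _)).
      by rewrite (_ : _ @^-1` _ = [set x | 0 < s * f x])//; apply/seteqP; split => x /=; rewrite in_itv/= andbT.
    have sA : summable mu (A `&` Q) (fun x => s * f x).
      apply: summableZ; [exact: measurableI|apply: sS; first exact: measurableI].
      by move=> x [[]].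
    have : {ae mu, forall x, (A `&` Q) x -> s * f x = 0}.
      apply: Rintegral_eq0_ae => //; first exact: measurableI.
        by apply: aeW => x [[_ /ltW]].
      rewrite RintegralZl; [|exact: measurableI|].
        by rewrite H// mulr0.
      by apply: sS; [exact: measurableI|move=> x [[]]].
    apply: filterS => x h Qx sf0; have := h (conj (conj (bO _ Qx) sf0) Qx).
    by move=> e; rewrite e ltxx in sf0.
  have h1 := sg 1 (normr1 _); have h2 : {ae mu, forall x, Q x -> 0 < (-1) * f x -> False}.
    by apply: sg; rewrite normrN1.
  apply: filterS2 h1 h2 => x p1 p2 Qx; have := p1 Qx; have := p2 Qx.
  rewrite mul1r mulN1r oppr_gt0 => a b; apply/eqP; rewrite eq_le !leNgt.
  by apply/andP; split; apply/negP.
have [B [HB OB]] := rV_open_bigcup_ball oOmega.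
have h : {ae mu, forall x, forall k, B k x -> f x = 0}.
  apply: ae_foralln => k; have [->|[c [r [r0 Bk]]]] := HB k.
    by apply: aeW => x [].
  rewrite Bk; apply: key => //; rewrite -Bk => x Bx; rewrite OB; by exists k.
by apply: filterS h => x H; rewrite OB => -[k _ /H].
Qed.

End weak_derivatives.

(** * Weak gradients and the closure of the test functions *)

Lemma sqint_summable d (T : measurableType d) (R : realType)
  (mu : {measure set T -> \bar R}) (D : set T) (u : T -> R) :
  measurable D -> (mu D < +oo)%E -> sqint mu D u -> summable mu D u.
Proof.
move=> mD muD su.
have s1 : sqint mu D (cst 1).
  by apply: (@sqint_bounded _ _ _ _ _ mD muD _ 1) => //; apply: aeW => x _; rewrite normr1.
have := sqint_mul mD su s1; apply: eq_integrable => // x _.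
by rewrite /= mulr1.
Qed.

Section sobolev_spaces.
Variables (R : realType) (n : nat) (Omega : set 'rV[R]_n.+1).
Hypotheses (oOmega : open Omega) (bOmega : bounded_set Omega).
Notation mu := (leb_rV R n.+1).
Notation fn := ('rV[R]_n.+1 -> R).
Implicit Types (u v phi : fn) (G H : 'I_n.+1 -> fn) (i : 'I_n.+1).
Let mO : measurable Omega. Proof. exact: mOmega oOmega. Qed.
Let muO : (mu Omega < +oo)%E. Proof. exact: muOmega oOmega bOmega. Qed.

Notation S2 := (sqint mu Omega).
Notation N := (nrm2 mu Omega).
Notation wg := (is_weak_gradient Omega).
Notation C1c := (C1_compact_support Omega).

Lemma wg_sqint u G i : wg u G -> S2 (G i). Proof. by move=> /(_ i)[]. Qed.

Lemma wg_test u G phi i : wg u G -> C1c phi ->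
  \int[mu]_(x in Omega) (u x * partial i phi x) = - \int[mu]_(x in Omega) (G i x * phi x).
Proof. by move=> /(_ i)[_]; exact. Qed.

Lemma wg_unique u v G H : S2 u -> S2 v ->
  {ae mu, forall x, Omega x -> u x = v x} -> wg u G -> wg v H ->
  forall i, {ae mu, forall x, Omega x -> G i x = H i x}.
Proof.
move=> su sv uv gG gH i.
have sG := wg_sqint i gG; have sH := wg_sqint i gH.
have sGH := sqint_summable mO muO (sqintB mO sG sH).
have h : {ae mu, forall x, Omega x -> G i x - H i x = 0}.
  apply: (fundamental_lemma oOmega sGH) => phi hp; have [sp sdp] := C1_compact_support_sqint oOmega bOmega hp.
  under eq_Rintegral do rewrite mulrBl.
  rewrite RintegralB//; try exact: sqint_mul.
  apply/eqP; rewrite subr_eq0 -eqr_opp -(wg_test _ gG hp) -(wg_test _ gH hp); apply/eqP.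
  apply: ae_eq_Rintegral => //.
  - exact: measurable_funM (sqint_meas su) (sqint_meas (sdp i)).
  - exact: measurable_funM (sqint_meas sv) (sqint_meas (sdp i)).
  - by apply: filterS uv => x h Ox; rewrite h.
by apply: filterS h => x h Ox; apply/eqP; rewrite -subr_eq0; apply/eqP/h.
Qed.

Lemma wg_ae u v G : S2 u -> S2 v ->
  {ae mu, forall x, Omega x -> u x = v x} -> wg u G -> wg v G.
Proof.
move=> su sv uv gG i; split; first exact: wg_sqint gG.
move=> phi hp; have [sp sdp] := C1_compact_support_sqint oOmega bOmega hp.
rewrite -(wg_test _ gG hp); apply: ae_eq_Rintegral => //.
- exact: measurable_funM (sqint_meas sv) (sqint_meas (sdp i)).
- exact: measurable_funM (sqint_meas su) (sqint_meas (sdp i)).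
- by apply: filterS uv => x h Ox; rewrite h.
Qed.

Lemma wgD u v G H : S2 u -> S2 v -> wg u G -> wg v H ->
  wg (fun x => u x + v x) (fun i x => G i x + H i x).
Proof.
move=> su sv gG gH i; split; first exact: (sqintD mO (wg_sqint i gG) (wg_sqint i gH)).
move=> phi hp; have [sp sdp] := C1_compact_support_sqint oOmega bOmega hp.
under eq_Rintegral do rewrite mulrDl.
under [in RHS]eq_Rintegral do rewrite mulrDl.
rewrite !RintegralD//; [|exact: (sqint_mul mO (wg_sqint i gG))|
  exact: (sqint_mul mO (wg_sqint i gH))|exact: sqint_mul|exact: sqint_mul].
by rewrite opprD -(wg_test _ gG hp) -(wg_test _ gH hp).
Qed.

Lemma wgZ (k : R) u G : S2 u -> wg u G -> wg (fun x => k * u x) (fun i x => k * G i x).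
Proof.
move=> su gG i; split; first exact: (sqintZ mO k (wg_sqint i gG)).
move=> phi hp; have [sp sdp] := C1_compact_support_sqint oOmega bOmega hp.
under eq_Rintegral do rewrite -mulrA.
under [in RHS]eq_Rintegral do rewrite -mulrA.
rewrite !RintegralZl//; [|exact: (sqint_mul mO (wg_sqint i gG))|exact: sqint_mul].
by rewrite (wg_test _ gG hp) mulrN.
Qed.

Lemma wgB u v G H : S2 u -> S2 v -> wg u G -> wg v H ->
  wg (fun x => u x - v x) (fun i x => G i x - H i x).
Proof.
move=> su sv gG gH; have := wgD su (sqintZ mO (-1) sv) gG (wgZ (-1) sv gH).
under eq_fun do rewrite mulN1r.
by under [X in wg _ X]eq_fun do under eq_fun do rewrite mulN1r.
Qed.

Lemma wg_lim (u_ : nat -> fn) (G_ : nat -> 'I_n.+1 -> fn) u G :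
  (forall k, S2 (u_ k)) -> (forall k, wg (u_ k) (G_ k)) -> S2 u -> (forall i, S2 (G i)) ->
  N (fun x => u_ k x - u x) @[k --> \oo] --> 0 ->
  (forall i, N (fun x => G_ k i x - G i x) @[k --> \oo] --> 0) -> wg u G.
Proof.
move=> su_ gG_ su sG cu cG i; split=> [|phi hp]; first exact: sG.
have [sp sdp] := C1_compact_support_sqint oOmega bOmega hp.
have c1 := cvg_Rintegral_mul mO su_ su (sdp i) cu.
have c2 := cvg_Rintegral_mul mO (fun k => wg_sqint i (gG_ k)) (sG i) sp (cG i).
have c3 : - (\int[mu]_(x in Omega) (G_ k i x * phi x)) @[k --> \oo] -->
  - (\int[mu]_(x in Omega) (G i x * phi x)) by exact: cvgN.
move: c1; rewrite (_ : (fun k => \int[mu]_(x in Omega) (u_ k x * partial i phi x)) =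
  fun k => - (\int[mu]_(x in Omega) (G_ k i x * phi x))); last first.
  by apply/funext => k; rewrite (wg_test _ (gG_ k) hp).
by move=> c1; apply: (cvg_unique (@Rhausdorff R) c1 c3).
Qed.

Lemma C1g_wg u G : C1g Omega u G -> S2 u -> (forall i, S2 (G i)) -> wg u G.
Proof.
move=> gu su sG i; split=> [|phi hp]; first exact: sG.
exact: Rintegral_by_parts.
Qed.

Lemma C1c_wg phi : C1c phi -> wg phi (fun i => partial i phi).
Proof.
move=> hp; have [sp sdp] := C1_compact_support_sqint oOmega bOmega hp.
have [/(C1gS (@subsetT _ Omega)) gp _] := C1_compact_supportP hp.
exact: C1g_wg.
Qed.

(* Pairs of a function of H10 and a gradient: carrying the gradient avoids the
   choice made by weak_gradient. *)
Definition H0 u G : Prop := [/\ S2 u, (forall i, S2 (G i)) &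
  forall e, 0 < e -> exists phi, [/\ C1c phi, N (fun x => phi x - u x) < e &
    forall i, N (fun x => partial i phi x - G i x) < e]].

Lemma H0_approx u G : H0 u G -> exists phi : nat -> fn,
  [/\ forall k, C1c (phi k),
      N (fun x => phi k x - u x) @[k --> \oo] --> 0 &
      forall i, N (fun x => partial i (phi k) x - G i x) @[k --> \oo] --> 0].
Proof.
move=> [su sG h].
have /choice[phi hphi] : forall k : nat, exists phi,
    [/\ C1c phi, N (fun x => phi x - u x) < k.+1%:R^-1 &
    forall i, N (fun x => partial i phi x - G i x) < k.+1%:R^-1].
  by move=> k; apply: h; rewrite invr_gt0.
exists phi; split=> [k||i].
- by have [] := hphi k.
- apply: (cvg_ge0_le _ (@cvg_harmonic R)) => k; have [_ h1 _] := hphi k.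
  by rewrite nrm2_ge0 ltW.
- apply: (cvg_ge0_le _ (@cvg_harmonic R)) => k; have [_ _ h1] := hphi k.
  by rewrite nrm2_ge0 ltW.
Qed.

Lemma H0_wg u G : H0 u G -> wg u G.
Proof.
move=> h; have [su sG _] := h; have [phi [hp c1 c2]] := H0_approx h.
apply: (wg_lim (u_ := phi) (G_ := fun k i => partial i (phi k))) => // k.
  by have [] := C1_compact_support_sqint oOmega bOmega (hp k).
exact: C1c_wg.
Qed.

Lemma C1c_H0 phi : C1c phi -> H0 phi (fun i => partial i phi).
Proof.
move=> hp; have [sp sdp] := C1_compact_support_sqint oOmega bOmega hp.
split=> // e e0; exists phi; split=> // [|i].
  by rewrite nrm2_subrr.
by rewrite nrm2_subrr.
Qed.

Lemma H0_closed u G : S2 u -> (forall i, S2 (G i)) ->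
  (forall e, 0 < e -> exists v H, [/\ H0 v H, N (fun x => v x - u x) < e &
    forall i, N (fun x => H i x - G i x) < e]) -> H0 u G.
Proof.
move=> su sG h; split=> // e e0; have e4 : 0 < e / 4 by rewrite divr_gt0.
have [v [H [[sv sH hv] h1 h2]]] := h _ e4; have [phi [hp p1 p2]] := hv _ e4.
have [sp sdp] := C1_compact_support_sqint oOmega bOmega hp.
have key a b c : S2 a -> S2 b -> S2 c -> N (fun x => a x - b x) < e / 4 ->
    N (fun x => b x - c x) < e / 4 -> N (fun x => a x - c x) < e.
  move=> sa sb sc ab bc; rewrite (_ : (fun x => _) = fun x => (a x - b x) + (b x - c x)).
    apply: le_lt_trans (nrm2D_le mO _ _) _; [exact: sqintB|exact: sqintB|].
    lra.
  by apply/funext => x; ring.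
exists phi; split=> // [|i]; first exact: key p1 h1.
exact: key (p2 i) (h2 i).
Qed.

Lemma H0D u v G H : H0 u G -> H0 v H ->
  H0 (fun x => u x + v x) (fun i x => G i x + H i x).
Proof.
move=> [su sG hu] [sv sH hv]; split=> [|i|e e0]; [exact: sqintD|exact: sqintD|].
have e4 : 0 < e / 4 by rewrite divr_gt0.
have [phi [hp p1 p2]] := hu _ e4; have [psi [hq q1 q2]] := hv _ e4.
have [sp sdp] := C1_compact_support_sqint oOmega bOmega hp.
have [sq sdq] := C1_compact_support_sqint oOmega bOmega hq.
have key a b c d : S2 a -> S2 b -> S2 c -> S2 d -> N (fun x => a x - c x) < e / 4 ->
    N (fun x => b x - d x) < e / 4 -> N (fun x => (a x + b x) - (c x + d x)) < e.
  move=> sa sb sc sd ab bc.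
  rewrite (_ : (fun x => _) = fun x => (a x - c x) + (b x - d x)).
    apply: le_lt_trans (nrm2D_le mO _ _) _; [exact: sqintB|exact: sqintB|].
    lra.
  by apply/funext => x; ring.
exists (fun x => phi x + psi x); split=> // [||i].
- exact: C1_compact_supportD.
- exact: key p1 q1.
- have [gp _] := C1_compact_supportP hp; have [gq _] := C1_compact_supportP hq.
  rewrite (_ : partial i _ = fun x => partial i phi x + partial i psi x).
    exact: key (p2 i) (q2 i).
  by apply/funext => x; rewrite (C1g_partial i (C1gD gp gq) I).
Qed.

Lemma H0Z (k : R) u G : H0 u G -> H0 (fun x => k * u x) (fun i x => k * G i x).
Proof.
move=> [su sG hu]; split=> [|i|e e0]; [exact: sqintZ|exact: sqintZ|].
have k1 : 0 < k ^+ 2 + 1 by rewrite ltr_wpDl// sqr_ge0.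
have [phi [hp p1 p2]] := hu _ (divr_gt0 e0 k1).
have [sp sdp] := C1_compact_support_sqint oOmega bOmega hp.
have key a c : S2 a -> S2 c -> N (fun x => a x - c x) < e / (k ^+ 2 + 1) ->
    N (fun x => k * a x - k * c x) < e.
  move=> sa sc; rewrite ltr_pdivlMr// => ac.
  rewrite (_ : (fun x => _) = fun x => k * (a x - c x)).
    rewrite nrm2Z//; last exact: sqintB.
    apply: le_lt_trans ac; rewrite mulrC ler_wpM2l ?nrm2_ge0//; lra.
  by apply/funext => x; ring.
exists (fun x => k * phi x); split=> // [||i].
- exact: C1_compact_supportZ.
- exact: key p1.
- have [gp _] := C1_compact_supportP hp.
  rewrite (_ : partial i _ = fun x => k * partial i phi x).
    exact: key (p2 i).
  by apply/funext => x; rewrite (C1g_partial i (C1gZ k gp) I).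
Qed.

Lemma H0B u v G H : H0 u G -> H0 v H ->
  H0 (fun x => u x - v x) (fun i x => G i x - H i x).
Proof.
move=> hu hv; have := H0D hu (H0Z (-1) hv).
under eq_fun do rewrite mulN1r.
by under [X in H0 _ X]eq_fun do under eq_fun do rewrite mulN1r.
Qed.

Lemma H0_ae u v G H : H0 u G -> S2 v -> (forall i, S2 (H i)) ->
  {ae mu, forall x, Omega x -> u x = v x} ->
  (forall i, {ae mu, forall x, Omega x -> G i x = H i x}) -> H0 v H.
Proof.
move=> hu sv sH uv GH; have [su sG _] := hu.
have key a b : S2 a -> S2 b -> {ae mu, forall x, Omega x -> a x = b x} ->
   N (fun x => a x - b x) = 0.
  move=> sa sb ab; rewrite (nrm2_ae_eq mO (v := cst 0)) ?nrm2_cst0//.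
  - exact: sqint_meas (sqintB mO sa sb).
  - by apply: filterS ab => x h Ox; rewrite h// subrr.
apply: (H0_closed sv sH) => e e0; exists u, G; split=> [//||i]; rewrite key//.
Qed.

Lemma H0_cst0 : H0 (cst 0) (fun _ => cst 0).
Proof.
have h := C1c_H0 (C1_compact_support0 Omega).
have e i : partial i (cst 0 : fn) = cst 0.
  by apply/funext => x; rewrite (C1g_partial i (C1g_cst setT 0) I).
by rewrite (_ : (fun _ => cst 0) = fun i => partial i (cst 0 : fn))//; apply/funext => i; rewrite e.
Qed.

(** For a test function, integration by parts of x_0 against phi^2 gives N phi = -2 I, where I is
    the integral of x_0 phi d_0 phi. Since |x_0| is bounded on [Omega], the Cauchy-Schwarz
    inequality bounds I^2 by M^2 N phi N (d_0 phi). The estimate then passes to the closure. *)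
Lemma poincare : exists2 C, 0 < C & forall u G, H0 u G -> N u <= C * \sum_i N (G i).
Proof.
have [M HM] : exists M, forall x, Omega x -> `|x 0 0| <= M.
  have [M [_ HM]] := bOmega; exists (M + 1) => x Ox.
  have := HM (M + 1); rewrite ltrDl => /(_ ltr01 _ Ox); apply: le_trans.
  rewrite [leRHS]mx_normrE.
  exact: (le_bigmax _ (fun ij : 'I_1 * 'I_n.+1 => `|x ij.1 ij.2|) (0, 0)).
pose C := 4 * `|M| ^+ 2 + 1.
have C0 : 0 < C by rewrite ltr_wpDl// mulr_ge0// sqr_ge0.
have key phi : C1c phi -> N phi <= C * N (partial 0 phi).
  move=> hp; have [sp sdp] := C1_compact_support_sqint oOmega bOmega hp.
  have [gp [K [cK KO p0 _]]] := C1_compact_supportP hp.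
  have gc := C1g_coord Omega (0 : 'I_n.+1).
  have hq : C1c (fun x => phi x * phi x).
    apply: (@C1_compact_support_intro _ _ _ K) => //.
      exact: C1g_C1 (C1gM gp gp).
    by move=> x nK; rewrite p0// mul0r.
  have mc : measurable_fun Omega (fun x : 'rV[R]_n.+1 => x 0 0).
    by have [] := C1g_measurable oOmega gc.
  have aM : {ae mu, forall x, Omega x -> `|x 0 0| <= `|M|}.
    by apply: aeW => x Ox; apply: le_trans (HM x Ox) (ler_norm _).
  have := Rintegral_by_parts oOmega bOmega 0 gc _ _ hq.
  have -> : \int[mu]_(x in Omega) (cst (0 == 0 :> 'I_n.+1)%:R x * (phi x * phi x)) = N phi.
    by apply: eq_Rintegral => x _; rewrite /= mul1r expr2.
  have sc : S2 (fun x : 'rV[R]_n.+1 => x 0 0) by apply: (sqint_bounded mO muO mc aM).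
  have sd i : S2 (cst (i == 0)%:R : fn).
    apply: (@sqint_bounded _ _ _ _ _ mO muO _ 1) => //; apply: aeW => x _.
    by rewrite /cst; case: (_ == _); rewrite ?normr1 ?normr0.
  move=> /(_ sc sd); rewrite (_ : \int[mu]_(x in Omega) _ =
     2 * \int[mu]_(x in Omega) ((x 0 0 * phi x) * partial 0 phi x)); last first.
    rewrite -RintegralZl//; last first.
      by apply: (sqint_mul mO) => //; exact: (sqint_bmul mO mc aM).
    apply: eq_Rintegral => x _; rewrite (C1g_partial 0 (C1gM gp gp) I); ring.
  have := cauchy_schwarz mO (sqint_bmul mO mc aM sp) (sdp 0).
  set I := \int[mu]_(x in Omega) _ => cs e.
  have h : N (fun x => x 0 0 * phi x) <= `|M| ^+ 2 * N phi by apply: nrm2_bmul.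
  have n1 := nrm2_ge0 mu Omega phi; have n2 := nrm2_ge0 mu Omega (partial 0 phi).
  have {cs}cs : I ^+ 2 <= `|M| ^+ 2 * N phi * N (partial 0 phi).
    by apply: le_trans cs _; rewrite ler_wpM2r.
  have I2 : 4 * I ^+ 2 = N phi ^+ 2.
    have -> : N phi = - (2 * I) by rewrite e opprK.
    by ring.
  have [N0|N0] := ltP 0 (N phi); last first.
    apply: le_trans N0 _; rewrite mulr_ge0// ltW//.
  rewrite -(ler_pM2l N0) -expr2 -I2 /C.
  have m2 := sqr_ge0 `|M|; nra.
(* The factor 4 comes from two uses of |s + t|^2 <= 2 |s|^2 + 2 |t|^2, one for the function and one
   for its derivative. *)
exists (4 * C); first by rewrite mulr_gt0.
move=> u G [su sG h]; apply/ler_addgt0Pr => e e0.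
have e' : 0 < e / (2 + 4 * C) by rewrite divr_gt0// addr_gt0// mulr_gt0.
have [phi [hp p1 p2]] := h _ e'.
have [sp sdp] := C1_compact_support_sqint oOmega bOmega hp.
have h1 : N u <= 2 * N (fun x => phi x - u x) + 2 * N phi.
  have := nrm2B_le mO sp (sqintB mO sp su); rewrite addrC.
  by congr (_ <= _); congr nrm2; apply/funext => x; ring.
have h2 : N (partial 0 phi) <= 2 * N (fun x => partial 0 phi x - G 0 x) + 2 * N (G 0).
  have := nrm2D_le mO (sqintB mO (sdp 0) (sG 0)) (sG 0).
  by congr (_ <= _); congr nrm2; apply/funext => x; ring.
have h3 := key _ hp; have h4 := p2 0.
have h5 : N (G 0) <= \sum_i N (G i).
  by rewrite (bigD1 0)//= lerDl sumr_ge0// => i _; exact: nrm2_ge0.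
set e1 := e / _ in h4 p1; have ee : e = e1 * (2 + 4 * C).
  by rewrite /e1 divfK// gt_eqF// addr_gt0// mulr_gt0.
rewrite ee; move: h5; set S := \sum_i _ => h5.
move: (N u) (N phi) (N (partial 0 phi)) (N (fun x => phi x - u x))
  (N (fun x => partial 0 phi x - G 0 x)) (N (G 0)) h1 h2 h3 h4 h5 p1
  => a b c d f g h1 h2 h3 h4 h5 p1.
have : C * c <= C * (2 * e1 + 2 * S) by rewrite ler_pM2l//; lra.
lra.
Qed.

Lemma sqnorm_L2E u : S2 u -> sqnorm_L2 Omega u = (N u)%:E.
Proof. by move=> su; exact: sqnormE. Qed.

Lemma H1P u : H1 Omega u <-> exists G, S2 u /\ wg u G.
Proof. by split=> [[su [G hG]]|[G [su hG]]]; [exists G|split; [exact: su|exists G]]. Qed.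

Lemma H1_weak_gradient u : H1 Omega u -> wg u (weak_gradient Omega u).
Proof.
by move=> [_ [G hG]]; apply: (xgetPex (fun _ _ => 0) (P := [set G | wg u G])); exists G.
Qed.

Lemma sqnorm_H1E u G : S2 u -> wg u G ->
  sqnorm_H1 Omega u = (N u + \sum_i N (G i))%:E.
Proof.
move=> su gG; have H1u : H1 Omega u by apply/H1P; exists G.
have gw := H1_weak_gradient H1u.
rewrite /sqnorm_H1 sqnorm_L2E// EFinD; congr (_ + _)%E.
rewrite -sumEFin; apply: eq_bigr => i _; rewrite sqnorm_L2E; last exact: wg_sqint gw.
congr EFin; apply: nrm2_ae_eq => //.
- exact: sqint_meas (wg_sqint i gw).
- exact: sqint_meas (wg_sqint i gG).
- by apply: wg_unique gw gG i => //; exact: aeW.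
Qed.

(** The norm [sqnorm_H1] is computed with a chosen gradient, but by uniqueness any weak gradient
    gives the same value; a finite sum of nonnegative sequences tends to 0 exactly when each of them
    does. *)
Lemma cvg_H1P (u_ : nat -> fn) (G_ : nat -> 'I_n.+1 -> fn) u G :
  (forall k, S2 (u_ k)) -> (forall k, wg (u_ k) (G_ k)) -> S2 u -> wg u G ->
  cvg_H1 Omega u_ u <->
  N (fun x => u_ k x - u x) @[k --> \oo] --> 0 /\
  forall i, N (fun x => G_ k i x - G i x) @[k --> \oo] --> 0.
Proof.
move=> su_ gG_ su gG.
pose A k := N (fun x => u_ k x - u x).
pose B k := \sum_i N (fun x => G_ k i x - G i x).
have e k : sqnorm_H1 Omega (u_ k \- u) = (A k + B k)%:E.
  by rewrite (@sqnorm_H1E _ (fun i x => G_ k i x - G i x))//; [exact: sqintB|exact: wgB].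
rewrite /cvg_H1 (_ : (fun k => _) = fun k => (A k + B k)%:E); last exact/funext.
have A0 k : 0 <= A k by exact: nrm2_ge0.
have B0 k : 0 <= B k by apply: sumr_ge0 => i _; exact: nrm2_ge0.
split=> [/fine_cvg /= h|[c1 c2]].
  split=> [|i]; apply: cvg_ge0_le h => k.
    by rewrite A0/= lerDl.
  rewrite nrm2_ge0/= (le_trans _ (_ : B k <= _))//; last by rewrite lerDr.
  by rewrite /B (bigD1 i)//= lerDl sumr_ge0// => j _; exact: nrm2_ge0.
apply: EFin_cvg; rewrite -(addr0 0); apply: cvgD => //.
have -> : (0 : R) = \sum_(i < n.+1) 0 by rewrite big1.
by apply: cvg_big => //; exact: add_continuous.
Qed.

Lemma H10P u : H10 Omega u <-> exists G, H0 u G.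
Proof.
split=> [[H1u [phi [hp cp]]]|[G hG]].
  have gw := H1_weak_gradient H1u; exists (weak_gradient Omega u).
  have su : S2 u by case: H1u.
  split=> // [i|e e0]; first exact: wg_sqint gw.
  have sphi k : S2 (phi k) by have [] := C1_compact_support_sqint oOmega bOmega (hp k).
  have [+ _] := cvg_H1P sphi (fun k => C1c_wg (hp k)) su gw.
  move=> /(_ cp)[c1 c2].
  have [k0 Hk0] := (cvg0_ltP (fun k => nrm2_ge0 mu Omega _)).1 c1 _ e0.
  have /choice[K HK] : forall i, exists K, forall k, (K <= k)%N ->
      N (fun x => partial i (phi k) x - weak_gradient Omega u i x) < e.
    by move=> i; exact: (cvg0_ltP (fun k => nrm2_ge0 mu Omega _)).1 (c2 i) _ e0.
  pose k := (k0 + \sum_i K i)%N; exists (phi k); split=> // [|i].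
    by apply: Hk0; rewrite leq_addr.
  by apply: HK; rewrite /k (bigD1 i)//= addnCA leq_addr.
have [su sG _] := hG; have gG := H0_wg hG; split; first by apply/H1P; exists G.
have [phi [hp c1 c2]] := H0_approx hG; exists phi; split=> //.
have sphi k : S2 (phi k) by have [] := C1_compact_support_sqint oOmega bOmega (hp k).
by apply/(cvg_H1P sphi (fun k => C1c_wg (hp k)) su gG).
Qed.

Lemma H10_weak_gradient u : H10 Omega u -> H0 u (weak_gradient Omega u).
Proof.
move=> /[dup] -[H1u _] /H10P[G hG]; have [su sG _] := hG.
have gw := H1_weak_gradient H1u.
apply: (H0_ae hG) => //.
- by move=> i; exact: wg_sqint gw.
- exact: aeW.
- by move=> i; apply: wg_unique (H0_wg hG) gw i => //; exact: aeW.
Qed.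

End sobolev_spaces.

(** * Functions of class C^1 up to the boundary *)

Lemma MVT_lip (R : realType) (F F' : R -> R) (M : R) :
  (forall t : R, is_derive t (1 : R) F (F' t)) -> (forall t, `|F' t| <= M) ->
  forall s t, `|F s - F t| <= M * `|s - t|.
Proof.
move=> dF FM.
have cF : continuous F.
  by move=> x; apply/differentiable_continuous/derivable1_diffP; have [] := dF x.
have key s t : s <= t -> `|F t - F s| <= M * `|t - s|.
  move=> st; have [c _ ->] := MVT_segment st (fun x _ => dF x) (continuous_subspaceT cF).
  by rewrite normrM ler_wpM2r.
move=> s t; have [/key|/ltW/key//] := leP s t.
by rewrite distrC [`|t - s|]distrC.
Qed.

Section continuity_within.
Variable R : realType.

Lemma within_continuous_add (T : topologicalType) (A : set T) (u v : T -> R) :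
  {within A, continuous u} -> {within A, continuous v} ->
  {within A, continuous (fun x => u x + v x)}.
Proof. by move=> cu cv x; exact: (@continuousD _ _ (subspace A) u v x (cu x) (cv x)). Qed.

Lemma within_continuous_mul (T : topologicalType) (A : set T) (u v : T -> R) :
  {within A, continuous u} -> {within A, continuous v} ->
  {within A, continuous (fun x => u x * v x)}.
Proof. by move=> cu cv x; exact: (@continuousM _ (subspace A) u v x (cu x) (cv x)). Qed.

Lemma within_continuous_cst (T : topologicalType) (A : set T) (r : R) :
  {within A, continuous (fun _ : T => r)}.
Proof. by move=> x; exact: cst_continuous. Qed.

Lemma within_continuous_comp (T : topologicalType) (A : set T) (u : T -> R) (F : R -> R) :
  {within A, continuous u} -> continuous F -> {within A, continuous (fun x => F (u x))}.
Proof. by move=> cu cF x; exact: (@continuous_comp (subspace A) _ _ u F x (cu x) (cF _)). Qed.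

Lemma within_continuous_sub (T : topologicalType) (A : set T) (u v : T -> R) :
  {within A, continuous u} -> {within A, continuous v} ->
  {within A, continuous (fun x => u x - v x)}.
Proof.
move=> cu cv; apply: within_continuous_add => //.
by apply: (@within_continuous_comp _ _ v -%R) => // x; exact: opp_continuous.
Qed.

(** Meant for segments that end on the boundary, where [u] is continuous only relative to the
    closure of the domain and the segment only matters for its own parameters. *)
Lemma within_continuous_path (S T : topologicalType) (A : set T) (D : set S)
    (f : S -> T) (u : T -> R) : {within A, continuous u} ->
  {within D, continuous f} -> (forall y, D y -> A (f y)) -> {within D, continuous (u \o f)}.
Proof.
move=> cu cf fA x; rewrite /continuous_at.
case: _ / (nbhs_subspaceP D x) => Dx; last first.
  by move=> ? /nbhs_singleton //= ?; rewrite nbhs_simpl => ? ->.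
move=> B nB.
have h1 : within A (nbhs (f x : T)) (u @^-1` B).
  by rewrite (nbhs_subspace_in (fA _ Dx)); exact: (cu (f x) B nB).
have h2 : within D (nbhs (x : S)) (f @^-1` [set z | A z -> B (u z)]).
  have := cf x _ h1; rewrite /= /fmap /=.
  by have /= -> := @nbhs_subspace_in _ D x Dx.
have {}h2 : nbhs (x : S) [set z : S | D z -> A (f z) -> B (u (f z))] := h2.
change (nbhs (x : S) [set z : S | D z -> B (u (f z))]).
by apply: filterS h2 => z h Dz; exact: h Dz (fA _ Dz).
Qed.

End continuity_within.

Section C1_up_to_the_boundary.
Variables (R : realType) (n : nat) (Omega : set 'rV[R]_n.+1).
Hypotheses (oOmega : open Omega) (bOmega : bounded_set Omega).
Notation mu := (leb_rV R n.+1).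
Notation fn := ('rV[R]_n.+1 -> R).
Implicit Types (u v phi h : fn) (G H : 'I_n.+1 -> fn) (i : 'I_n.+1) (k : chart R n.+1).
Let mO : measurable Omega. Proof. exact: mOmega oOmega. Qed.
Let muO : (mu Omega < +oo)%E. Proof. exact: muOmega oOmega bOmega. Qed.

Notation S2 := (sqint mu Omega).
Notation N := (nrm2 mu Omega).
Notation wg := (is_weak_gradient Omega).
Notation C1c := (C1_compact_support Omega).

(** The condition [C1_closure] with the continuous extensions of the derivatives carried as data. *)
Definition C1cl u G : Prop := {within closure Omega, continuous u} /\
  forall i, (forall x, Omega x -> is_derive x (delta_mx 0 i) u (G i x)) /\
    {within closure Omega, continuous (G i)}.

Lemma C1_closureP u : C1_closure Omega u <-> exists G, C1cl u G.
Proof.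
split=> [[cu h]|[G [cu h]]].
  have /choice[G hG] : forall i, exists v,
      {within closure Omega, continuous v} /\ {in Omega, v =1 partial i u}.
    by move=> i; have [_ [v hv]] := h i; exists v.
  exists G; split=> // i; have [h1 h2] := hG i; split=> // x Ox.
  by rewrite h2 ?inE//; apply: derivableP; have [/(_ x Ox)] := h i.
split=> // i; have [h1 h2] := h i; split; first by move=> x /h1[].
by exists (G i); split=> // x; rewrite inE => /h1[_ <-].
Qed.

Lemma compact_closure : compact (closure Omega).
Proof.
apply: bounded_closed_compact; last exact: closed_closure.
have [M [Mr HM]] := bOmega; exists M; split => // x Mx y.
have /HM h := Mx.
suff : closure Omega `<=` [set y | `|y| <= x] by apply.
have cl : closed [set y : 'rV[R]_n.+1 | `|y| <= x].
  apply: (preimage_closed (f := fun y : 'rV[R]_n.+1 => `|y|) _ (@closed_le R x)).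
  by move=> z _; exact: norm_continuous.
by rewrite [X in _ `<=` X](closure_id _).1//; apply: closureS => z /h.
Qed.

Lemma within_closure_for u x : {within closure Omega, continuous u} -> Omega x ->
  {for x, continuous u}.
Proof.
move=> /(continuous_subspaceW (@subset_closure _ Omega)).
by rewrite continuous_open_subspace// => h Ox; apply: h; rewrite inE.
Qed.

Lemma C1cl_C1g u G : C1cl u G -> C1g Omega u G.
Proof.
move=> [cu h]; split=> [x|i x] Ox; first exact: within_closure_for.
by have [h1 h2] := h i; split; [exact: h1|exact: within_closure_for].
Qed.

Lemma within_closure_sqint u : {within closure Omega, continuous u} -> S2 u.
Proof.
move=> cu; have [M M0 HM] := compact_image_bounded compact_closure cu.
apply: (@sqint_bounded _ _ _ _ _ mO muO _ M).
  apply: rV_continuous_measurable => //.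
  exact: continuous_subspaceW (@subset_closure _ Omega) cu.
by apply: aeW => x Ox; apply: HM; exact: subset_closure.
Qed.

Lemma C1cl_sqint u G : C1cl u G -> S2 u /\ forall i, S2 (G i).
Proof.
by move=> [cu h]; split=> [|i]; apply: within_closure_sqint => //; have [] := h i.
Qed.

Lemma C1cl_wg u G : C1cl u G -> wg u G.
Proof.
by move=> /[dup] /C1cl_C1g gu /C1cl_sqint[su sG]; exact: C1g_wg.
Qed.

Lemma C1clD u v G H : C1cl u G -> C1cl v H ->
  C1cl (fun x => u x + v x) (fun i x => G i x + H i x).
Proof.
move=> [cu hu] [cv hv]; split=> [|i]; first exact: within_continuous_add.
have [du cG] := hu i; have [dv cH] := hv i; split; last exact: within_continuous_add.
by move=> x Ox; apply: is_derive_addr; [exact: du|exact: dv].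
Qed.

Lemma C1clB u v G H : C1cl u G -> C1cl v H ->
  C1cl (fun x => u x - v x) (fun i x => G i x - H i x).
Proof.
move=> [cu hu] [cv hv]; split=> [|i]; first exact: within_continuous_sub.
have [du cG] := hu i; have [dv cH] := hv i; split; last exact: within_continuous_sub.
by move=> x Ox; apply: is_derive_subr; [exact: du|exact: dv].
Qed.

Lemma C1cl_comp u G (F F' : R -> R) : C1cl u G ->
  (forall t : R, is_derive t (1 : R) F (F' t)) -> continuous F' ->
  C1cl (fun x => F (u x)) (fun i x => F' (u x) * G i x).
Proof.
move=> [cu hu] dF cF'; split=> [|i].
  apply: within_continuous_comp => // x.
  by apply/differentiable_continuous/derivable1_diffP; have [] := dF x.
have [du cG] := hu i; split.
  by move=> x Ox; apply: is_derive_comp_real => //; exact: du.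
by apply: within_continuous_mul => //; exact: within_continuous_comp.
Qed.

Lemma C1c_C1cl phi : C1c phi -> C1cl phi (fun i => partial i phi).
Proof.
move=> /C1_compact_supportP[[cp h] _]; split=> [|i].
  by apply: continuous_subspaceT => x; exact: cp.
split; first by move=> x _; have [] := h i x I.
by apply: continuous_subspaceT => x; have [] := h i x I.
Qed.

(** * Composition with a function of bounded Lipschitz derivative, in L^2 *)

Section chain_rule.
Variables (F F' : R -> R) (M L : R).
Hypotheses (dF : forall t : R, is_derive t (1 : R) F (F' t))
  (FM : forall t, `|F' t| <= M) (FL : forall s t, `|F' s - F' t| <= L * `|s - t|).

Let M0 : 0 <= M. Proof. exact: le_trans (FM 0). Qed.
Let L0 : 0 <= L.
Proof. by have := FL 1 0; rewrite subr0 normr1 mulr1; apply: le_trans. Qed.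

Let cF : continuous F.
Proof. by move=> x; apply/differentiable_continuous/derivable1_diffP; have [] := dF x. Qed.

Lemma chain_continuous_deriv : continuous F'.
Proof.
have L1 : 0 < L + 1 by rewrite ltr_wpDl.
move=> t; apply/cvgrPdist_lt => e e0; near=> s.
apply: le_lt_trans (FL _ _) _; apply: (@le_lt_trans _ _ ((L + 1) * `|t - s|)).
  by rewrite ler_wpM2r// lerDl.
rewrite -ltr_pdivlMl//.
by near: s; apply: cvgr_dist_lt => //; rewrite mulr_gt0// invr_gt0.
Unshelve. all: by end_near. Qed.

Lemma chain_sqint u : S2 u -> S2 (fun x => F (u x)).
Proof.
move=> su; have s1 : S2 (cst `|F 0|).
  by apply: (@sqint_bounded _ _ _ _ _ mO muO _ `|F 0|) => //; apply: aeW => x _; rewrite normr_id.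
have s2 : S2 (fun x => `|F 0| + M * `|u x|).
  apply: (sqintD mO s1); apply: (sqintZ mO); apply: (sqint_le mO _ su).
    by apply: measurableT_comp => //; exact: sqint_meas su.
  by apply: aeW => x _; rewrite normr_id.
apply: (sqint_le mO _ s2).
  apply: measurableT_comp; last exact: sqint_meas su.
  exact: continuous_measurable_fun.
apply: aeW => x _; rewrite [leRHS]ger0_norm; last by rewrite addr_ge0 ?mulr_ge0.
have := MVT_lip dF FM (u x) 0; rewrite subr0.
have := ler_normD (F (u x) - F 0) (F 0); rewrite subrK; lra.
Qed.

Lemma chain_sqint_deriv u v : S2 u -> S2 v -> S2 (fun x => F' (u x) * v x).
Proof.
move=> su sv; apply: (sqint_bmul mO (M := M)) => //; last exact: aeW.
apply: measurableT_comp; last exact: sqint_meas su.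
exact: continuous_measurable_fun chain_continuous_deriv.
Qed.

Lemma chain_cvg (u_ : nat -> fn) u : (forall m, S2 (u_ m)) -> S2 u ->
  N (fun x => u_ m x - u x) @[m --> \oo] --> 0 ->
  N (fun x => F (u_ m x) - F (u x)) @[m --> \oo] --> 0.
Proof.
move=> su_ su cu.
have c2 : M ^+ 2 * N (fun x => u_ m x - u x) @[m --> \oo] --> 0.
  by rewrite -(mulr0 (M ^+ 2)); apply: cvgM => //; exact: cvg_cst.
apply: cvg_ge0_le c2 => m; rewrite nrm2_ge0/= -nrm2Z//; last exact: sqintB.
apply: nrm2_le => //.
- exact: sqint_meas (sqintB mO (chain_sqint (su_ m)) (chain_sqint su)).
- by apply: sqintZ => //; exact: sqintB.
- by apply: aeW => x _; rewrite normrM (ger0_norm M0); exact: MVT_lip.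
Qed.

(** Both factors are controlled in L^2 only, so [v] is split at a level p. Where |v| <= p the
    Lipschitz bound on F' gives L p |u_m - u|; where |v| > p the bound 2 M |v| is used, and the norm
    of [v] on that set is small for large p. *)
Lemma chain_cvg_coef (u_ : nat -> fn) u v : (forall m, S2 (u_ m)) -> S2 u -> S2 v ->
  N (fun x => u_ m x - u x) @[m --> \oo] --> 0 ->
  N (fun x => (F' (u_ m x) - F' (u x)) * v x) @[m --> \oo] --> 0.
Proof.
move=> su_ su sv cu.
pose A (p : nat) := Omega `&` [set x | p%:R < `|v x|].
have mv : measurable_fun Omega (fun x => `|v x|).
  by apply: measurableT_comp => //; exact: sqint_meas sv.
have mA p : measurable (A p).
  have := mv mO `]p%:R, +oo[%classic (measurable_itv _).
  by rewrite (_ : _ @^-1` _ = [set x | p%:R < `|v x|])//;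
    apply/seteqP; split => x /=; rewrite in_itv/= andbT.
have cA : N (fun x => \1_(A p) x * v x) @[p --> \oo] --> 0.
  apply: cvg_nrm2_small => // x Ox; exists (Num.truncn `|v x|).+1 => p vp [_ /=].
  apply/negP; rewrite -leNgt; apply: (@le_trans _ _ (Num.truncn `|v x|).+1%:R).
    by apply/ltW; exact: truncnS_gt.
  by rewrite ler_nat.
have sdF m : S2 (fun x => (F' (u_ m x) - F' (u x)) * v x).
  rewrite (_ : (fun x => _) = fun x => F' (u_ m x) * v x - F' (u x) * v x).
    by apply: sqintB => //; exact: chain_sqint_deriv.
  by apply/funext => x; rewrite mulrBl.
have bound m p : N (fun x => (F' (u_ m x) - F' (u x)) * v x) <=
    2 * ((L * p%:R) ^+ 2 * N (fun x => u_ m x - u x)) +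
    2 * ((2 * M) ^+ 2 * N (fun x => \1_(A p) x * v x)).
  have s1 : S2 (fun x => (L * p%:R) * (u_ m x - u x)).
    by apply: sqintZ => //; exact: sqintB.
  have sI : S2 (fun x => \1_(A p) x * v x).
    apply: (sqint_bmul mO (M := 1)) => //.
    by apply: aeW => x _; rewrite indicE; case: (_ \in _); rewrite ?normr1 ?normr0.
  have s2 : S2 (fun x => (2 * M) * (\1_(A p) x * v x)) by exact: sqintZ.
  have s1n : S2 (fun x => `|(L * p%:R) * (u_ m x - u x)|).
    apply: (sqint_le mO _ s1); first by apply: measurableT_comp => //; exact: sqint_meas s1.
    by apply: aeW => x _; rewrite normr_id.
  have s2n : S2 (fun x => `|(2 * M) * (\1_(A p) x * v x)|).
    apply: (sqint_le mO _ s2); first by apply: measurableT_comp => //; exact: sqint_meas s2.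
    by apply: aeW => x _; rewrite normr_id.
  have nn a : N (fun x => `|a x|) = N a.
    by apply: eq_Rintegral => x _; rewrite real_normK// num_real.
  rewrite -!nrm2Z//; last exact: sqintB.
  rewrite -(nn (fun x => L * p%:R * _)) -(nn (fun x => 2 * M * _)).
  apply: le_trans (nrm2D_le mO s1n s2n); apply: nrm2_le => //.
  - exact: sqint_meas (sdF m).
  - exact: sqintD.
  - apply: aeW => x Ox; rewrite [leRHS]ger0_norm ?addr_ge0//.
    rewrite !normrM indicE; have [xA|xA] := boolP (x \in A p).
      apply: ler_wpDl; first by rewrite mulr_ge0.
      rewrite normr1 mul1r ler_wpM2r//.
      apply: le_trans (ler_normB _ _) _; have := FM (u_ m x); have := FM (u x).
      rewrite (@ger0_norm _ 2)// (ger0_norm M0); lra.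
    have vp : `|v x| <= p%:R.
      by rewrite leNgt; apply/negP => pv; move/negP: xA; apply; rewrite inE.
    rewrite normr0 mul0r mulr0 addr0 (ger0_norm L0) (@ger0_norm _ p%:R)//.
    rewrite -mulrA mulrCA mulrC; apply: ler_pM => //; exact: FL.
apply/cvg0_ltP => [m|e e0]; first exact: nrm2_ge0.
(* The level p is fixed first, so that the large values of [v] cost at most e / 2; the index m is
   then chosen depending on p. *)
have e8 : 0 < e / (2 * (2 * M) ^+ 2 * 2 + 1).
  by rewrite divr_gt0// ltr_wpDl// !mulr_ge0// sqr_ge0.
have [p Hp] := (cvg0_ltP (fun p => nrm2_ge0 mu Omega _)).1 cA _ e8.
have {}Hp := Hp p (leqnn p).
pose K := 2 * (L * p%:R) ^+ 2 * 2 + 1; have K0 : 0 < K.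
  by rewrite ltr_wpDl// !mulr_ge0// sqr_ge0.
have [m0 Hm] := (cvg0_ltP (fun m => nrm2_ge0 mu Omega _)).1 cu _ (divr_gt0 e0 K0).
exists m0 => m /Hm um; apply: le_lt_trans (bound m p) _.
move: Hp um; rewrite !ltr_pdivlMr//; last by rewrite ltr_wpDl// !mulr_ge0// sqr_ge0.
rewrite /K; have := nrm2_ge0 mu Omega (fun x => \1_(A p) x * v x).
have := nrm2_ge0 mu Omega (fun x => u_ m x - u x).
have := sqr_ge0 (2 * M); have := sqr_ge0 (L * p%:R).
move: (N _) (N _) ((2 * M) ^+ 2) ((L * p%:R) ^+ 2) => a b c d d0 c0 a0 b0 h1 h2.
nra.
Qed.

Lemma chain_cvg_deriv (u_ v_ : nat -> fn) u v :
  (forall m, S2 (u_ m)) -> S2 u -> (forall m, S2 (v_ m)) -> S2 v ->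
  N (fun x => u_ m x - u x) @[m --> \oo] --> 0 ->
  N (fun x => v_ m x - v x) @[m --> \oo] --> 0 ->
  N (fun x => F' (u_ m x) * v_ m x - F' (u x) * v x) @[m --> \oo] --> 0.
Proof.
move=> su_ su sv_ sv cu cv.
have c1 := chain_cvg_coef su_ su sv cu.
have c2 : 2 * (M ^+ 2 * N (fun x => v_ m x - v x)) +
    2 * N (fun x => (F' (u_ m x) - F' (u x)) * v x) @[m --> \oo] --> 0.
  rewrite (_ : 0 = 2 * (M ^+ 2 * 0) + 2 * 0); last by rewrite !mulr0 addr0.
  apply: cvgD; apply: cvgM => //; try exact: cvg_cst.
  by apply: cvgM => //; exact: cvg_cst.
apply: cvg_ge0_le c2 => m; rewrite nrm2_ge0/=.
have s1 : S2 (fun x => F' (u_ m x) * (v_ m x - v x)).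
  by apply: chain_sqint_deriv => //; exact: sqintB.
have s2 : S2 (fun x => (F' (u_ m x) - F' (u x)) * v x).
  rewrite (_ : (fun x => _) = fun x => F' (u_ m x) * v x - F' (u x) * v x).
    by apply: sqintB => //; exact: chain_sqint_deriv.
  by apply/funext => x; rewrite mulrBl.
rewrite (_ : (fun x => _) = fun x => F' (u_ m x) * (v_ m x - v x) +
  (F' (u_ m x) - F' (u x)) * v x); last by apply/funext => x; ring.
apply: le_trans (nrm2D_le mO s1 s2) _; rewrite lerD2r ler_wpM2l//.
apply: nrm2_bmul => //; [|exact: aeW|exact: sqintB].
apply: measurableT_comp; last exact: sqint_meas (su_ m).
exact: continuous_measurable_fun chain_continuous_deriv.
Qed.

End chain_rule.

End C1_up_to_the_boundary.

(** * Boundary charts *)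

Section one_dimensional_hardy.
Variable R : realType.
Let leb : {measure set (measurableTypeR R) -> \bar R} := @lebesgue_measure R.

(* Integrate the derivative of (t - e') f^2, where e' is the endpoint opposite to e. *)
Lemma hardy_interval (f g : R -> R) (a b e : R) : a < b -> e = a \/ e = b ->
  {within `[a, b], continuous f} -> {within `[a, b], continuous g} ->
  (forall t : R, a < t < b -> is_derive t (1 : R) f (g t)) ->
  (\int[@lebesgue_measure R]_(t in `[a, b]) (f t ^+ 2)%:E <=
   (2 * (b - a) * f e ^+ 2)%:E +
   (4 * (b - a) ^+ 2)%:E * \int[@lebesgue_measure R]_(t in `[a, b]) (g t ^+ 2)%:E)%E.
Proof.
move=> ab eab cf cg df.
have cI : compact `[a, b] by exact: segment_compact.
have mI : measurable (`[a, b] : set (measurableTypeR R)) by exact: measurable_itv.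
have ci h : {within `[a, b], continuous h} -> leb.-integrable `[a, b] (EFin \o h).
  by move=> ch; exact: continuous_compact_integrable.
pose e' := a + b - e.
have cid : {within `[a, b], continuous (fun t : R => t - e')}.
  apply: within_continuous_sub; last exact: within_continuous_cst.
  by apply: continuous_subspaceT => t; exact: cvg_id.
have cf2 : {within `[a, b], continuous (fun t => f t ^+ 2)} by exact: within_continuous_mul.
have cg2 : {within `[a, b], continuous (fun t => g t ^+ 2)} by exact: within_continuous_mul.
have cfg : {within `[a, b], continuous (fun t => 2 * ((t - e') * (f t * g t)))}.
  apply: within_continuous_mul; first exact: within_continuous_cst.
  by apply: within_continuous_mul => //; exact: within_continuous_mul.
pose P t := (t - e') * f t ^+ 2.
pose p t := f t ^+ 2 + 2 * ((t - e') * (f t * g t)).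
have cP : {within `[a, b], continuous P} by exact: within_continuous_mul.
have cp : {within `[a, b], continuous p} by exact: within_continuous_add.
have dP (t : R) : a < t < b -> is_derive t (1 : R) P (p t).
  move=> tab; have dt := df t tab.
  have d1 := is_derive_subr (is_derive_idr t) (is_derive_cstr e' t 1).
  apply: is_derive_eq (is_derive_mulr d1 (is_derive_mulr dt dt)) _.
  by rewrite /p; ring.
have IP : (\int[leb]_(t in `[a, b]) (p t)%:E = (P b)%:E - (P a)%:E)%E.
  have /(continuous_within_itvP P ab)[_ Pa Pb] := cP.
  apply: continuous_FTC2 => //.
    split; [|exact: Pa|exact: Pb].
    by move=> t; rewrite in_itv/= => /dP[].
  by move=> t; rewrite in_itv/= => /dP[_ <-]; rewrite derive1E.
(* At [e'] the primitive vanishes, and at [e] its linear factor is b - a up to the sign of the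
   endpoint. *)
have PE : P b - P a = (b - a) * f e ^+ 2.
  by rewrite /P /e'; case: eab => ->; ring.
have s1 := ci _ cf2; have s2 := ci _ cg2; have s3 := ci _ cp.
rewrite -[X in (X <= _)%E](@fineK _ (\int[leb]_(t in `[a, b]) (f t ^+ 2)%:E)%E); last first.
  exact: integrable_fin_num.
rewrite -[X in (_ <= _ + _ * X)%E](@fineK _ (\int[leb]_(t in `[a, b]) (g t ^+ 2)%:E)%E); last first.
  exact: integrable_fin_num.
rewrite -EFinM -EFinD lee_fin.
have IP' : \int[leb]_(t in `[a, b]) p t = (b - a) * f e ^+ 2.
  by rewrite /Rintegral IP -EFinB/= PE.
(* Young's inequality on the cross term: (f + 2 (t - e') g)^2 >= 0 gives p >= f^2 / 2 - 2 (t - e')^2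
   g^2. *)
have h : \int[leb]_(t in `[a, b]) (2^-1 * f t ^+ 2 - (2 * (b - a) ^+ 2) * g t ^+ 2) <=
    \int[leb]_(t in `[a, b]) p t.
  apply: le_Rintegral => //.
    have := integrableB mI (integrableZl mI 2^-1 s1) (integrableZl mI (2 * (b - a) ^+ 2) s2).
    exact: eq_integrable.
  move=> t; rewrite /= in_itv/= => /andP[ta tb]; rewrite /p.
  have te : (t - e') ^+ 2 <= (b - a) ^+ 2.
    by rewrite /e'; case: eab => ->; nra.
  have := sqr_ge0 (f t + 2 * (t - e') * g t); have := sqr_ge0 (g t).
  move: (f t) (g t) (t - e') (b - a) te => x y z w te h1 h2.
  have := ler_wpM2r h1 te.
  nra.
move: h; rewrite IP' RintegralB//; last 2 first.
- by have := integrableZl mI 2^-1 s1; exact: eq_integrable.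
- by have := integrableZl mI (2 * (b - a) ^+ 2) s2; exact: eq_integrable.
rewrite !RintegralZl// /Rintegral; lra.
Qed.

End one_dimensional_hardy.

Lemma continuous_sumr (R : realType) (T : topologicalType) (m : nat) (F : 'I_m -> T -> R) (x : T) :
  (forall l, {for x, continuous (F l)}) -> {for x, continuous (fun y => \sum_l F l y)}.
Proof.
elim: m F => [|m IH] F cF.
  rewrite (_ : (fun y => _) = fun=> 0); first exact: continuous_cstr.
  by apply/funext => y; rewrite big_ord0.
rewrite (_ : (fun y => _) = fun y => F ord0 y + \sum_l F (lift ord0 l) y); last first.
  by apply/funext => y; rewrite big_ord_recl.
by apply: (continuousD (cF _)); exact: (IH (fun l => F (lift ord0 l))).
Qed.

Section charts.
Variables (R : realType) (n : nat) (Omega : set 'rV[R]_n.+1).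
Hypothesis oOmega : open Omega.
Notation mu := (leb_rV R n.+1).
Notation fn := ('rV[R]_n.+1 -> R).
Implicit Types (u v phi h : fn) (G H : 'I_n.+1 -> fn).
Let mO : measurable Omega. Proof. exact: mOmega oOmega. Qed.

Definition height (k : chart R n.+1) (x : 'rV[R]_n.+1) : R :=
  (-1) ^+ chart_sign k * x 0 (chart_axis k) - chart_graph k (col' (chart_axis k) x).

Lemma chart_pointE (k : chart R n.+1) (y : 'rV[R]_n) :
  chart_point k y = rV_insert (chart_axis k) ((-1) ^+ chart_sign k * chart_graph k y) y.
Proof. by []. Qed.

Lemma height_insert (k : chart R n.+1) t y : height k (rV_insert (chart_axis k) t y) =
  (-1) ^+ chart_sign k * t - chart_graph k y.
Proof. by rewrite /height rV_insert_id col'_rV_insert. Qed.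

Lemma continuous_col' (i : 'I_n.+1) : continuous (fun x : 'rV[R]_n.+1 => col' i x : 'rV[R]_n).
Proof.
move=> x; apply: continuous_rV => j.
rewrite (_ : (fun y : 'rV[R]_n.+1 => col' i y 0 j) = fun y => y 0 (lift i j)).
  exact: coord_continuous.
by apply/funext => y; rewrite mxE.
Qed.

Lemma C1g_graph (i : 'I_n.+1) (gam : 'rV[R]_n -> R) : C1 gam ->
  exists G, C1g setT (fun x : 'rV[R]_n.+1 => gam (col' i x)) G.
Proof.
move=> [cg dg]; exists (fun j x => if unlift i j is Some l then partial l gam (col' i x) else 0).
split=> [x _|j x _].
  by apply: (@continuous_comp _ _ _ (fun x : 'rV[R]_n.+1 => col' i x : 'rV[R]_n) gam);
    [exact: continuous_col'|exact: cg].
case: (unliftP i j) => [l ->|->].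
  have [d c] := dg l; split; last first.
    by apply: (@continuous_comp _ _ _ (fun x : 'rV[R]_n.+1 => col' i x : 'rV[R]_n));
      [exact: continuous_col'|exact: c].
  apply: (is_derive_along _ (derivableP (d (col' i x)))) => h.
  congr gam; apply/rowP => m; rewrite !mxE eqxx/=; congr (_ * _%:R + _).
  by rewrite (inj_eq lift_inj).
split; last exact: cst_continuous.
apply: (is_derive_along _ (is_derive_cstr (gam (col' i x)) (0 : R) 1)) => h.
congr gam; apply/rowP => m; rewrite !mxE eqxx/= eq_sym (negbTE (neq_lift _ _)).
by rewrite mulr0 add0r.
Qed.

Variable k : chart R n.+1.
Hypothesis hk : C2_chart Omega k.
Notation i := (chart_axis k).
Notation s := ((-1 : R) ^+ chart_sign k).
Notation c := (chart_center k).
Notation r := (chart_radius k).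
Notation D := (chart_point k @^-1` chart_ball k).

Let ss : s * s = 1. Proof. by rewrite -expr2 sqrr_sign. Qed.
Let s1 : s = 1 \/ s = -1.
Proof. by case: (chart_sign k); [right|left]; rewrite ?expr1 ?expr0. Qed.

Lemma chart_radius_gt0 : 0 < r. Proof. by case: hk. Qed.

Lemma C1_chart_graph : C1 (chart_graph k). Proof. by case: hk => _ []. Qed.

Lemma C1g_height : exists G, C1g setT (height k) G.
Proof.
have [G hG] := C1g_graph (chart_axis k) C1_chart_graph.
eexists; apply: C1gB hG; apply: C1gZ; exact: C1g_coord.
Qed.

Lemma continuous_height : continuous (height k).
Proof. by have [G [h _]] := C1g_height => x; exact: h. Qed.

Lemma chart_ballE x : ball c r x -> (Omega x <-> 0 < height k x).
Proof.
case: hk => _ _ e Bx; rewrite /height subr_gt0; split=> h.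
  by have : (Omega `&` chart_ball k) x; [|rewrite e => -[]].
by have : (Omega `&` chart_ball k) x; [rewrite e|case].
Qed.

Lemma continuous_chart_point : continuous (chart_point k).
Proof.
have [cg _] := C1_chart_graph.
move=> y; apply: continuous_rV => j; case: (unliftP (chart_axis k) j) => [l ->|->].
  rewrite (_ : (fun y => _) = fun y : 'rV[R]_n => y 0 l); first exact: coord_continuous.
  by apply/funext => z; rewrite chart_pointE rV_insert_lift.
rewrite (_ : (fun y => _) = fun y : 'rV[R]_n => s * chart_graph k y).
  exact: (continuousM (@continuous_cstr _ _ s y) (cg y)).
by apply/funext => z; rewrite chart_pointE rV_insert_id.
Qed.

Lemma open_chart_domain : open D.
Proof.
apply: open_comp; last by rewrite /chart_ball ball_box ?chart_radius_gt0//; exact: open_box.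
by move=> y _; exact: continuous_chart_point.
Qed.

Lemma measurable_chart_domain : measurable D.
Proof. exact: rV_open_measurable open_chart_domain. Qed.

Lemma height_chart_point y : height k (chart_point k y) = 0.
Proof. by rewrite chart_pointE height_insert mulrA ss mul1r subrr. Qed.

Lemma chart_point_notin y : D y -> ~ Omega (chart_point k y).
Proof. by move=> Dy /(chart_ballE Dy); rewrite height_chart_point ltxx. Qed.

(** A point of the graph is the limit of the points just above it along the axis, which lie in
    [Omega] as long as they stay in the cube. *)
Lemma chart_point_closure y : D y -> closure Omega (chart_point k y).
Proof.
move=> Dy B nB; have nB' : nbhs (chart_point k y) (B `&` ball c r).
  apply: filterI => //; apply: open_nbhs_nbhs; split=> //.
  by rewrite ball_box ?chart_radius_gt0//; exact: open_box.
pose f (t : R) := rV_insert i (s * (chart_graph k y + t)) y.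
have f0 : f 0 = chart_point k y by rewrite /f addr0.
have cf : {for 0, continuous f}.
  apply: (@continuous_comp _ _ _ (fun t => s * (chart_graph k y + t)) (fun t => rV_insert i t y));
    last exact: continuous_rV_insert.
  apply: continuousM; first exact: continuous_cstr.
  by apply: continuousD; [exact: continuous_cstr|exact: cvg_id].
have nB2 : nbhs (f 0) (B `&` ball c r) by rewrite f0.
have /nbhs_ballP[e /= e0 he] := cf _ nB2.
have [t t0 [Bt ct]] : exists2 t, 0 < t & (B `&` ball c r) (f t).
  exists (e / 2); first by rewrite divr_gt0.
  by apply: he; rewrite /ball/= sub0r normrN gtr0_norm; lra.
exists (f t); split=> //; apply/(chart_ballE ct).
by rewrite height_insert mulrA ss mul1r addrC addKr.
Qed.

Lemma chart_point_boundary y : D y -> boundary Omega (chart_point k y).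
Proof.
move=> Dy; split; first exact: chart_point_closure.
by rewrite (interior_id _).1//; exact: chart_point_notin.
Qed.

Lemma height_ge0_closure x : ball c r x -> 0 <= height k x -> closure Omega x.
Proof.
move=> Bx; rewrite le_eqVlt => /orP[/eqP h0|/(chart_ballE Bx)]; last exact: subset_closure.
have xE : x = chart_point k (col' i x).
  rewrite chart_pointE -[LHS](rV_insert_col' i); congr rV_insert.
  by move/eqP: h0; rewrite eq_sym subr_eq0 => /eqP <-; rewrite mulrA ss mul1r.
by rewrite xE; apply: chart_point_closure; rewrite /= -xE.
Qed.

Lemma measurable_chart_trace u : {within closure Omega, continuous u} ->
  measurable_fun D (fun y => u (chart_point k y)).
Proof.
move=> cu; apply: rV_continuous_measurable; first exact: open_chart_domain.
apply: (@within_continuous_path _ _ _ (closure Omega)) => //.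
  exact: continuous_subspaceT continuous_chart_point.
exact: chart_point_closure.
Qed.

Notation w := (fun y => Num.sqrt (1 + \sum_l partial l (chart_graph k) y ^+ 2)).

Lemma chart_weight_ge1 y : 1 <= w y.
Proof.
rewrite -[leLHS]sqrtr1 ler_wsqrtr// lerDl; apply: sumr_ge0 => l _; exact: sqr_ge0.
Qed.

Lemma measurable_chart_weight : measurable_fun D w.
Proof.
apply: rV_continuous_measurable; first exact: open_chart_domain.
apply: continuous_subspaceT => y.
apply: (@continuous_comp _ _ _ (fun y => 1 + \sum_l partial l (chart_graph k) y ^+ 2) Num.sqrt);
  last exact: sqrt_continuous.
apply: (continuousD (@continuous_cstr _ _ 1 y)).
apply: continuous_sumr => l; have [_ dg] := C1_chart_graph; have [_ cl] := dg l.
exact: (continuousM (cl y) (cl y)).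
Qed.

Lemma chart_surface_integral_ge0 u : (forall x, 0 <= u x) ->
  (0 <= chart_surface_integral k u)%E.
Proof.
move=> u0; apply: integral_ge0 => y _; rewrite lee_fin mulr_ge0//.
Qed.

Lemma chart_surface_integral_le (C : R) u v h : 0 <= C ->
  {within closure Omega, continuous u} -> {within closure Omega, continuous v} ->
  {within closure Omega, continuous h} ->
  (forall x, 0 <= u x) -> (forall x, 0 <= v x) -> (forall x, 0 <= h x) ->
  (forall x, boundary Omega x -> u x <= C * (v x + h x)) ->
  (chart_surface_integral k u <=
   C%:E * (chart_surface_integral k v + chart_surface_integral k h))%E.
Proof.
move=> C0 cu cv ch u0 v0 h0 uvh; rewrite /chart_surface_integral.
have w0 y : 0 <= w y by exact: le_trans ler01 (chart_weight_ge1 y).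
have m (a : fn) : {within closure Omega, continuous a} ->
    measurable_fun D (fun y => (a (chart_point k y) * w y)%:E).
  move=> ca; apply/measurable_EFinP; apply: measurable_funM.
    exact: measurable_chart_trace.
  exact: measurable_chart_weight.
have mD := measurable_chart_domain.
rewrite -ge0_integralD//; [|by move=> y _; rewrite lee_fin mulr_ge0|exact: m|
  by move=> y _; rewrite lee_fin mulr_ge0|exact: m].
rewrite -ge0_integralZl_EFin//; [|by move=> y _; rewrite adde_ge0// lee_fin mulr_ge0|
  by apply: emeasurable_funD; exact: m].
apply: ge0_le_integral => //.
- by move=> y _; rewrite lee_fin mulr_ge0.
- exact: m.
- by apply: measurable_funeM; apply: emeasurable_funD; exact: m.
- move=> y Dy; rewrite -EFinD -EFinM lee_fin -mulrDl mulrA ler_wpM2r//.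
  by apply: uvh; exact: chart_point_boundary.
Qed.

Definition strip (rho delta : R) : set 'rV[R]_n.+1 :=
  [set x | ball c rho x /\ 0 < height k x < delta].

Lemma strip_sub rho delta : rho <= r -> strip rho delta `<=` Omega.
Proof.
move=> rr x [Bx /andP[h0 _]]; have Bx' : ball c r x by exact: le_ball Bx.
by have [_] := chart_ballE Bx'; exact.
Qed.

Lemma measurable_strip rho delta : measurable (strip rho delta).
Proof.
apply: measurableI; first exact: rV_measurable_ball.
have mh : measurable_fun setT (height k).
  by apply: rV_continuous_measurable; [exact: openT|exact: continuous_subspaceT continuous_height].
have := mh measurableT `]0, delta[%classic (measurable_itv _).
by rewrite setTI (_ : _ @^-1` _ = [set x | 0 < height k x < delta])//;
  apply/seteqP; split => x /=; rewrite in_itv.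
Qed.

(** A line parallel to the axis that meets the strip does so, in the full cube, along a segment of
    length delta with the graph point as one endpoint; the chart sign decides which one. It starts
    from the half-size cube, and delta < r / 2, so the segment cannot leave the full cube. *)
Lemma strip_line y t0 delta : delta < r / 2 ->
  strip (r / 2) delta (rV_insert i t0 y) ->
  exists a b, [/\ a < b /\ b - a = delta,
    s * chart_graph k y = a \/ s * chart_graph k y = b,
    (forall t, a <= t <= b -> ball c r (rV_insert i t y)),
    (forall t, a <= t <= b -> 0 <= height k (rV_insert i t y)) &
    (forall t, a < t < b <-> 0 < height k (rV_insert i t y) < delta)].
Proof.
move=> dr [/rV_ballP[_ Bt0]]; rewrite height_insert => /andP[h1 h2].
have ball_t t : `|t - t0| <= delta -> ball c r (rV_insert i t y).
  move=> tt; apply/rV_ballP; split=> [|j]; first exact: chart_radius_gt0.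
  have := Bt0 j; case: (unliftP i j) => [l ->|->]; rewrite ?rV_insert_lift ?rV_insert_id.
    by have := chart_radius_gt0; lra.
  move=> h; have := ler_normD (c 0 i - t0) (t0 - t).
  rewrite addrA subrK [`|t0 - t|]distrC; lra.
case: s1 => se; rewrite se in h1 h2 *; rewrite ?mul1r ?mulN1r in h1 h2 *.
- exists (chart_graph k y), (chart_graph k y + delta); split.
  + by split; [lra|ring].
  + by left.
  + by move=> t /andP[ta tb]; apply: ball_t; rewrite ler_norml; apply/andP; split; lra.
  + by move=> t /andP[ta tb]; rewrite height_insert se mul1r; lra.
  + by move=> t; rewrite height_insert se mul1r; split=> /andP[ta tb]; apply/andP; split; lra.
- exists (- chart_graph k y - delta), (- chart_graph k y); split.
  + by split; [lra|ring].
  + by right.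
  + by move=> t /andP[ta tb]; apply: ball_t; rewrite ler_norml; apply/andP; split; lra.
  + by move=> t /andP[ta tb]; rewrite height_insert se mulN1r; lra.
  + by move=> t; rewrite height_insert se mulN1r; split=> /andP[ta tb]; apply/andP; split; lra.
Qed.

(** Hardy's inequality on each segment across the strip, integrated over the base by Tonelli's
    theorem. The gradient term is taken over the full cube because the segments may leave the
    half-size one. The surface weight is at least 1, so passing from dy to the surface measure only
    enlarges the right-hand side. *)
Lemma strip_estimate u G delta : 0 < delta -> delta < r / 2 -> C1cl Omega u G ->
  (\int[mu]_(x in strip (r / 2) delta) (u x ^+ 2)%:E <=
   (2 * delta)%:E * chart_surface_integral k (fun x => u x ^+ 2)%R +
   (4 * delta ^+ 2)%:E * \int[mu]_(x in strip r delta) (G i x ^+ 2)%:E)%E.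
Proof.
move=> d0 dr hu; have [cu hG] := hu; have [dG cG] := hG i.
have cO : closure Omega `<=` closure Omega by [].
have r0 := chart_radius_gt0.
have gu := C1cl_C1g oOmega hu; have [mu_ mG] := C1g_measurable oOmega gu.
have r2 : r / 2 <= r by lra.
pose S := strip (r / 2) delta; pose S' := strip r delta.
have SO : S `<=` Omega by exact: strip_sub.
have S'O : S' `<=` Omega by exact: strip_sub.
pose U := (fun x => (u x ^+ 2)%:E) \_ S; pose V := (fun x => (G i x ^+ 2)%:E) \_ S'.
have mU : measurable_fun setT U.
  apply/(measurable_restrictT _ (measurable_strip _ _)); apply: measurable_sqr.
  exact: measurable_funS SO mu_.
have mV : measurable_fun setT V.
  apply/(measurable_restrictT _ (measurable_strip _ _)); apply: measurable_sqr.
  exact: measurable_funS S'O (mG i).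
have U0 x : (0 <= U x)%E by rewrite /U patchE; case: ifP => // _; rewrite lee_fin sqr_ge0.
have V0 x : (0 <= V x)%E by rewrite /V patchE; case: ifP => // _; rewrite lee_fin sqr_ge0.
rewrite integral_mkcond [X in (_ <= _ + _ * X)%E]integral_mkcond -/U -/V.
rewrite /leb_rV (tonelli_rV_insert i mU U0) (tonelli_rV_insert i mV V0).
pose W := (fun y => (u (chart_point k y) ^+ 2 * w y)%:E) \_ D.
have w0 y : 0 <= w y by exact: le_trans ler01 (chart_weight_ge1 y).
have W0 y : (0 <= W y)%E.
  by rewrite /W patchE; case: ifP => // _; rewrite lee_fin mulr_ge0// sqr_ge0.
have mW : measurable_fun setT W.
  apply/(measurable_restrictT _ measurable_chart_domain); apply/measurable_EFinP.
  apply: measurable_funM; last exact: measurable_chart_weight.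
  by apply: measurable_funX; exact: measurable_chart_trace.
have -> : chart_surface_integral k (fun x => u x ^+ 2)%R = (\int[leb_rV R n]_y W y)%E.
  by rewrite /chart_surface_integral integral_mkcond.
have mIV := measurable_fun_rV_section i mV V0.
have mIU := measurable_fun_rV_section i mU U0.
have IV0 y : (0 <= \int[@lebesgue_measure R]_t V (rV_insert i t y))%E by exact: integral_ge0.
have c1 : 0 <= 2 * delta by lra.
have c2 : 0 <= 4 * delta ^+ 2 by rewrite mulr_ge0// sqr_ge0.
rewrite -ge0_integralZl_EFin// -ge0_integralZl_EFin//.
rewrite -ge0_integralD//; last 4 first.
- by move=> y _; rewrite mule_ge0// lee_fin mulr_ge0// ltW.
- exact: measurable_funeM.
- by move=> y _; rewrite mule_ge0// lee_fin mulr_ge0// sqr_ge0.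
- exact: measurable_funeM.
apply: (@ge0_le_integral _ _ _ (leb_rV R n)) => //.
- by move=> y _; exact: integral_ge0.
- by apply: emeasurable_funD; exact: measurable_funeM.
move=> y _.
(* A line that misses the strip contributes 0 on the left. *)
have [[t0 St0]|nS] := pselect (exists t0, S (rV_insert i t0 y)); last first.
  rewrite integral0_eq; last first.
    move=> t _; rewrite /U patchE memNset//.
    by move=> h; apply: nS; exists t.
  by rewrite adde_ge0// mule_ge0// lee_fin mulr_ge0 ?sqr_ge0// ltW.
have [a [b [[ab ba] eab Bab hge hab]]] := strip_line dr St0.
have inO t : a < t < b -> Omega (rV_insert i t y).
  move=> tab; have Bt : ball c r (rV_insert i t y) by apply: Bab; lra.
  by have [_] := chart_ballE Bt; apply; have /hab/andP[] := tab.
have Dy : D y by rewrite /= chart_pointE; apply: Bab; case: eab => ->; lra.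
have inC t : a <= t <= b -> closure Omega (rV_insert i t y).
  by move=> tab; apply: height_ge0_closure; [exact: Bab|exact: hge].
pose f t := u (rV_insert i t y); pose g t := G i (rV_insert i t y).
have path (v : fn) : {within closure Omega, continuous v} ->
    {within `[a, b], continuous (fun t => v (rV_insert i t y))}.
  move=> cv; apply: (within_continuous_path cv).
    by apply: continuous_subspaceT; exact: continuous_rV_insert.
  by move=> t; rewrite /= in_itv/=; exact: inC.
have cf := path _ cu; have cg := path _ cG.
have hd := hardy_interval ab eab cf cg (fun t tab =>
  is_derive_rV_insert (dG _ (inO t tab))).
have mins : measurable_fun [set: measurableTypeR R] (fun t => rV_insert i t y).
  apply: measurable_fun_rVP => j; case: (unliftP i j) => [l ->|->].
    by under eq_fun do rewrite rV_insert_lift; exact: measurable_cst.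
  by under eq_fun do rewrite rV_insert_id; exact: measurable_id.
have mI : measurable (`]a, b[ : set (measurableTypeR R)) by exact: measurable_itv.
have mfab (v : R -> R) : {within `[a, b], continuous v} ->
    measurable_fun (`[a, b] : set (measurableTypeR R)) (fun t => (v t ^+ 2)%:E).
  by move=> cv; apply: measurable_sqr; exact: subspace_continuous_measurable_fun.
have oc (v : R -> R) : {within `[a, b], continuous v} ->
  (\int[@lebesgue_measure R]_(t in `[a, b]) (v t ^+ 2)%:E =
   \int[@lebesgue_measure R]_(t in `]a, b[) (v t ^+ 2)%:E)%E.
  move=> cv; rewrite -integral_itv_bndo_bndc; last first.
    by apply: measurable_funS (mfab _ cv) => //; exact: subset_itv_co_cc.
  rewrite -integral_itv_obnd_cbnd//.
  by apply: measurable_funS (mfab _ cv) => //; exact: subset_itv_oo_cc.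
have hU : (\int[@lebesgue_measure R]_t U (rV_insert i t y) <=
    \int[@lebesgue_measure R]_(t in `]a, b[) (f t ^+ 2)%:E)%E.
  rewrite [leRHS]integral_mkcond; apply: ge0_le_integral => //.
  - exact: (measurableT_comp mU).
  - apply/(measurable_restrictT _ mI).
    by apply: measurable_funS (mfab _ cf) => //; exact: subset_itv_oo_cc.
  - move=> t _; rewrite /U !patchE; case: ifPn => [|_]; last first.
      by case: ifP => // _; rewrite lee_fin sqr_ge0.
    rewrite inE => -[_ /hab tab].
    by rewrite mem_set//= in_itv.
have hV : (\int[@lebesgue_measure R]_(t in `]a, b[) (g t ^+ 2)%:E <=
    \int[@lebesgue_measure R]_t V (rV_insert i t y))%E.
  rewrite [leLHS]integral_mkcond; apply: ge0_le_integral => //.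
  - by move=> t _; rewrite patchE; case: ifP => // _; rewrite lee_fin sqr_ge0.
  - apply/(measurable_restrictT _ mI).
    by apply: measurable_funS (mfab _ cg) => //; exact: subset_itv_oo_cc.
  - exact: (measurableT_comp mV).
  - move=> t _; rewrite patchE; case: ifPn => // /set_mem /=; rewrite in_itv/= => tab.
    rewrite /V patchE mem_set//; split; last exact/hab.
    by apply: Bab; lra.
apply: (le_trans hU); rewrite -(oc _ cf); apply: (le_trans hd).
rewrite ba (oc _ cg); apply: leeD; last first.
  by apply: lee_wpmul2l => //; rewrite lee_fin mulr_ge0 ?sqr_ge0.
rewrite /W patchE mem_set// -EFinM lee_fin -chart_pointE ler_wpM2l//.
by rewrite ler_peMr ?sqr_ge0// chart_weight_ge1.
Qed.

End charts.

(** * Traces *)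

Section traces.
Variables (R : realType) (n : nat) (Omega : set 'rV[R]_n.+1).
Hypotheses (oOmega : open Omega) (bOmega : bounded_set Omega).
Notation mu := (leb_rV R n.+1).
Notation fn := ('rV[R]_n.+1 -> R).
Implicit Types (u v phi h : fn) (G H : 'I_n.+1 -> fn) (i : 'I_n.+1) (k : chart R n.+1).
Let mO : measurable Omega. Proof. exact: mOmega oOmega. Qed.

Notation S2 := (sqint mu Omega).
Notation N := (nrm2 mu Omega).
Notation wg := (is_weak_gradient Omega).
Notation C1c := (C1_compact_support Omega).
Notation csi := chart_surface_integral.

(** The content of [has_trace] for a pair of a function and a gradient, with the gradients of the
    approximants as data. *)
Definition traces w H h : Prop := exists u_ : nat -> fn, exists G_ : nat -> 'I_n.+1 -> fn,
  [/\ forall m, C1cl Omega (u_ m) (G_ m),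
      N (fun x => u_ m x - w x) @[m --> \oo] --> 0,
      (forall i, N (fun x => G_ m i x - H i x) @[m --> \oo] --> 0) &
      forall k, C2_chart Omega k ->
        csi k (fun x => (u_ m x - h x) ^+ 2) @[m --> \oo] --> 0%E].

Lemma has_traceP u G h : S2 u -> wg u G -> has_trace Omega u h <-> traces u G h.
Proof.
move=> su gu; split=> [[u_ [h1 h2 h3]]|[u_ [G_ [h1 h2 h3 h4]]]].
  have /choice[G_ hG] : forall m, exists G, C1cl Omega (u_ m) G.
    by move=> m; exact/C1_closureP.
  exists u_, G_.
  have [c1 c2] : N (fun x => u_ m x - u x) @[m --> \oo] --> 0 /\
      forall i, N (fun x => G_ m i x - G i x) @[m --> \oo] --> 0.
    apply: (cvg_H1P oOmega bOmega _ _ su gu).1 => // m.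
      by have [] := C1cl_sqint oOmega bOmega (hG m).
    exact: (C1cl_wg oOmega bOmega (hG m)).
  by split.
exists u_; split=> //.
  by move=> m; apply/C1_closureP; exists (G_ m).
apply: (cvg_H1P oOmega bOmega (G_ := G_) _ _ su gu).2 => // m.
  by have [] := C1cl_sqint oOmega bOmega (h1 m).
exact: (C1cl_wg oOmega bOmega (h1 m)).
Qed.

Lemma cvg_csi0 (C : R) k (u_ v_ w_ : nat -> fn) : C2_chart Omega k -> 0 <= C ->
  (forall m, {within closure Omega, continuous (u_ m)}) ->
  (forall m, {within closure Omega, continuous (v_ m)}) ->
  (forall m, {within closure Omega, continuous (w_ m)}) ->
  (forall m x, 0 <= u_ m x) -> (forall m x, 0 <= v_ m x) -> (forall m x, 0 <= w_ m x) ->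
  (forall m x, boundary Omega x -> u_ m x <= C * (v_ m x + w_ m x)) ->
  csi k (v_ m) @[m --> \oo] --> 0%E -> csi k (w_ m) @[m --> \oo] --> 0%E ->
  csi k (u_ m) @[m --> \oo] --> 0%E.
Proof.
move=> hk C0 cu cv cw u0 v0 w0 uvw hv hw.
have hb : (C%:E * (csi k (v_ m) + csi k (w_ m)))%E @[m --> \oo] --> 0%E.
  rewrite -[X in _ --> X](mule0 C%:E) -[X in (_ * X)%E](adde0 0%E).
  by apply: cvgeZl => //; apply: cvgeD.
apply: (squeeze_cvge _ (cvg_cst 0%E) hb); apply: nearW => m; apply/andP; split.
  by apply: (chart_surface_integral_ge0 k); exact: u0.
by apply: (chart_surface_integral_le oOmega hk) => //; exact: uvw.
Qed.

Lemma within_continuous_sqr_sub (A : set 'rV[R]_n.+1) u v : {within A, continuous u} ->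
  {within A, continuous v} -> {within A, continuous (fun x => (u x - v x) ^+ 2)}.
Proof.
by move=> cu cv; apply: within_continuous_mul; exact: within_continuous_sub.
Qed.

Lemma traces_sub w w' H H' h : {within closure Omega, continuous h} ->
  S2 w -> S2 w' -> (forall i, S2 (H i)) -> (forall i, S2 (H' i)) ->
  traces w H h -> traces w' H' h ->
  traces (fun x => w x - w' x) (fun i x => H i x - H' i x) (fun=> 0).
Proof.
move=> ch sw sw' sH sH' [u [G [cu h1 h2 h3]]] [u' [G' [cu' h1' h2' h3']]].
have su m := C1cl_sqint oOmega bOmega (cu m).
have su' m := C1cl_sqint oOmega bOmega (cu' m).
have key (a a' b b' : nat -> fn) (c c' : fn) : (forall m, S2 (a m)) -> (forall m, S2 (a' m)) ->
    S2 c -> S2 c' -> N (fun x => a m x - c x) @[m --> \oo] --> 0 ->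
    N (fun x => a' m x - c' x) @[m --> \oo] --> 0 ->
    N (fun x => (a m x - a' m x) - (c x - c' x)) @[m --> \oo] --> 0.
  move=> sa sa' sc sc' ha ha'.
  have hs : 2 * N (fun x => a m x - c x) + 2 * N (fun x => a' m x - c' x) @[m --> \oo] --> 0.
    rewrite -[X in _ --> X](addr0 0) -[X in _ --> X + _](mulr0 2) -[X in _ --> _ + X](mulr0 2).
    by apply: cvgD; apply: cvgM => //; exact: cvg_cst.
  apply: cvg_ge0_le hs => m; rewrite nrm2_ge0/=.
  rewrite (_ : (fun x => _) = fun x => (a m x - c x) - (a' m x - c' x)).
    by apply: nrm2B_le => //; exact: sqintB.
  by apply/funext => x; ring.
exists (fun m x => u m x - u' m x), (fun m i x => G m i x - G' m i x); split.
- by move=> m; exact: C1clB.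
- by apply: key => // m; [have [] := su m|have [] := su' m].
- by move=> i; apply: key => // m; [have [_] := su m|have [_] := su' m].
- move=> k hk; apply: (@cvg_csi0 2 k _ _ _ hk _ _ _ _ _ _ _ _ (h3 k hk) (h3' k hk)) => //.
  + move=> m; apply: within_continuous_sqr_sub; last exact: within_continuous_cst.
    by apply: within_continuous_sub; [have [] := cu m|have [] := cu' m].
  + by move=> m; apply: within_continuous_sqr_sub => //; have [] := cu m.
  + by move=> m; apply: within_continuous_sqr_sub => //; have [] := cu' m.
  + by move=> m x; exact: sqr_ge0.
  + by move=> m x; exact: sqr_ge0.
  + by move=> m x; exact: sqr_ge0.
  + move=> m x _; have := sqr_ge0 ((u m x - h x) + (u' m x - h x)); nra.
Qed.

(** On the boundary F(h) = 0, hence |F(u_m)| <= M |u_m - h| there; inside, the compositions and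
    their gradients converge by the chain rule in L^2. *)
Lemma traces_comp (F F' : R -> R) (M L : R) w H h :
  (forall t : R, is_derive t (1 : R) F (F' t)) -> (forall t, `|F' t| <= M) ->
  (forall s t, `|F' s - F' t| <= L * `|s - t|) ->
  {within closure Omega, continuous h} -> (forall x, boundary Omega x -> F (h x) = 0) ->
  S2 w -> (forall i, S2 (H i)) -> traces w H h ->
  traces (fun x => F (w x)) (fun i x => F' (w x) * H i x) (fun=> 0).
Proof.
move=> dF FM FL ch Fh sw sH [u [G [cu h1 h2 h3]]].
have M0 : 0 <= M by exact: le_trans (FM 0).
have su m := C1cl_sqint oOmega bOmega (cu m).
have cF' := chain_continuous_deriv FL.
have cFu m : C1cl Omega (fun x => F (u m x)) (fun i x => F' (u m x) * G m i x).
  exact: C1cl_comp.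
exists (fun m x => F (u m x)), (fun m i x => F' (u m x) * G m i x); split=> //.
- by apply: (chain_cvg oOmega bOmega dF FM) => // m; have [] := su m.
- move=> i; apply: (chain_cvg_deriv oOmega FM FL) => // m; first by have [] := su m.
  by have [_] := su m.
- move=> k hk.
  apply: (@cvg_csi0 (M ^+ 2) k _ _ _ hk _ _ _ _ _ _ _ _ (h3 k hk) (h3 k hk)).
  + exact: sqr_ge0.
  + move=> m; apply: within_continuous_sqr_sub; last exact: within_continuous_cst.
    by have [] := cFu m.
  + by move=> m; apply: within_continuous_sqr_sub => //; have [] := cu m.
  + by move=> m; apply: within_continuous_sqr_sub => //; have [] := cu m.
  + by move=> m x; exact: sqr_ge0.
  + by move=> m x; exact: sqr_ge0.
  + by move=> m x; exact: sqr_ge0.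
  + move=> m x bx; rewrite -(Fh x bx) -mulr2n mulrnAr -mulr_natl.
    have : (F (u m x) - F (h x)) ^+ 2 <= (M * (u m x - h x)) ^+ 2.
      by rewrite ler_sqr_norm normrM (ger0_norm M0); exact: (MVT_lip dF FM).
    rewrite exprMn => h5; apply: (le_trans h5).
    by have := mulr_ge0 (sqr_ge0 M) (sqr_ge0 (u m x - h x)); lra.
Qed.

Lemma C1c_notin phi x : C1c phi -> ~ Omega x -> phi x = 0.
Proof. by move=> /C1_compact_supportP[_ [K [_ KO h _]]] nx; apply: h => /KO. Qed.

(** The approximants g + phi_m coincide with [g] on the boundary, where test functions vanish, so
    the surface integrals are all 0. *)
Lemma traces_H0D g Gg w H : C1cl Omega g Gg -> H0 Omega w H ->
  traces (fun x => g x + w x) (fun i x => Gg i x + H i x) g.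
Proof.
move=> hg /H0_approx[phi [cphi c1 c2]].
have eqN (a : nat -> fn) (b b' : fn) : (fun m => N (fun x => b x + a m x - (b x + b' x))) =
    fun m => N (fun x => a m x - b' x).
  by apply/funext => m; congr nrm2; apply/funext => x; ring.
exists (fun m x => g x + phi m x), (fun m i x => Gg i x + partial i (phi m) x); split.
- by move=> m; apply: C1clD => //; exact: C1c_C1cl.
- by rewrite eqN.
- by move=> i; rewrite eqN.
- move=> k hk; rewrite (_ : (fun m => _) = fun=> 0%E); first exact: cvg_cst.
  apply/funext => m; rewrite /csi; apply: integral0_eq => y Dy.
  by rewrite (C1c_notin (cphi m) (chart_point_notin hk Dy)) addr0 subrr expr0n mul0r.
Qed.

End traces.

(** * Functions with zero trace *)

Lemma near_lt (R : realType) (f : nat -> R) (l e : R) : f m @[m --> \oo] --> l -> l < e ->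
  \forall m \near \oo, f m < e.
Proof. by move=> fl le; apply: cvgr_lt fl _ _. Qed.

Section cutoffs.
Variables (R : realType) (n : nat) (Omega : set 'rV[R]_n.+1).
Hypotheses (oOmega : open Omega) (bOmega : bounded_set Omega).
Notation mu := (leb_rV R n.+1).
Notation fn := ('rV[R]_n.+1 -> R).
Implicit Types (u v phi h : fn) (G H : 'I_n.+1 -> fn) (i : 'I_n.+1) (k : chart R n.+1).
Let mO : measurable Omega. Proof. exact: mOmega oOmega. Qed.
Let muO : (mu Omega < +oo)%E. Proof. exact: muOmega oOmega bOmega. Qed.

Notation S2 := (sqint mu Omega).
Notation N := (nrm2 mu Omega).
Notation thin k delta := (strip k (chart_radius k / 2) delta).
Notation core k := (ball (chart_center k) (chart_radius k / (4 * n.+1%:R))).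

Lemma dstep_le0 (t : R) : t <= 0 -> dstep t = 0.
Proof. by move=> t0; rewrite /dstep (pos_le0 t0) !mulr0. Qed.

Lemma dstep_ge1 (t : R) : 1 <= t -> dstep t = 0.
Proof.
move=> t1; rewrite /dstep [pos (1 - _)]pos_le0 ?mulr0 ?mul0r//.
by rewrite subr_le0 /pos2 pos_gt0 ?expr_ge1//; lra.
Qed.

Lemma C1g_sqdist (c : 'rV[R]_n.+1) : C1g setT (fun x => \sum_l (x 0 l - c 0 l) ^+ 2)
  (fun i x => 2 * (x 0 i - c 0 i)).
Proof.
have h (l : 'I_n.+1) : C1g setT (fun x => (x 0 l - c 0 l) ^+ 2)
    (fun i x => (i == l)%:R * (2 * (x 0 l - c 0 l))).
  have h1 := C1gB (@C1g_coord R n.+1 setT l) (C1g_cst setT (c 0 l)).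
  apply: C1g_extg (C1gM h1 h1); first exact: openT.
  by move=> i x _ /=; ring.
have key m (f : 'I_m -> 'I_n.+1) : C1g setT (fun x => \sum_j (x 0 (f j) - c 0 (f j)) ^+ 2)
    (fun i x => \sum_j (i == f j)%:R * (2 * (x 0 (f j) - c 0 (f j)))).
  elim: m f => [|m IH] f.
    rewrite (_ : (fun x => _) = cst 0); last by apply/funext => x; rewrite big_ord0.
    rewrite (_ : (fun i x => _) = fun _ => cst 0); first exact: C1g_cst.
    by apply/funext => i; apply/funext => x; rewrite big_ord0.
  have := C1gD (h (f ord0)) (IH (fun j => f (lift ord0 j))).
  congr C1g; first by apply/funext => x; rewrite big_ord_recl.
  by apply/funext => i; apply/funext => x; rewrite big_ord_recl.
have := key _ id; congr C1g; apply/funext => i; apply/funext => x.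
rewrite (bigD1 i)//= eqxx mul1r big1 ?addr0// => j ji.
by rewrite eq_sym (negbTE ji) mul0r.
Qed.

(* The cutoff is 1 - z (1 - q), where z localizes to the chart and q is a
   function of the height. *)
Lemma chart_cutoff k : C2_chart Omega k -> exists2 C, 0 <= C & forall delta, 0 < delta <= 1 ->
  exists chi G, [/\ C1g setT chi G, (forall x, 0 <= chi x <= 1),
    (forall x, Omega x -> 1 - chi x <= \1_(thin k delta) x),
    (forall i x, Omega x -> `|G i x| <= C / delta * \1_(thin k delta) x) &
    (forall x, core k x -> height k x <= delta / 2 -> chi x = 0)].
Proof.
move=> hk; have [Gt hGt] := C1g_height hk; have r0 := chart_radius_gt0 hk.
set r := chart_radius k in r0 *; set c := chart_center k.
have /choice[T hT] : forall i, exists T : R, 0 <= T /\ forall x, closure Omega x -> `|Gt i x| <= T.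
  move=> i; have cG : {within closure Omega, continuous (Gt i)}.
    by apply: continuous_subspaceT => x; have [_ /(_ i x I)[]] := hGt.
  have [T T0 HT] := compact_image_bounded (compact_closure bOmega) cG.
  by exists T.
pose T' : R := \sum_i T i.
have T'0 : 0 <= T' by apply: sumr_ge0 => i _; have [] := hT i.
have HT i x : Omega x -> `|Gt i x| <= T'.
  move=> Ox; have [_ /(_ x (subset_closure Ox)) h] := hT i; apply: (le_trans h).
  by rewrite /T' (bigD1 i)//= lerDl; apply: sumr_ge0 => j _; have [] := hT j.
(* Since [dstep] is bounded by 4, the localizing factor contributes 4 * (8 / r^2) * 2 * (r / 2) = 32
   / r and the factor in the height 4 * (4 / delta) * T'. The first is also divided by delta, as
   delta <= 1. *)
exists (32 / r + 16 * T').
  have : 0 < 32 / r by rewrite divr_gt0.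
  by move: T'0; lra.
move=> delta /andP[d0 d1].
(* The Euclidean distance is used for smoothness. Outside the half-size cube the sum of squares is
   at least r^2 / 4, so az <= 0; on the core, of side shrunk by the dimension, it is at most r^2 /
   8, so az >= 1. Likewise aq <= 0 up to height delta / 2 and aq >= 1 from height delta on. *)
pose az (x : 'rV[R]_n.+1) : R := 2 - 8 / r ^+ 2 * (\sum_l (x 0 l - c 0 l) ^+ 2).
pose aq (x : 'rV[R]_n.+1) : R := 4 / delta * height k x - 2.
have haz := C1gB (C1g_cst setT 2) (C1gZ (8 / r ^+ 2) (C1g_sqdist c)).
have haq := C1gB (C1gZ (4 / delta) hGt) (C1g_cst setT 2).
have hz := C1g_comp haz (@is_derive_step R) (@continuous_dstep R).
have hq := C1g_comp haq (@is_derive_step R) (@continuous_dstep R).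
have one := C1g_cst (setT : set 'rV[R]_n.+1) (1 : R).
have hchi := C1gB one (C1gM hz (C1gB one hq)).
have r2 : 0 < r ^+ 2 by rewrite exprn_gt0.
have far x : ~ ball c (r / 2) x -> az x <= 0.
  move=> nb; have [l hl] : exists l, r / 2 <= `|c 0 l - x 0 l|.
    apply: contrapT => h; apply: nb; apply/rV_ballP; split=> [|l]; first by rewrite divr_gt0.
    by rewrite ltNge; apply/negP => ?; apply: h; exists l.
  have : (r / 2) ^+ 2 <= \sum_l (x 0 l - c 0 l) ^+ 2.
    rewrite (bigD1 l)//= ler_wpDr//; first by apply: sumr_ge0 => j _; exact: sqr_ge0.
    by rewrite ler_sqr_norm distrC; rewrite ger0_norm//; rewrite divr_ge0// ltW.
  rewrite /az; move: (\sum_l _) => S hS.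
  have : 8 / r ^+ 2 * (r / 2) ^+ 2 <= 8 / r ^+ 2 * S.
    by rewrite ler_wpM2l// divr_ge0// ltW.
  have -> : 8 / r ^+ 2 * (r / 2) ^+ 2 = 2 by field; rewrite gt_eqF.
  lra.
have near_c x : core k x -> 1 <= az x.
  move=> /rV_ballP[rho0 h]; have n0 : (0 : R) < n.+1%:R by rewrite ltr0n.
  have n1 : (1 : R) <= n.+1%:R by rewrite ler1n.
  have : \sum_l (x 0 l - c 0 l) ^+ 2 <= r ^+ 2 / 8.
    apply: (@le_trans _ _ (\sum_(l < n.+1) (r / (4 * n.+1%:R)) ^+ 2)).
      apply: ler_sum => l _; rewrite ler_sqr_norm distrC (ger0_norm (ltW rho0)).
      exact: ltW (h l).
    rewrite sumr_const card_ord -[_ *+ n.+1]mulr_natl.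
    have -> : n.+1%:R * (r / (4 * n.+1%:R)) ^+ 2 = r ^+ 2 / 16 * n.+1%:R^-1.
      by field; rewrite gt_eqF.
    have : n.+1%:R^-1 <= (1 : R) by rewrite invf_le1.
    have : (0 : R) < n.+1%:R^-1 by rewrite invr_gt0.
    move: (_^-1) => q q0 q1; nra.
  rewrite /az; move: (\sum_l _) => S hS.
  have : 8 / r ^+ 2 * S <= 8 / r ^+ 2 * (r ^+ 2 / 8).
    by rewrite ler_wpM2l// divr_ge0// ltW.
  have -> : 8 / r ^+ 2 * (r ^+ 2 / 8) = 1 by field; rewrite gt_eqF.
  lra.
have deep x : Omega x -> ~ thin k delta x -> ~ ball c (r / 2) x \/ 1 <= aq x.
  move=> Ox nS; have [Bx|] := pselect (ball c (r / 2) x); last by left.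
  right; have Bx' : ball c r x by apply: le_ball Bx; lra.
  have h0 : 0 < height k x by exact: (chart_ballE hk Bx').1.
  have : delta <= height k x.
    by rewrite leNgt; apply/negP => h; apply: nS; split=> //; rewrite h0.
  move=> h; have : 4 / delta * delta <= 4 / delta * height k x.
    by rewrite ler_wpM2l// divr_ge0// ltW.
  rewrite /aq mulfVK ?gt_eqF//; lra.
have z01 x := conj (step_ge0 (az x)) (step_le1 (az x)).
have q01 x := conj (step_ge0 (aq x)) (step_le1 (aq x)).
exists (fun x => 1 - step (az x) * (1 - step (aq x))); eexists; split; first exact: hchi.
- move=> x; have [z0 z1] := z01 x; have [q0 q1] := q01 x; apply/andP; split; nra.
- move=> x Ox; rewrite subKr indicE; have [z0 z1] := z01 x; have [q0 q1] := q01 x.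
  have [_|] := boolP (x \in thin k delta); first by rewrite /=; nra.
  rewrite notin_setE => /(deep _ Ox)[/far h|h].
    by rewrite (step_le0 h) mul0r.
  by rewrite (step_ge1 h) subrr mulr0.
- move=> i x Ox; have [z0 z1] := z01 x; have [q0 q1] := q01 x; rewrite /=.
  rewrite !sub0r -/(az x) -/(aq x) subr0 normrN indicE.
  have [|] := boolP (x \in thin k delta); last first.
    rewrite notin_setE mulr0 => /(deep _ Ox)[/far h|h].
      by rewrite (step_le0 h) (dstep_le0 h) !mul0r addr0 normr0.
    by rewrite (step_ge1 h) (dstep_ge1 h) subrr !mulr0 !mul0r oppr0 mulr0 addr0 normr0.
  rewrite inE mulr1 => -[/rV_ballP[_ /(_ i)]]; rewrite distrC -/c -/r => xc _.
  have h1 := dstep_bound (az x); have h2 := dstep_bound (aq x); have h3 := HT i x Ox.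
  have k8 : 0 <= 8 / r ^+ 2 by rewrite divr_ge0// ltW.
  have e1 : `|dstep (az x) * - (8 / r ^+ 2 * (2 * (x 0 i - c 0 i))) * (1 - step (aq x))| <= 32 / r.
    rewrite normrM -[leRHS]mulr1; apply: ler_pM => //; last by rewrite ger0_norm; lra.
    rewrite normrM normrN [X in _ * X]normrM (ger0_norm k8).
    have -> : 32 / r = 4 * (8 / r ^+ 2 * r) by field; rewrite gt_eqF.
    apply: ler_pM => //; first by rewrite mulr_ge0.
    by apply: ler_wpM2l => //; rewrite normrM ger0_norm//; lra.
  have e2 : `|step (az x) * - (dstep (aq x) * (4 / delta * Gt i x))| <= 16 * T' / delta.
    rewrite normrM normrN -[leRHS]mul1r; apply: ler_pM => //; first by rewrite ger0_norm.
    have k4 : 0 <= 4 / delta by rewrite divr_ge0// ltW.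
    rewrite normrM [X in _ * X]normrM (ger0_norm k4).
    have -> : 16 * T' / delta = 4 * (4 / delta * T') by ring.
    by apply: ler_pM => //; [rewrite mulr_ge0|exact: ler_wpM2l].
  apply: le_trans (ler_normD _ _) _; rewrite [leRHS]mulrDl; apply: lerD => //.
  apply: (le_trans e1); rewrite ler_peMr//; first by rewrite divr_ge0// ltW.
  by rewrite invf_ge1.
- move=> x cx hx; rewrite (step_ge1 (near_c x cx)) step_le0 ?subr0 ?mulr1 ?subrr//.
  rewrite /aq subr_le0; have : 4 / delta * height k x <= 4 / delta * (delta / 2).
    by rewrite ler_wpM2l// divr_ge0// ltW.
  have -> : 4 / delta * (delta / 2) = 2 by field; rewrite gt_eqF.
  by [].
Qed.

(** All factors lie in [0, 1]: this yields the subadditivity of 1 - product and lets each term of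
    the Leibniz rule be bounded by the gradient of a single factor. *)
Lemma prod_cutoff p (chi_ : 'I_p -> fn) (G_ : 'I_p -> 'I_n.+1 -> fn) :
  (forall j, C1g setT (chi_ j) (G_ j)) -> (forall j x, 0 <= chi_ j x <= 1) ->
  exists G, [/\ C1g setT (fun x => \prod_j chi_ j x) G,
    (forall x, 0 <= \prod_j chi_ j x <= 1),
    (forall x, 1 - \prod_j chi_ j x <= \sum_j (1 - chi_ j x)) &
    (forall i x, `|G i x| <= \sum_j `|G_ j i x|)].
Proof.
elim: p chi_ G_ => [|p IH] chi_ G_ hchi b.
  exists (fun _ => cst 0); split.
  - rewrite (_ : (fun x => _) = cst 1); first exact: C1g_cst.
    by apply/funext => x; rewrite big_ord0.
  - by move=> x; rewrite big_ord0 ler01 lexx.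
  - by move=> x; rewrite !big_ord0 subrr.
  - by move=> i x; rewrite big_ord0 normr0.
have [G [hG bG dG gG]] := IH (fun j => chi_ (lift ord0 j)) (fun j => G_ (lift ord0 j))
  (fun j => hchi _) (fun j x => b _ _).
have := C1gM (hchi ord0) hG; set G' := (fun i x => _ + _) => hG'.
exists G'; split.
- by move: hG'; congr C1g; apply/funext => x; rewrite big_ord_recl.
- move=> x; rewrite big_ord_recl; have := b ord0 x; have := bG x.
  move: (\prod_j _) (chi_ _ _) => s t /andP[? ?] /andP[? ?]; apply/andP; split; nra.
- move=> x; rewrite !big_ord_recl; have := b ord0 x; have := bG x; have := dG x.
  move: (\prod_j _) (chi_ _ _) (\sum_j _) => s t S ? /andP[? ?] /andP[? ?]; nra.
- move=> i x; rewrite big_ord_recl /G'; apply: le_trans (ler_normD _ _) _.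
  have /andP[p0 p1] := bG x; have /andP[c0 c1] := b ord0 x.
  apply: lerD; rewrite normrM.
    by rewrite [X in _ * X]ger0_norm// ler_piMr.
  by apply: (le_trans _ (gG i x)); rewrite (ger0_norm c0) ler_piMl.
Qed.

Lemma compact_boundary : compact (boundary Omega).
Proof.
rewrite /boundary; apply: (@subclosed_compact _ _ (closure Omega)).
- rewrite setDE; apply: closedI; first exact: closed_closure.
  by apply: open_closedC; exact: open_interior.
- exact: compact_closure.
- by move=> x [].
Qed.

Lemma boundary_cover : C2_boundary Omega -> exists p (ks : 'I_p -> chart R n.+1),
  (forall j, C2_chart Omega (ks j)) /\
  forall x, boundary Omega x -> exists j, core (ks j) x.
Proof.
move=> cb; have [[x0 b0]|nb] := pselect (boundary Omega !=set0); last first.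
  exists 0%N, (fun _ => Chart 0 1 0 false (fun=> 0)); split=> [[]//|x bx].
  by case: nb; exists x.
(* This chart serves as the value of the choice function off the boundary. *)
have [k0 [hk0 _]] := cb x0 b0.
have /choice[ks hks] : forall x, exists k, C2_chart Omega k /\
    (boundary Omega x -> chart_center k = x).
  move=> x; have [/cb[k [hk e]]|nbx] := pselect (boundary Omega x); first by exists k.
  by exists k0.
have rho0 k : C2_chart Omega k -> 0 < chart_radius k / (4 * n.+1%:R).
  by move=> /chart_radius_gt0 ?; rewrite divr_gt0// mulr_gt0// ltr0n.
have := compact_boundary; rewrite compact_cover => /(_ _ [set: 'rV[R]_n.+1]
    (fun x => core (ks x)))[].
- by move=> x _; rewrite ball_box ?rho0//; [exact: open_box|have [] := hks x].
- move=> x bx; exists x => //; have [hk e] := hks x; rewrite (e bx).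
  exact/ballxx/rho0.
move=> F _ hF; exists (size (finmap.enum_fset F)), (fun j => ks (nth 0 (finmap.enum_fset F) j)).
split=> [j|x bx].
  by have [] := hks (nth 0 (finmap.enum_fset F) j).
have [y yF cy] := hF x bx.
have iF : (index y (finmap.enum_fset F) < size (finmap.enum_fset F))%N by rewrite index_mem.
by exists (Ordinal iF); rewrite /= nth_index.
Qed.

(** The constant iterates |s + t|^2 <= 2 |s|^2 + 2 |t|^2; what matters is that it depends on the
    number of terms only. *)
Lemma nrm2_sum_le p (f_ : 'I_p -> fn) : (forall j, S2 (f_ j)) ->
  S2 (fun x => \sum_j f_ j x) /\
  N (fun x => \sum_j f_ j x) <= 2 ^+ p * \sum_j N (f_ j).
Proof.
elim: p f_ => [|p IH] f_ sf.
  rewrite (_ : (fun x => _) = cst 0); last by apply/funext => x; rewrite big_ord0.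
  split; last first.
    apply: (@le_trans _ _ 0); first by rewrite nrm2_cst0.
    by apply: mulr_ge0; [exact: exprn_ge0|apply: sumr_ge0 => j _; exact: nrm2_ge0].
  by apply: (@sqint_bounded _ _ _ _ _ mO muO _ 0) => //; apply: aeW => x _; rewrite normr0.
have [s1 h1] := IH (fun j => f_ (lift ord0 j)) (fun j => sf _).
rewrite (_ : (fun x => _) = fun x => f_ ord0 x + \sum_j f_ (lift ord0 j) x); last first.
  by apply/funext => x; rewrite big_ord_recl.
split; first exact: sqintD.
apply: le_trans (nrm2D_le mO (sf ord0) s1) _; rewrite big_ord_recl exprS.
have := nrm2_ge0 mu Omega (f_ ord0); have : (1 : R) <= 2 ^+ p by rewrite exprn_ege1// ler1n.
move: h1; move: (N _) (N (f_ ord0)) (\sum_j _) (2 ^+ p) => A B S q; nra.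
Qed.

(** Used with the cutoff errors, which live on the union of the thin strips: it reduces their norms
    to one strip at a time. *)
Lemma nrm2_indic_dominated p (A_ : 'I_p -> set 'rV[R]_n.+1) (a_ : 'I_p -> R) (q f : fn) :
  (forall j, measurable (A_ j)) -> (forall j, 0 <= a_ j) -> measurable_fun Omega q -> S2 f ->
  (forall x, Omega x -> `|q x| <= \sum_j a_ j * \1_(A_ j) x) ->
  N (fun x => q x * f x) <= 2 ^+ p * \sum_j a_ j ^+ 2 * N (fun x => \1_(A_ j) x * f x).
Proof.
move=> mA a0 mq sf qA.
have sn : S2 (fun x => `|f x|).
  apply: (sqint_le mO _ sf); first by apply: measurableT_comp => //; exact: sqint_meas sf.
  by apply: aeW => x _; rewrite normr_id.
have sj j : S2 (fun x => \1_(A_ j) x * `|f x|).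
  apply: (sqint_bmul mO (M := 1)) => //.
  by apply: aeW => x _; rewrite indicE; case: (_ \in _); rewrite ?normr1 ?normr0.
have [s1 h1] := nrm2_sum_le (fun j => sqintZ mO (a_ j) (sj j)).
apply: (le_trans _ (le_trans h1 _)).
  apply: nrm2_le => //; first by apply: measurable_funM => //; exact: sqint_meas sf.
  apply: aeW => x Ox; rewrite normrM [leRHS]ger0_norm; last first.
    by apply: sumr_ge0 => j _; rewrite !mulr_ge0// indicE.
  under [leRHS]eq_bigr do rewrite mulrA.
  by rewrite -mulr_suml ler_wpM2r// qA.
rewrite le_eqVlt; apply/orP; left; apply/eqP; congr (_ * _); apply: eq_bigr => j _.
rewrite nrm2Z//; congr (_ * _); apply: eq_Rintegral => x _.
by rewrite !exprMn real_normK// num_real.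
Qed.

Lemma integral_indic_sqr (A : set 'rV[R]_n.+1) f : A `<=` Omega ->
  (\int[mu]_(x in A) (f x ^+ 2)%:E = \int[mu]_(x in Omega) ((\1_A x * f x) ^+ 2)%:E)%E.
Proof.
move=> AO; rewrite integral_mkcond [RHS]integral_mkcond; apply: eq_integral => x _.
rewrite !patchE indicE; have [xA|xA] := boolP (x \in A).
  by rewrite mem_set ?mul1r//; apply: AO; rewrite inE in xA.
by case: ifP => // _; rewrite mul0r expr0n.
Qed.

Lemma sqint_indic (A : set 'rV[R]_n.+1) f : measurable A -> S2 f -> S2 (fun x => \1_A x * f x).
Proof.
move=> mA sf; apply: (sqint_bmul mO (M := 1)) => //.
by apply: aeW => x _; rewrite indicE; case: (_ \in _); rewrite ?normr1 ?normr0.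
Qed.

Lemma cvg_strip0 k rho f : C2_chart Omega k -> S2 f ->
  N (fun x => \1_(strip k rho l.+1%:R^-1) x * f x) @[l --> \oo] --> 0.
Proof.
move=> hk sf; apply: (cvg_nrm2_small mO (A := fun l => strip k rho l.+1%:R^-1)) => //.
  by move=> l; exact: measurable_strip hk _ _.
move=> x _; have [h0|h0] := leP (height k x) 0.
  by exists 0%N => l _ [_ /andP[]]; rewrite ltNge h0.
exists (Num.truncn (height k x)^-1) => l lt [_ /andP[_]].
apply/negP; rewrite -leNgt invf_ple ?posrE ?ltr0n//.
apply/ltW/(lt_le_trans (truncnS_gt _)); by rewrite ler_nat.
Qed.

(** In the strip estimate the gradient term carries delta^2 times a norm that is small once the
    strip is thin, uniformly for large m. The trace term carries only delta, but for fixed delta it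
    tends to 0 with m. Hence the order of the two limits: the width first, then m. *)
Lemma thin_strip_small k H (u_ : nat -> fn) (G_ : nat -> 'I_n.+1 -> fn) (e : R) :
  C2_chart Omega k -> (forall i, S2 (H i)) -> 0 < e ->
  (forall m, C1cl Omega (u_ m) (G_ m)) ->
  (forall i, N (fun x => G_ m i x - H i x) @[m --> \oo] --> 0) ->
  chart_surface_integral k (fun x => u_ m x ^+ 2) @[m --> \oo] --> 0%E ->
  \forall l \near \oo, \forall m \near \oo,
    N (fun x => \1_(thin k l.+1%:R^-1) x * u_ m x) < e * (l.+1%:R^-1) ^+ 2.
Proof.
move=> hk sH e0 hu cG /fine_cvgP[fcsi ccsi].
have r0 := chart_radius_gt0 hk; set i := chart_axis k.
have su m := C1cl_sqint oOmega bOmega (hu m).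
have cH := cvg_strip0 (chart_radius k) hk (sH i).
near=> l.
have dr : l.+1%:R^-1 < chart_radius k / 2.
  by near: l; apply: cvgr_lt (@cvg_harmonic R) _ _; rewrite divr_gt0.
have Hl : N (fun x => \1_(strip k (chart_radius k) l.+1%:R^-1) x * H i x) < e / 32.
  by near: l; apply: cvgr_lt cH _ _; rewrite divr_gt0.
set d := l.+1%:R^-1 in dr Hl *; have d0 : 0 < d by rewrite invr_gt0 ltr0n.
near=> m.
have csm : chart_surface_integral k (fun x => u_ m x ^+ 2)%R \is a fin_num by near: m; exact: fcsi.
(* The trace term of the strip estimate is then below e d^2 / 4; the gradient term will be below e
   d^2 / 2. *)
have csl : fine (chart_surface_integral k (fun x => u_ m x ^+ 2)%R) < e * d / 8.
  by near: m; apply: cvgr_lt ccsi _ _; rewrite divr_gt0// mulr_gt0.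
have Gm : N (fun x => G_ m i x - H i x) < e / 32.
  by near: m; apply: cvgr_lt (cG i) _ _; rewrite divr_gt0.
have := strip_estimate oOmega hk d0 dr (hu m); rewrite -/i.
have [sum sGm] := su m.
set A := strip k _ d; set B := strip k _ d.
have mA : measurable A by exact: measurable_strip hk _ _.
have mB : measurable B by exact: measurable_strip hk _ _.
have AO : A `<=` Omega by apply: strip_sub => //; lra.
have BO : B `<=` Omega by exact: strip_sub.
rewrite (integral_indic_sqr _ AO) (integral_indic_sqr _ BO).
rewrite (sqnormE mO (sqint_indic mA sum)) (sqnormE mO (sqint_indic mB (sGm i))).
rewrite -(fineK csm) -!EFinM -EFinD lee_fin => h1; apply: (le_lt_trans h1).
have : N (fun x => \1_B x * G_ m i x) <= 2 * N (fun x => G_ m i x - H i x) +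
    2 * N (fun x => \1_B x * H i x).
  have s1 : S2 (fun x => \1_B x * (G_ m i x - H i x)) by apply: sqint_indic => //; exact: sqintB.
  rewrite (_ : (fun x => _) = fun x => \1_B x * (G_ m i x - H i x) + \1_B x * H i x).
    apply: le_trans (nrm2D_le mO s1 (sqint_indic mB (sH i))) _; rewrite lerD2r ler_wpM2l//.
    rewrite -[leRHS]mul1r -(expr1n R 2); apply: nrm2_bmul => //.
      by apply: aeW => x _; rewrite indicE; case: (_ \in _); rewrite ?normr1 ?normr0.
    exact: sqintB.
  by apply/funext => x; ring.
move: Gm Hl csl; rewrite -/B.
move: (N _) (N (fun x => G_ m i x - H i x)) (N (fun x => \1_B x * H i x)) (fine _).
move=> a1 a2 a3 a4 h2 h3 h4 h5.
have k1 : a1 < e / 8 by lra.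
have k2 : d * a4 < d * (e * d / 8) by rewrite ltr_pM2l.
have k3 : d ^+ 2 * a1 < d ^+ 2 * (e / 8) by rewrite ltr_pM2l// exprn_gt0.
nra.
Unshelve. all: by end_near. Qed.

(* Multiplying the approximants by a cutoff of width delta costs
   N (u_ m) / delta^2 on the strip, which the strip estimate controls by the
   trace and by the gradient on the strip. *)
Lemma traces0_H0 w H : C2_boundary Omega -> S2 w -> (forall i, S2 (H i)) ->
  traces Omega w H (fun=> 0) -> H0 Omega w H.
Proof.
move=> cb sw sH [u_ [G_ [hu c1 c2 c3]]]; split=> // e e0.
have [p [ks [hks cover]]] := boundary_cover cb.
have /choice[C hC] : forall j, exists C : R, 0 <= C /\ forall delta, 0 < delta <= 1 ->
  exists chi G, [/\ C1g setT chi G, (forall x, 0 <= chi x <= 1),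
    (forall x, Omega x -> 1 - chi x <= \1_(thin (ks j) delta) x),
    (forall i x, Omega x -> `|G i x| <= C / delta * \1_(thin (ks j) delta) x) &
    (forall x, core (ks j) x -> height (ks j) x <= delta / 2 -> chi x = 0)].
  by move=> j; have [C C0 h] := chart_cutoff (hks j); exists C.
pose P2 : R := 2 ^+ p; pose SC := \sum_j C j ^+ 2.
have P20 : 0 <= P2 by rewrite exprn_ge0.
have SC0 : 0 <= SC by apply: sumr_ge0 => j _; exact: sqr_ge0.
pose K := 1 + P2 * p%:R + P2 * SC.
have K0 : 0 < K by rewrite /K ltr_wpDr ?mulr_ge0// ltr_pwDl// mulr_ge0.
(* The approximation errors of the function and of each derivative will be at most 4 K e1, that is e
   / 2. *)
pose e1 := e / (8 * K); have e10 : 0 < e1 by rewrite divr_gt0// mulr_gt0.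
have ee1 : e = e1 * (8 * K) by rewrite /e1 mulfVK// gt_eqF// mulr_gt0.
have r0 j := chart_radius_gt0 (hks j).
suff [l [m [[hw hH] [hum hGm huth]]]] : exists l m : nat,
    ((forall j, N (fun x => \1_(thin (ks j) l.+1%:R^-1) x * w x) < e1) /\
     (forall j i, N (fun x => \1_(thin (ks j) l.+1%:R^-1) x * H i x) < e1)) /\
    [/\ N (fun x => u_ m x - w x) < e1, (forall i, N (fun x => G_ m i x - H i x) < e1) &
     forall j, N (fun x => \1_(thin (ks j) l.+1%:R^-1) x * u_ m x) < e1 * (l.+1%:R^-1) ^+ 2].
  set d := l.+1%:R^-1 in hw hH huth *.
  have d01 : 0 < d <= 1 by rewrite /d invr_gt0 ltr0n invf_le1 ?ltr0n ?ler1n.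
  have /andP[d0 d1] := d01.
  have /choice[chi_ hchi] := fun j => (hC j).2 d d01.
  have {hchi}/choice[X_ hX] := hchi.
  have mth j : measurable (thin (ks j) d) by exact: measurable_strip (hks j) _ _.
  have [X [gX bX dX aX]] := prod_cutoff (G_ := X_) (chi_ := chi_)
    (fun j => let: And5 h _ _ _ _ := hX j in h) (fun j => let: And5 _ h _ _ _ := hX j in h).
  set chi := (fun x => \prod_j chi_ j x) in gX bX dX *.
  have bX' x : Omega x -> `|chi x - 1| <= \sum_j 1 * \1_(thin (ks j) d) x.
    move=> Ox; rewrite distrC ger0_norm ?subr_ge0; last by have /andP[] := bX x.
    apply: (le_trans (dX x)); apply: ler_sum => j _; rewrite mul1r.
    by have [_ _ h _ _] := hX j; exact: h.
  have aX' i x : Omega x -> `|X i x| <= \sum_j C j / d * \1_(thin (ks j) d) x.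
    move=> Ox; apply: (le_trans (aX i x)); apply: ler_sum => j _.
    by have [_ _ _ h _] := hX j; exact: h.
  have [mchi mX] := C1g_measurable oOmega (C1gS (@subsetT _ Omega) gX).
  have [sum sGm] := C1cl_sqint oOmega bOmega (hu m).
  have gu := C1cl_C1g oOmega (hu m).
  have gv := C1gM (C1gS (@subsetT _ Omega) gX) gu.
  (* An open set that contains the boundary, where heights are nonpositive, and on which the product
     of the cutoffs is 0. Removing it from the closure leaves a compact subset of [Omega] outside of
     which chi u_m vanishes. *)
  pose U := \bigcup_j (core (ks j) `&` [set x | height (ks j) x < d / 2]).
  have oU : open U.
    apply: bigcup_open => j _; apply: openI.
      by rewrite ball_box; [exact: open_box|rewrite divr_gt0// mulr_gt0// ltr0n].
    rewrite (_ : [set x | _] = height (ks j) @^-1` [set t | t < d / 2])//.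
    by apply: open_comp; [move=> x _; exact: continuous_height (hks j) _|exact: open_lt].
  pose Kc := closure Omega `&` ~` U.
  have clK : closed Kc by apply: closedI; [exact: closed_closure|exact: open_closedC].
  have cK : compact Kc.
    by apply: (subclosed_compact clK (compact_closure bOmega)) => x [].
  have KO : Kc `<=` Omega.
    move=> x [cx nU]; apply: contrapT => nO; apply: nU.
    have [|j cj] := cover x; first by split=> //; rewrite (interior_id _).1.
    exists j => //; split=> //=.
    have n1 : (1 : R) <= n.+1%:R by rewrite ler1n.
    have Bx : ball (chart_center (ks j)) (chart_radius (ks j)) x.
      apply: le_ball cj; rewrite ler_pdivrMr; last by rewrite mulr_gt0// ltr0n.
      by have := r0 j; nra.
    apply: (@le_lt_trans _ _ 0); last by rewrite divr_gt0.
    by rewrite leNgt; apply/negP => /(chart_ballE (hks j) Bx).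
  have chi0 x : Omega x -> ~ Kc x -> chi x * u_ m x = 0.
    move=> Ox nK; have [j _ [cj /= hj]] : U x.
      by apply: contrapT => nU; apply: nK; split=> //; exact: subset_closure.
    have [_ _ _ _ h] := hX j.
    by rewrite /chi (bigD1 j)//= (h x cj (ltW hj)) !mul0r.
  have [gV GV0] := C1g_patch oOmega clK KO chi0 gv.
  exists ((fun x => chi x * u_ m x) \_ Omega); split.
  - apply: C1_compact_support_intro (C1g_C1 gV) cK KO _ => x nK.
    by rewrite patchE; case: ifPn => //; rewrite inE => Ox; exact: chi0.
  - have -> : N (fun x => ((fun x => chi x * u_ m x) \_ Omega) x - w x) =
        N (fun x => chi x * (u_ m x - w x) + (chi x - 1) * w x).
      by apply: eq_Rintegral => x Ox; rewrite patchE Ox; congr (_ ^+ 2); ring.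
    have b1 : {ae mu, forall x, Omega x -> `|chi x| <= 1}.
      by apply: aeW => x _; have /andP[? ?] := bX x; rewrite ger0_norm.
    have s0 := sqintB mO sum sw.
    have s1 := sqint_bmul mO mchi b1 s0.
    have mc1 : measurable_fun Omega (fun x => chi x - 1) by exact: measurable_funB.
    have b2 : {ae mu, forall x, Omega x -> `|chi x - 1| <= 1}.
      apply: aeW => x _; have : 0 <= chi x <= 1 := bX x; move: (chi x) => t /andP[? ?].
      by rewrite distrC ger0_norm; lra.
    have s2 := sqint_bmul mO mc1 b2 sw.
    apply: le_lt_trans (nrm2D_le mO s1 s2) _.
    have k1 := nrm2_bmul mO mchi ler01 b1 s0.
    have k2 := nrm2_indic_dominated mth (fun=> ler01) mc1 sw bX'.
    have k3 : \sum_(j < p) 1 ^+ 2 * N (fun x => \1_(thin (ks j) d) x * w x) <= p%:R * e1.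
      rewrite -[p in leRHS]card_ord -sum1_card natr_sum mulr_suml; apply: ler_sum => j _.
      by rewrite expr1n ler_wpM2l// ltW.
    have k4 := ler_wpM2l P20 k3.
    have := mulr_ge0 (mulr_ge0 P20 SC0) (ltW e10).
    rewrite ee1 /K -/P2 in k1 k2 k4 *; rewrite expr1n mul1r in k1.
    have := mulr_ge0 (mulr_ge0 P20 (ler0n R p)) (ltW e10).
    by move: k1 k2 k4 hum; lra.
  - move=> i.
    have -> : N (fun x => partial i ((fun x => chi x * u_ m x) \_ Omega) x - H i x) =
        N (fun x => chi x * (G_ m i x - H i x) + ((chi x - 1) * H i x + X i x * u_ m x)).
      apply: eq_Rintegral => x Ox; rewrite (C1g_partial i gV I) patchE Ox.
      by congr (_ ^+ 2); ring.
    have b1 : {ae mu, forall x, Omega x -> `|chi x| <= 1}.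
      by apply: aeW => x _; have /andP[? ?] := bX x; rewrite ger0_norm.
    have s0 := sqintB mO (sGm i) (sH i).
    have s1 := sqint_bmul mO mchi b1 s0.
    have mc1 : measurable_fun Omega (fun x => chi x - 1) by exact: measurable_funB.
    have b2 : {ae mu, forall x, Omega x -> `|chi x - 1| <= 1}.
      apply: aeW => x _; have : 0 <= chi x <= 1 := bX x; move: (chi x) => t /andP[? ?].
      by rewrite distrC ger0_norm; lra.
    have s2 := sqint_bmul mO mc1 b2 (sH i).
    have Cd j : 0 <= C j / d by rewrite divr_ge0 ?(hC j).1 ?(ltW d0).
    have b3 : {ae mu, forall x, Omega x -> `|X i x| <= \sum_j C j / d}.
      apply: aeW => x Ox; apply: (le_trans (aX' i x Ox)); apply: ler_sum => j _.
      by rewrite -[leRHS]mulr1 ler_wpM2l// indicE; case: (_ \in _).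
    have s3 := sqint_bmul mO (mX i) b3 sum.
    apply: le_lt_trans (nrm2D_le mO s1 (sqintD mO s2 s3)) _.
    have k0 := nrm2D_le mO s2 s3.
    have k1 := nrm2_bmul mO mchi ler01 b1 s0.
    have k2 := nrm2_indic_dominated mth (fun=> ler01) mc1 (sH i) bX'.
    have k3 : \sum_(j < p) 1 ^+ 2 * N (fun x => \1_(thin (ks j) d) x * H i x) <= p%:R * e1.
      rewrite -[p in leRHS]card_ord -sum1_card natr_sum mulr_suml; apply: ler_sum => j _.
      by rewrite expr1n ler_wpM2l// ltW.
    have k4 := ler_wpM2l P20 k3.
    have k5 := nrm2_indic_dominated mth Cd (mX i) sum (aX' i).
    (* The gradient of the cutoff, of size C / d, is compensated by the norm of u_m on the strip,
       which is below e1 d^2. *)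
    have k6 : \sum_(j < p) (C j / d) ^+ 2 * N (fun x => \1_(thin (ks j) d) x * u_ m x) <= SC * e1.
      rewrite /SC mulr_suml; apply: ler_sum => j _.
      rewrite expr_div_n -mulrA ler_wpM2l ?sqr_ge0//.
      by rewrite ler_pdivrMl ?exprn_gt0// [leRHS]mulrC; exact/ltW/huth.
    have k7 := ler_wpM2l P20 k6.
    rewrite ee1 /K -/P2 in k1 k2 k4 k5 k7 *; rewrite expr1n mul1r in k1.
    have q1 := mulr_ge0 (mulr_ge0 P20 (ler0n R p)) (ltW e10).
    have q2 := mulr_ge0 (mulr_ge0 P20 SC0) (ltW e10).
    by have := hGm i; move: k0 k1 k2 k4 k5 k7; lra.
suff : \forall l \near \oo, \forall m \near \oo,
    ((forall j, N (fun x => \1_(thin (ks j) l.+1%:R^-1) x * w x) < e1) /\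
     (forall j i, N (fun x => \1_(thin (ks j) l.+1%:R^-1) x * H i x) < e1)) /\
    [/\ N (fun x => u_ m x - w x) < e1, (forall i, N (fun x => G_ m i x - H i x) < e1) &
     forall j, N (fun x => \1_(thin (ks j) l.+1%:R^-1) x * u_ m x) < e1 * (l.+1%:R^-1) ^+ 2].
  by move=> /filter_ex[l /filter_ex[m h]]; exists l, m.
have tj j := thin_strip_small (hks j) sH e10 hu c2 _.
near=> l.
have hw : forall j, N (fun x => \1_(thin (ks j) l.+1%:R^-1) x * w x) < e1.
  near: l; apply: filter_forall => j.
  by apply: (near_lt (cvg_strip0 _ (hks j) _) e10).
have hH : forall j i, N (fun x => \1_(thin (ks j) l.+1%:R^-1) x * H i x) < e1.
  near: l; apply: filter_forall => j; apply: filter_forall => i.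
  by apply: (near_lt (cvg_strip0 _ (hks j) _) e10).
have ht : forall j, \forall m \near \oo,
    N (fun x => \1_(thin (ks j) l.+1%:R^-1) x * u_ m x) < e1 * (l.+1%:R^-1) ^+ 2.
  near: l; apply: filter_forall => j; apply: tj.
  move=> j'; rewrite (_ : (fun m => _) =
    fun m => chart_surface_integral (ks j') (fun x => (u_ m x - 0) ^+ 2)); first exact: c3.
  by apply/funext => m; congr chart_surface_integral; apply/funext => x; rewrite subr0.
near=> m; split=> //; split.
- by near: m; exact: (near_lt c1 e10).
- by near: m; apply: filter_forall => i; exact: (near_lt (c2 i) e10).
- by near: m; exact: filter_forall.
Unshelve. all: by end_near. Qed.

End cutoffs.

(** * The linear problem *)

Lemma cvg_sum0 (R : realType) p (f_ : 'I_p -> nat -> R) :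
  (forall j, f_ j m @[m --> \oo] --> 0) -> \sum_j f_ j m @[m --> \oo] --> 0.
Proof.
elim: p f_ => [|p IH] f_ cf.
  rewrite (_ : (fun m => _) = fun=> 0); first exact: cvg_cst.
  by apply/funext => m; rewrite big_ord0.
rewrite (_ : (fun m => _) = fun m => f_ ord0 m + \sum_j f_ (lift ord0 j) m); last first.
  by apply/funext => m; rewrite big_ord_recl.
by rewrite -[X in _ --> X](addr0 0); apply: cvgD => //; exact: (IH (fun j => f_ (lift ord0 j))).
Qed.

(** * Riesz representation by minimization; [lin r u v] stands for r u + v *)

Section riesz.
Variables (R : realType) (E : Type) (lin : R -> E -> E -> E) (D : set E).
Variables (B : E -> E -> R) (L : E -> R) (M : R).
Hypotheses (D_lin : forall r u v, D u -> D v -> D (lin r u v))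
  (B_lin : forall r u v w, D u -> D v -> D w -> B (lin r u v) w = r * B u w + B v w)
  (B_sym : forall u v, D u -> D v -> B u v = B v u)
  (B_ge0 : forall u, D u -> 0 <= B u u)
  (L_lin : forall r u v, D u -> D v -> L (lin r u v) = r * L u + L v)
  (L_bounded : forall u, D u -> 2 * L u <= B u u + M)
  (D_complete : forall u_ : nat -> E, (forall m, D (u_ m)) ->
    (forall e, 0 < e -> exists m0, forall m n, (m0 <= m)%N -> (m0 <= n)%N ->
       B (lin (-1) (u_ m) (u_ n)) (lin (-1) (u_ m) (u_ n)) < e) ->
    exists2 u, D u & B (lin (-1) (u_ m) u) (lin (-1) (u_ m) u) @[m --> \oo] --> 0)
  (D_nonempty : D !=set0).

Let B_linr r u v w : D u -> D v -> D w -> B w (lin r u v) = r * B w u + B w v.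
Proof.
by move=> Du Dv Dw; rewrite B_sym ?B_lin ?(B_sym Du Dw) ?(B_sym Dv Dw)//; exact: D_lin.
Qed.

Let B_quad r u v : D u -> D v ->
  B (lin r u v) (lin r u v) = r ^+ 2 * B u u + 2 * r * B u v + B v v.
Proof.
move=> Du Dv; have Duv := D_lin r Du Dv.
by rewrite B_lin// !B_linr// (B_sym Dv Du); ring.
Qed.

(* A minimizing sequence of B u u - 2 L u is Cauchy by the parallelogram identity. *)
Lemma riesz : exists2 u, D u & forall phi, D phi -> B u phi = L phi.
Proof.
pose q u := B u u - 2 * L u.
have q_ge u : D u -> - M <= q u by move=> /L_bounded; rewrite /q; lra.
pose A := q @` D.
have infA : has_inf A.
  split; first by have [u Du] := D_nonempty; exists (q u), u.
  by exists (- M) => _ [u Du <-]; exact: q_ge.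
pose m := inf A.
have q_inf u : D u -> m <= q u by move=> Du; apply: ge_inf; [exact: infA.2|exists u].
have /choice[u_ hu] : forall k : nat, exists u, D u /\ q u < m + k.+1%:R^-1.
  move=> k; have [_ [u Du <-] h] : exists2 t, A t & t < m + k.+1%:R^-1.
    by apply: inf_adherent => //; rewrite invr_gt0 ltr0n.
  by exists u.
have Du k : D (u_ k) by have [] := hu k.
have qu k : q (u_ k) < m + k.+1%:R^-1 by have [] := hu k.
have cauchy j k : B (lin (-1) (u_ j) (u_ k)) (lin (-1) (u_ j) (u_ k)) <
    2 * j.+1%:R^-1 + 2 * k.+1%:R^-1.
  have D0 := D_lin (-1) (Du j) (Du j).
  (* The midpoint of u_j and u_k, with 0 written as - u_j + u_j. *)
  have Dmid : D (lin 2^-1 (lin 1 (u_ j) (u_ k)) (lin (-1) (u_ j) (u_ j))).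
    by apply: D_lin => //; apply: D_lin.
  have := q_inf _ Dmid; have := qu j; have := qu k.
  rewrite /q !B_quad//; last exact: D_lin.
  rewrite !L_lin//; last exact: D_lin.
  rewrite !B_lin ?B_linr//; [|exact: D_lin..].
  rewrite !(B_sym (Du k) (Du j)).
  set x := B (u_ j) (u_ j); set y := B (u_ j) (u_ k); set z := B (u_ k) (u_ k).
  set s := L (u_ j); set t := L (u_ k).
  move: j.+1%:R^-1 k.+1%:R^-1 => e1 e2; lra.
have [u Dlu cu] : exists2 u, D u &
    B (lin (-1) (u_ k) u) (lin (-1) (u_ k) u) @[k --> \oo] --> 0.
  apply: D_complete => // e e0.
  have h0 (k : nat) : 0 <= k.+1%:R^-1 :> R by rewrite invr_ge0.
  have e4 : 0 < e / 4 by rewrite divr_gt0.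
  have [m0 hm0] := (cvg0_ltP h0).1 (@cvg_harmonic R) _ e4.
  exists m0 => j k /hm0 hj /hm0 hk; apply: lt_trans (cauchy j k) _.
  by move: hj hk; move: (j.+1%:R^-1) (k.+1%:R^-1) => s t; lra.
exists u => // phi Dphi.
have c1 : B (u_ k) phi @[k --> \oo] --> B u phi.
  have Bk k : D (lin (-1) (u_ k) u) by exact: D_lin.
  have cs k : B (lin (-1) (u_ k) u) phi ^+ 2 <=
      B (lin (-1) (u_ k) u) (lin (-1) (u_ k) u) * B phi phi.
    set v := lin _ _ _; have Dv : D v by exact: Bk.
    have h r : 0 <= r ^+ 2 * B v v + 2 * r * B v phi + B phi phi.
      by rewrite -B_quad//; apply: B_ge0; exact: D_lin.
    have v0 := B_ge0 Dv; have p0 := B_ge0 Dphi.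
    have [v0'|v0'] := eqVneq (B v v) 0.
      rewrite v0' mul0r; have [->|nz] := eqVneq (B v phi) 0; first by rewrite expr0n.
      have := h (- (B phi phi + 1) / (2 * B v phi)); rewrite v0' mulr0 add0r.
      have -> : 2 * (- (B phi phi + 1) / (2 * B v phi)) * B v phi = - (B phi phi + 1).
        by field.
      by rewrite opprD addrAC addNr add0r; lra.
    have v1 : 0 < B v v by rewrite lt_neqAle eq_sym v0'.
    have := h (- B v phi / B v v).
    have -> : (- B v phi / B v v) ^+ 2 * B v v + 2 * (- B v phi / B v v) * B v phi + B phi phi =
        B phi phi - B v phi ^+ 2 / B v v by field.
    by rewrite subr_ge0 ler_pdivrMr// mulrC.
  have c2 : B (lin (-1) (u_ k) u) phi ^+ 2 @[k --> \oo] --> 0.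
    have h : B (lin (-1) (u_ k) u) (lin (-1) (u_ k) u) * B phi phi @[k --> \oo] --> 0.
      by rewrite -(mul0r (B phi phi)); apply: cvgM => //; exact: cvg_cst.
    by apply: cvg_ge0_le h => k; rewrite sqr_ge0 cs.
  apply/cvgrPdist_lt => e e0.
  have [m0 hm0] := (cvg0_ltP (fun k => sqr_ge0 _)).1 c2 (e ^+ 2) (exprn_gt0 2 e0).
  exists m0 => // k /= /hm0; rewrite B_lin// mulN1r.
  rewrite distrC => h; rewrite ltNge; apply/negP => h2.
  have : e ^+ 2 <= `|B (u_ k) phi - B u phi| ^+ 2 by rewrite ler_pXn2r// nnegrE ltW.
  by rewrite real_normK ?num_real//; move: h; lra.
(* Since m <= q (t phi + u_k) and q (u_k) < m + 1/(k+1), the first variation is almost nonnegative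
   at u_k; it becomes so in the limit. *)
have key t : 0 <= 2 * t * (B u phi - L phi) + t ^+ 2 * B phi phi.
  have cl : 2 * t * (B (u_ k) phi - L phi) + t ^+ 2 * B phi phi + k.+1%:R^-1 @[k --> \oo] -->
      2 * t * (B u phi - L phi) + t ^+ 2 * B phi phi + 0.
    apply: cvgD; last exact: cvg_harmonic.
    apply: cvgD; last exact: cvg_cst.
    by apply: cvgM; [exact: cvg_cst|apply: cvgB => //; exact: cvg_cst].
  rewrite addr0 in cl; apply: (cvgr_to_ge cl) => k.
  have := q_inf _ (D_lin t Dphi (Du k)); have := qu k.
  by rewrite /q B_quad// L_lin// (B_sym Dphi (Du k)); move: (k.+1%:R^-1) => x; lra.
apply/eqP; rewrite -subr_eq0; apply/eqP.
have P0 := B_ge0 Dphi; move: (B u phi - L phi) (B phi phi) P0 key => x y y0 key.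
(* The value y + 1 replaces the minimizing denominator y, which may be 0. *)
have := key (- x / (y + 1)).
have -> : 2 * (- x / (y + 1)) * x + (- x / (y + 1)) ^+ 2 * y = - (x ^+ 2 * (y + 2) / (y + 1) ^+ 2).
  by field; lra.
rewrite oppr_ge0 => h; apply/eqP; rewrite -sqrf_eq0 eq_le sqr_ge0 andbT.
move: h; rewrite pmulr_lle0 ?invr_gt0 ?exprn_gt0//; last by lra.
by rewrite pmulr_lle0//; lra.
Qed.

End riesz.

Section linear_problem.
Variables (R : realType) (n : nat) (Omega : set 'rV[R]_n.+1).
Hypotheses (oOmega : open Omega) (bOmega : bounded_set Omega).
Notation mu := (leb_rV R n.+1).
Notation fn := ('rV[R]_n.+1 -> R).
Implicit Types (u v w phi h f : fn) (G H U V Phi : 'I_n.+1 -> fn) (i : 'I_n.+1).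
Let mO : measurable Omega. Proof. exact: mOmega oOmega. Qed.
Let muO : (mu Omega < +oo)%E. Proof. exact: muOmega oOmega bOmega. Qed.

Notation S2 := (sqint mu Omega).
Notation N := (nrm2 mu Omega).
Notation wg := (is_weak_gradient Omega).

Lemma young u v (e : R) : 0 < e -> S2 u -> S2 v ->
  2 * \int[mu]_(x in Omega) (u x * v x) <= N u / e + e * N v.
Proof.
move=> e0 su sv; have := nrm2_ge0 mu Omega (fun x => u x - e * v x).
have suv := sqint_mul mO su sv.
have s1 := ((sqintP mu Omega u).1 su).2; have s2 := ((sqintP mu Omega v).1 sv).2.
have -> : N (fun x => u x - e * v x) =
    N u - 2 * e * \int[mu]_(x in Omega) (u x * v x) + e ^+ 2 * N v.
  have -> : N (fun x => u x - e * v x) =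
      \int[mu]_(x in Omega) (u x ^+ 2 - (2 * e * (u x * v x) - e ^+ 2 * v x ^+ 2)).
    by apply: eq_Rintegral => x _; ring.
  rewrite RintegralB//; [|exact: (summableB mO (summableZ mO _ suv) (summableZ mO _ s2))].
  rewrite RintegralB//; [|exact: (summableZ mO _ suv)|exact: (summableZ mO _ s2)].
  by rewrite !RintegralZl// /nrm2; ring.
move: (N u) (N v) (\int[mu]_(x in Omega) _) => x y z h.
have -> : x / e + e * y = (x + e ^+ 2 * y) / e by field; rewrite gt_eqF.
by rewrite ler_pdivlMr//; lra.
Qed.

Variables (a : fn) (K0 K1 : R).
Hypotheses (K00 : 0 < K0) (ma : measurable_fun Omega a)
  (aK : forall x, Omega x -> K0 <= a x <= K1).

Definition energy U V : R := \int[mu]_(x in Omega) (a x * \sum_i U i x * V i x).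

Lemma a_bounded : {ae mu, forall x, Omega x -> `|a x| <= K1}.
Proof.
by apply: aeW => x /aK /andP[h1 h2]; rewrite ger0_norm//; exact: le_trans (ltW K00) h1.
Qed.

Lemma sqint_a u : S2 u -> S2 (fun x => a x * u x).
Proof. by apply: (sqint_bmul mO ma); exact: a_bounded. Qed.

Lemma summable_energy U V : (forall i, S2 (U i)) -> (forall i, S2 (V i)) ->
  summable mu Omega (fun x => a x * \sum_i U i x * V i x).
Proof.
move=> sU sV; rewrite (_ : (fun x => _) = fun x => \sum_i (a x * U i x) * V i x).
  by apply: summable_sum => // i; apply: sqint_mul => //; exact: sqint_a.
by apply/funext => x; rewrite mulr_sumr; apply: eq_bigr => i _; rewrite mulrA.
Qed.

Lemma energyE U V : (forall i, S2 (U i)) -> (forall i, S2 (V i)) ->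
  energy U V = \sum_i \int[mu]_(x in Omega) ((a x * U i x) * V i x).
Proof.
move=> sU sV; rewrite -Rintegral_sum//.
  by apply: eq_Rintegral => x _; rewrite mulr_sumr; apply: eq_bigr => i _; rewrite mulrA.
by move=> i; apply: sqint_mul => //; exact: sqint_a.
Qed.

Lemma energy_sym U V : energy U V = energy V U.
Proof.
by apply: eq_Rintegral => x _; congr (_ * _); apply: eq_bigr => i _; rewrite mulrC.
Qed.

Lemma energy_lin (r : R) U V Phi : (forall i, S2 (U i)) -> (forall i, S2 (V i)) ->
  (forall i, S2 (Phi i)) ->
  energy (fun i x => r * U i x + V i x) Phi = r * energy U Phi + energy V Phi.
Proof.
move=> sU sV sP; have s1 := summable_energy sU sP; have s2 := summable_energy sV sP.
rewrite /energy -RintegralZl// -RintegralD//; last exact: (summableZ mO).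
apply: eq_Rintegral => x _; rewrite mulrCA -mulrDr; congr (_ * _).
rewrite mulr_sumr -big_split/=.
by apply: eq_bigr => i _; ring.
Qed.

Lemma energyB U V Phi : (forall i, S2 (U i)) -> (forall i, S2 (V i)) ->
  (forall i, S2 (Phi i)) ->
  energy (fun i x => U i x - V i x) Phi = energy U Phi - energy V Phi.
Proof.
move=> sU sV sP; rewrite (_ : (fun i x => _) = fun i x => -1 * V i x + U i x).
  by rewrite energy_lin// mulN1r addrC.
by apply/funext => i; apply/funext => x; rewrite mulN1r addrC.
Qed.

Lemma energy_ge U : (forall i, S2 (U i)) -> K0 * \sum_i N (U i) <= energy U U.
Proof.
move=> sU; rewrite energyE// mulr_sumr; apply: ler_sum => i _.
have s1 := ((sqintP mu Omega (U i)).1 (sU i)).2.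
rewrite /nrm2 -RintegralZl//; apply: le_Rintegral => //.
- exact: (summableZ mO).
- exact: (sqint_mul mO (sqint_a (sU i)) (sU i)).
- by move=> x /aK /andP[h _]; rewrite -mulrA -expr2 ler_wpM2r// sqr_ge0.
Qed.

Lemma energy_le U : (forall i, S2 (U i)) -> energy U U <= K1 * \sum_i N (U i).
Proof.
move=> sU; rewrite energyE// mulr_sumr; apply: ler_sum => i _.
have s1 := ((sqintP mu Omega (U i)).1 (sU i)).2.
rewrite /nrm2 -RintegralZl//; apply: le_Rintegral => //.
- exact: (sqint_mul mO (sqint_a (sU i)) (sU i)).
- exact: (summableZ mO).
- by move=> x /aK /andP[_ h]; rewrite -mulrA -expr2 ler_wpM2r// sqr_ge0.
Qed.

(* The weak equation div (a U) = f, where U is a weak gradient of the solution. *)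
Definition weak_eq U f : Prop := forall phi Phi, H0 Omega phi Phi ->
  summable mu Omega (fun x => f x * phi x) /\
  energy U Phi = - \int[mu]_(x in Omega) (f x * phi x).

(** The definition uses the chosen gradients of the solution and of the test function, while
    [weak_eq] accepts any. They agree almost everywhere, so the energies are equal. *)
Lemma weak_solutionP f h u : weak_solution Omega a f h u <->
  exists U, [/\ S2 u, wg u U, traces Omega u U h & weak_eq U f].
Proof.
split=> [[hu htr hw]|[U [su wu tu eU]]].
  have wu := H1_weak_gradient hu; have [su _] := hu.
  exists (weak_gradient Omega u); split=> //.
    by apply/(has_traceP oOmega bOmega h su wu).
  move=> phi Phi hphi; have [|sfp e] := hw phi.
    by apply/(H10P oOmega bOmega); exists Phi.
  split=> //; rewrite -[RHS]e; have [sphi sPhi _] := hphi.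
  have h10 : H10 Omega phi by apply/(H10P oOmega bOmega); exists Phi.
  have [_ sW _] := H10_weak_gradient oOmega bOmega h10.
  have ww := H1_weak_gradient h10.1.
  have ae1 : forall i, {ae mu, forall x, Omega x -> Phi i x = weak_gradient Omega phi i x}.
    by apply: (wg_unique oOmega bOmega sphi sphi _ (H0_wg oOmega bOmega hphi) ww); exact: aeW.
  have sU i : S2 (weak_gradient Omega u i) by exact: wg_sqint wu.
  rewrite energyE// -[RHS]/(energy _ _) energyE//; apply: eq_bigr => i _.
  apply: ae_eq_Rintegral => //.
  - apply: measurable_funM; last exact: sqint_meas (sPhi i).
    exact: sqint_meas (sqint_a (sU i)).
  - apply: measurable_funM; last exact: sqint_meas (sW i).
    exact: sqint_meas (sqint_a (sU i)).
  - by apply: filterS (ae1 i) => x hx Ox; rewrite hx.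
have hu : H1 Omega u by apply/H1P; exists U.
split=> //; first by apply/(has_traceP oOmega bOmega h su wu).
move=> phi h10; have hphi := H10_weak_gradient oOmega bOmega h10.
have [sfp e] := eU _ _ hphi; split=> //; rewrite -[RHS]e -[LHS]/(energy _ _).
have [_ sW _] := hphi; have ww := H1_weak_gradient hu.
have sU i : S2 (U i) by exact: wg_sqint wu.
have sV i : S2 (weak_gradient Omega u i) by exact: wg_sqint ww.
have ae1 : forall i, {ae mu, forall x, Omega x -> weak_gradient Omega u i x = U i x}.
  by apply: (wg_unique oOmega bOmega su su _ ww wu); exact: aeW.
rewrite !energyE//; apply: eq_bigr => i _; apply: ae_eq_Rintegral => //.
- apply: measurable_funM; last exact: sqint_meas (sW i).
  exact: sqint_meas (sqint_a (sV i)).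
- apply: measurable_funM; last exact: sqint_meas (sW i).
  exact: sqint_meas (sqint_a (sU i)).
- by apply: filterS (ae1 i) => x hx Ox; rewrite hx.
Qed.

Section existence.
Variables (p : fn) (P : R) (f0 : fn) (F0 : 'I_n.+1 -> fn).
Hypotheses (mp : measurable_fun Omega p)
  (pP : {ae mu, forall x, Omega x -> 0 <= p x <= P})
  (sf0 : S2 f0) (sF0 : forall i, S2 (F0 i)).

Notation E := (fn * ('I_n.+1 -> fn))%type.

Definition pair_lin (r : R) (z z' : E) : E :=
  ((fun x => r * z.1 x + z'.1 x), (fun i x => r * z.2 i x + z'.2 i x)).

Definition H0_pairs : set E := [set z | H0 Omega z.1 z.2].

Definition lhs_form (z z' : E) :=
  energy z.2 z'.2 + \int[mu]_(x in Omega) ((p x * z.1 x) * z'.1 x).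

Definition rhs_form (z : E) :=
  \sum_i \int[mu]_(x in Omega) (F0 i x * z.2 i x) + \int[mu]_(x in Omega) (f0 x * z.1 x).

Notation lin := pair_lin.
Notation D := H0_pairs.
Notation B := lhs_form.
Notation L := rhs_form.

Let pabs : {ae mu, forall x, Omega x -> `|p x| <= P}.
Proof. by apply: filterS pP => x h /h /andP[? ?]; rewrite ger0_norm. Qed.

Let sqint_p u : S2 u -> S2 (fun x => p x * u x).
Proof. by apply: (sqint_bmul mO mp); exact: pabs. Qed.

Let pquad_ge0 u : S2 u -> 0 <= \int[mu]_(x in Omega) ((p x * u x) * u x).
Proof.
move=> su; have -> : 0 = \int[mu]_(x in Omega) (0 * 0 : R).
  by under eq_Rintegral do rewrite mulr0; rewrite Rintegral_cst ?mul0r.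
apply: ae_le_Rintegral => //.
- by apply: (@summable_bounded _ _ _ _ _ mO muO _ 0) => //; apply: aeW => x _; rewrite mulr0 normr0.
- exact: (sqint_mul mO (sqint_p su) su).
- by apply: filterS pP => x h /h /andP[h1 _]; rewrite mulr0 -mulrA -expr2 mulr_ge0// sqr_ge0.
Qed.

Let pquad_le u : S2 u -> \int[mu]_(x in Omega) ((p x * u x) * u x) <= P * N u.
Proof.
move=> su; have s1 := ((sqintP mu Omega u).1 su).2.
rewrite /nrm2 -RintegralZl//; apply: ae_le_Rintegral => //.
- exact: (sqint_mul mO (sqint_p su) su).
- exact: (summableZ mO).
- by apply: filterS pP => x h /h /andP[_ h1]; rewrite -mulrA -expr2 ler_wpM2r// sqr_ge0.
Qed.

Let int_lin (r : R) (u v w : fn) : S2 u -> S2 v -> S2 w ->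
  \int[mu]_(x in Omega) ((r * u x + v x) * w x) =
  r * \int[mu]_(x in Omega) (u x * w x) + \int[mu]_(x in Omega) (v x * w x).
Proof.
move=> su sv sw; have s1 := sqint_mul mO su sw; have s2 := sqint_mul mO sv sw.
rewrite -RintegralZl// -RintegralD//; last exact: (summableZ mO).
by apply: eq_Rintegral => x _; ring.
Qed.

Let D_lin r (u v : E) : D u -> D v -> D (lin r u v).
Proof. by move=> Du Dv; apply: H0D => //; exact: H0Z. Qed.

(** The representation theorem on the pairs of [H0]. Poincare's inequality makes the form control
    both components of a pair in L^2, which gives completeness and, through Young's inequality, the
    lower bound of the quadratic functional. *)
Lemma linear_existence : exists w W, H0 Omega w W /\ forall phi Phi, H0 Omega phi Phi ->
  energy W Phi + \int[mu]_(x in Omega) ((p x * w x) * phi x) =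
  \sum_i \int[mu]_(x in Omega) (F0 i x * Phi i x) + \int[mu]_(x in Omega) (f0 x * phi x).
Proof.
have [C C0 hC] := poincare oOmega bOmega.
(* Poincare's inequality gives e (N u + sum N (U i)) <= K0 sum N (U i), so the energy absorbs the
   terms that Young's inequality produces. *)
pose e := K0 / (1 + C); have e0 : 0 < e by rewrite divr_gt0// addr_gt0.
pose M := (\sum_i N (F0 i) + N f0) / e.
suff [z Dz hz] : exists2 z, D z & forall y, D y -> B z y = L y.
  by exists z.1, z.2; split=> // phi Phi hphi; have := hz (phi, Phi) hphi.
apply: (@riesz R E lin D B L M) => //.
- move=> r u v w [su sU _] [sv sV _] [sw sW _]; rewrite /lhs_form /= energy_lin//.
  under eq_Rintegral do rewrite mulrDr mulrCA.
  by rewrite int_lin ?mulrDr//; [rewrite addrACA|exact: sqint_p..].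
- move=> u v _ _; rewrite /lhs_form energy_sym; congr (_ + _).
  by apply: eq_Rintegral => x _; ring.
- move=> u [su sU _]; rewrite addr_ge0 ?pquad_ge0//.
  apply: le_trans (energy_ge sU); apply: mulr_ge0; first exact: ltW.
  by apply: sumr_ge0 => i _; exact: nrm2_ge0.
- move=> r u v [su sU _] [sv sV _]; rewrite /rhs_form /= mulrDr mulr_sumr addrACA -big_split/=.
  congr (_ + _).
    apply: eq_bigr => i _; under eq_Rintegral do rewrite mulrC.
    by rewrite int_lin//; congr (_ * _ + _); apply: eq_Rintegral => x _; rewrite mulrC.
  under eq_Rintegral do rewrite mulrC.
  by rewrite int_lin//; congr (_ * _ + _); apply: eq_Rintegral => x _; rewrite mulrC.
- move=> u hu; have [su sU _] := hu; rewrite /lhs_form /rhs_form /M.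
  have h1 := energy_ge sU; have h2 := pquad_ge0 su; have h3 := hC _ _ hu.
  have h4 : 2 * \sum_i \int[mu]_(x in Omega) (F0 i x * u.2 i x) <=
      (\sum_i N (F0 i)) / e + e * \sum_i N (u.2 i).
    rewrite mulr_suml !mulr_sumr -big_split/=; apply: ler_sum => i _; exact: young.
  have h5 := young e0 sf0 su.
  have h6 : e * (N u.1 + \sum_i N (u.2 i)) <= K0 * \sum_i N (u.2 i).
    have : e * (N u.1 + \sum_i N (u.2 i)) <= e * ((1 + C) * \sum_i N (u.2 i)).
      by rewrite ler_wpM2l ?(ltW e0)//; lra.
    by rewrite mulrA /e mulfVK// gt_eqF// addr_gt0.
  rewrite [(_ + N f0) / e]mulrDl; lra.
- move=> u_ Du cau.
  have low z : D z -> N z.1 <= C / K0 * B z z /\ forall i, N (z.2 i) <= K0^-1 * B z z.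
    move=> hz; have [sz sZ _] := hz.
    have h1 := energy_ge sZ; have h2 := pquad_ge0 sz; have h3 := hC _ _ hz.
    have h4 : \sum_i N (z.2 i) <= K0^-1 * B z z by rewrite ler_pdivlMl// /lhs_form; lra.
    split=> [|i].
      by apply: (le_trans h3); rewrite -mulrA ler_wpM2l// ltW.
    apply: le_trans h4; rewrite (bigD1 i)//= lerDl.
    by apply: sumr_ge0 => j _; exact: nrm2_ge0.
  have linN (v v' : fn) : N (fun x => -1 * v x + v' x) = N (fun x => v' x - v x).
    by apply: eq_Rintegral => x _; rewrite mulN1r addrC.
  have cau1 e' : 0 < e' -> exists m0, forall m k, (m0 <= m)%N -> (m0 <= k)%N ->
      N (fun x => (u_ m).1 x - (u_ k).1 x) < e' /\
      forall i, N (fun x => (u_ m).2 i x - (u_ k).2 i x) < e'.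
    move=> e'0; pose q := C / K0 + K0^-1.
    have k1 : 0 < K0^-1 by rewrite invr_gt0.
    have k2 : 0 < C / K0 by rewrite divr_gt0.
    have q0 : 0 < q by rewrite addr_gt0.
    have [m0 hm0] := cau _ (divr_gt0 e'0 q0).
    exists m0 => m k mm mk; have := hm0 k m mk mm; rewrite ltr_pdivlMr// => h.
    have [h1 h2] := low _ (D_lin (-1) (Du k) (Du m)).
    have Bz : 0 <= B (lin (-1) (u_ k) (u_ m)) (lin (-1) (u_ k) (u_ m)).
      by have := le_trans (nrm2_ge0 mu Omega _) h1; rewrite pmulr_rge0.
    split=> [|i].
      by rewrite -linN; apply: (le_lt_trans h1); rewrite /q in h; nra.
    by rewrite -linN; apply: (le_lt_trans (h2 i)); rewrite /q in h; nra.
  have [u su cu] : exists2 u, S2 u & N (fun x => (u_ m).1 x - u x) @[m --> \oo] --> 0.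
    apply: (sqint_complete mO); first by move=> m; have [] := Du m.
    by move=> e' /cau1[m0 h]; exists m0 => m k mm mk; have [] := h m k mm mk.
  have /choice[U hU] : forall i, exists U : fn, S2 U /\
      N (fun x => (u_ m).2 i x - U x) @[m --> \oo] --> 0.
    move=> i; have [U sU cU] : exists2 U, S2 U &
        N (fun x => (u_ m).2 i x - U x) @[m --> \oo] --> 0.
      apply: (sqint_complete mO); first by move=> m; have [_ + _] := Du m; exact.
      by move=> e' /cau1[m0 h]; exists m0 => m k mm mk; have [_ +] := h m k mm mk; exact.
    by exists U.
  have sU i : S2 (U i) by have [] := hU i.
  have DU : H0 Omega u U.
    apply: (H0_closed oOmega bOmega) => // e' e'0.
    have [m [h1 h2]] : exists m, N (fun x => (u_ m).1 x - u x) < e' /\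
        forall i, N (fun x => (u_ m).2 i x - U i x) < e'.
      have : \forall m \near \oo, N (fun x => (u_ m).1 x - u x) < e' /\
          forall i, N (fun x => (u_ m).2 i x - U i x) < e'.
        near=> m; split; first by near: m; exact: near_lt cu e'0.
        by near: m; apply: filter_forall => i; apply: near_lt e'0; have [] := hU i.
      by move=> /filter_ex.
    by exists (u_ m).1, (u_ m).2; split=> //; exact: Du.
  exists (u, U) => //.
  have c2 : K1 * \sum_i N (fun x => (u_ m).2 i x - U i x) +
      P * N (fun x => (u_ m).1 x - u x) @[m --> \oo] --> 0.
    have e3 : K1 * 0 + P * 0 = 0 by rewrite !mulr0 addr0.
    rewrite -[X in _ --> X]e3.
    apply: cvgD; apply: cvgM => //; try exact: cvg_cst.
    by apply: cvg_sum0 => i; have [] := hU i.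
  apply: cvg_ge0_le c2 => m; have Dz := @D_lin (-1) (u_ m) (u, U) (Du m) DU.
  have [sz sZ _] := Dz.
  apply/andP; split.
    rewrite addr_ge0 ?pquad_ge0//; apply: le_trans (energy_ge sZ).
    by apply: mulr_ge0; [exact: ltW|apply: sumr_ge0 => i _; exact: nrm2_ge0].
  apply: lerD.
    apply: (le_trans (energy_le sZ)); rewrite le_eqVlt; apply/orP; left; apply/eqP.
    congr (_ * _); apply: eq_bigr => i _; rewrite linN.
    by apply: eq_Rintegral => x _; rewrite -sqrrN opprB.
  apply: (le_trans (pquad_le sz)); rewrite le_eqVlt; apply/orP; left; apply/eqP.
  by congr (_ * _); rewrite linN; apply: eq_Rintegral => x _; rewrite -sqrrN opprB.
- by exists (cst 0, fun _ => cst 0); exact: H0_cst0.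
Unshelve. all: by end_near. Qed.

End existence.

End linear_problem.

(** * The monotone iteration *)

Section monotone_iteration.
Variables (R : realType) (n : nat) (Omega : set 'rV[R]_n.+1).
Hypotheses (oOmega : open Omega) (bOmega : bounded_set Omega) (cb : C2_boundary Omega).
Notation mu := (leb_rV R n.+1).
Notation fn := ('rV[R]_n.+1 -> R).
Implicit Types (u v w phi f s t : fn) (G H U V Phi : 'I_n.+1 -> fn) (i : 'I_n.+1).
Let mO : measurable Omega. Proof. exact: mOmega oOmega. Qed.
Let muO : (mu Omega < +oo)%E. Proof. exact: muOmega oOmega bOmega. Qed.

Notation S2 := (sqint mu Omega).
Notation N := (nrm2 mu Omega).
Notation wg := (is_weak_gradient Omega).

Variables (a : fn) (K0 K1 : R).
Hypotheses (K00 : 0 < K0) (ma : measurable_fun Omega a)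
  (aK : forall x, Omega x -> K0 <= a x <= K1).
Notation energy := (energy Omega a).
Notation weak_eq := (weak_eq Omega a).
Let sqint_a u : S2 u -> S2 (fun x => a x * u x).
Proof. exact: (sqint_a oOmega K00 ma aK). Qed.

Variables (h : fn) (Gh : 'I_n.+1 -> fn).
Hypothesis hGh : C1cl Omega h Gh.

Let sh : S2 h. Proof. by have [] := C1cl_sqint oOmega bOmega hGh. Qed.
Let sGh i : S2 (Gh i). Proof. by have [_] := C1cl_sqint oOmega bOmega hGh. Qed.

(** The datum [h] is of class C^1 up to the boundary and has itself as trace; the difference u - h
    has zero trace and so belongs to [H0]. *)
Lemma tracesP u U : S2 u -> (forall i, S2 (U i)) ->
  traces Omega u U h <-> H0 Omega (fun x => u x - h x) (fun i x => U i x - Gh i x).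
Proof.
move=> su sU; split=> [tu|hu].
  apply: (traces0_H0 oOmega bOmega cb); [exact: sqintB|by move=> i; exact: sqintB|].
  have th := traces_H0D hGh (H0_cst0 oOmega bOmega).
  apply: (traces_sub oOmega bOmega _ su sh sU sGh tu); first by have [] := hGh.
  move: th; congr traces; first by apply/funext => x; rewrite addr0.
  by apply/funext => i; apply/funext => x; rewrite addr0.
have := traces_H0D hGh hu; congr traces; first by apply/funext => x; rewrite addrC subrK.
by apply/funext => i; apply/funext => x; rewrite addrC subrK.
Qed.

Lemma Rintegral_ge0_ae f : measurable_fun Omega f -> summable mu Omega f ->
  {ae mu, forall x, Omega x -> 0 <= f x} -> 0 <= \int[mu]_(x in Omega) f x.
Proof.
move=> mf sf f0; have -> : 0 = \int[mu]_(x in Omega) (0 * 0 : R).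
  by under eq_Rintegral do rewrite mulr0; rewrite Rintegral_cst ?mul0r.
apply: ae_le_Rintegral => //.
- by apply: (@summable_bounded _ _ _ _ _ mO muO _ 0) => //; apply: aeW => x _; rewrite mulr0 normr0.
- by apply: filterS f0 => x fx Ox; rewrite mulr0 fx.
Qed.

(** From 0 <= F' <= 1 follows F'^2 <= F', so the tested energy a F' |U|^2 dominates K0 |F' U|^2. *)
Lemma truncated_energy (F' : R -> R) u U : continuous F' -> (forall r, 0 <= F' r <= 1) ->
  S2 u -> (forall i, S2 (U i)) ->
  K0 * \sum_i N (fun x => F' (u x) * U i x) <= energy U (fun i x => F' (u x) * U i x).
Proof.
move=> cF' F01 su sU.
have mF : measurable_fun Omega (fun x => F' (u x)).
  by apply: measurableT_comp; [exact: continuous_measurable_fun|exact: sqint_meas su].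
have sF i : S2 (fun x => F' (u x) * U i x).
  apply: (sqint_bmul mO mF (M := 1)) => //.
  by apply: aeW => x _; have /andP[? ?] := F01 (u x); rewrite ger0_norm.
rewrite (energyE oOmega K00 ma aK)// mulr_sumr; apply: ler_sum => i _.
have s1 := ((sqintP mu Omega _).1 (sF i)).2.
rewrite /nrm2 -RintegralZl//; apply: le_Rintegral => //.
- exact: (summableZ mO).
- exact: (sqint_mul mO (sqint_a (sU i)) (sF i)).
- move=> x /aK /andP[k _]; have /andP[f0 f1] := F01 (u x).
  move: (F' (u x)) (U i x) (a x) f0 f1 k => r y z r0 r1 kz.
  have -> : z * y * (r * y) = z * (r * y ^+ 2) by ring.
  have -> : K0 * (r * y) ^+ 2 = K0 * (r * (r * y ^+ 2)) by ring.
  have ry : 0 <= r * y ^+ 2 by rewrite mulr_ge0// sqr_ge0.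
  apply: ler_pM => //; [exact: ltW|by rewrite mulr_ge0|].
  by rewrite ler_piMl.
Qed.

(** F(u) is an admissible test function because F(h) = 0 on the boundary. The energy it produces is
    nonnegative while the right-hand side is nonpositive, so the gradient of F(u) vanishes, and F(u)
    with it by Poincare's inequality. *)
Lemma comparison (F F' : R -> R) (L : R) u U f :
  (forall r : R, is_derive r (1 : R) F (F' r)) -> (forall r, 0 <= F' r <= 1) ->
  (forall r r', `|F' r - F' r'| <= L * `|r - r'|) ->
  (forall x, boundary Omega x -> F (h x) = 0) ->
  S2 u -> (forall i, S2 (U i)) -> traces Omega u U h -> weak_eq U f ->
  {ae mu, forall x, Omega x -> 0 <= f x * F (u x)} ->
  {ae mu, forall x, Omega x -> F (u x) = 0}.
Proof.
move=> dF F01 FL Fh su sU tu eU fF.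
have FM r : `|F' r| <= 1 by have /andP[? ?] := F01 r; rewrite ger0_norm.
have cF' := chain_continuous_deriv FL.
have sFu := chain_sqint oOmega bOmega dF FM su.
have sFU i := chain_sqint_deriv oOmega FM FL su (sU i).
have hF : H0 Omega (fun x => F (u x)) (fun i x => F' (u x) * U i x).
  apply: (traces0_H0 oOmega bOmega cb) => //.
  by apply: (traces_comp oOmega bOmega dF FM FL _ Fh) => //; have [] := hGh.
have [sf e] := eU _ _ hF.
have e1 := truncated_energy cF' F01 su sU.
have e2 := Rintegral_ge0_ae (summable_meas sf) sf fF.
have [C C0 hC] := poincare oOmega bOmega.
apply: nrm2_eq0 => //; apply: (le_trans (hC _ _ hF)).
have : \sum_i N (fun x => F' (u x) * U i x) <= 0.
  by rewrite -(pmulr_rle0 _ K00); move: e1; rewrite e; lra.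
by move=> ?; rewrite pmulr_rle0.
Qed.

Lemma energy_difference u v U V f f' : (forall i, S2 (U i)) -> (forall i, S2 (V i)) ->
  H0 Omega (fun x => u x - v x) (fun i x => U i x - V i x) -> weak_eq U f -> weak_eq V f' ->
  summable mu Omega (fun x => (f x - f' x) * (u x - v x)) /\
  energy (fun i x => U i x - V i x) (fun i x => U i x - V i x) =
  - \int[mu]_(x in Omega) ((f x - f' x) * (u x - v x)).
Proof.
move=> sU sV huv eU eV; have [s1 e1] := eU _ _ huv; have [s2 e2] := eV _ _ huv.
have [_ sW _] := huv.
have fE : (fun x => (f x - f' x) * (u x - v x)) =
    fun x => f x * (u x - v x) - f' x * (u x - v x).
  by apply/funext => x; rewrite mulrBl.
split; first by rewrite fE; exact: summableB.
by rewrite (energyB oOmega K00 ma aK)// e1 e2 fE RintegralB//; ring.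
Qed.

Lemma energy_eq0 w W : H0 Omega w W -> energy W W <= 0 ->
  {ae mu, forall x, Omega x -> w x = 0}.
Proof.
move=> hw e; have [sw sW _] := hw; have [C C0 hC] := poincare oOmega bOmega.
have e1 := energy_ge oOmega K00 ma aK sW.
apply: nrm2_eq0 => //; apply: (le_trans (hC _ _ hw)).
by rewrite pmulr_rle0// -(pmulr_rle0 _ K00); exact: le_trans e.
Qed.

(** Testing the difference of the equations with u - v makes its energy nonpositive. *)
Lemma weak_eq_unique u v U V f f' : (forall i, S2 (U i)) -> (forall i, S2 (V i)) ->
  H0 Omega (fun x => u x - v x) (fun i x => U i x - V i x) -> weak_eq U f -> weak_eq V f' ->
  {ae mu, forall x, Omega x -> 0 <= (f x - f' x) * (u x - v x)} ->
  {ae mu, forall x, Omega x -> u x = v x}.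
Proof.
move=> sU sV huv eU eV fm; have [s e] := energy_difference sU sV huv eU eV.
have i0 := Rintegral_ge0_ae (summable_meas s) s fm.
have h0 : energy (fun i x => U i x - V i x) (fun i x => U i x - V i x) <= 0.
  by rewrite e oppr_le0.
by apply: filterS (energy_eq0 huv h0) => x hx /hx /eqP; rewrite subr_eq0 => /eqP.
Qed.

Lemma weak_eq_ae U f f' : measurable_fun Omega f' ->
  {ae mu, forall x, Omega x -> f x = f' x} -> weak_eq U f -> weak_eq U f'.
Proof.
move=> mf' ff' eU phi Phi hphi; have [s e] := eU _ _ hphi; have [sphi _ _] := hphi.
have mf'phi : measurable_fun Omega (fun x => f' x * phi x).
  by apply: measurable_funM => //; exact: sqint_meas sphi.
have ae1 : {ae mu, forall x, Omega x -> f x * phi x = f' x * phi x}.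
  by apply: filterS ff' => x hx Ox; rewrite hx.
split; last by rewrite e; congr (- _); apply: ae_eq_Rintegral => //; exact: summable_meas s.
apply: (summable_le mO mf'phi (g := fun x => `|f x * phi x|)).
  apply: (summable_le mO _ (g := fun x => `|f x * phi x|)).
  - by apply: measurableT_comp => //; exact: summable_meas s.
  - by have := integrable_abse s; apply: eq_integrable => // x _ /=.
  - by apply: aeW => x _; rewrite normr_id.
by apply: filterS ae1 => x hx Ox; rewrite hx.
Qed.

Variables (b c : fn) (Bm Cm nu M : R) (kappa : R -> R).
Hypotheses (mb : measurable_fun Omega b)
  (bB : {ae mu, forall x, Omega x -> 0 <= b x <= Bm})
  (mc : measurable_fun Omega c)
  (cC : {ae mu, forall x, Omega x -> 0 <= c x <= Cm})
  (nu0 : 0 <= nu) (M0 : 0 <= M)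
  (kappa_lip : forall r r', `|kappa r - kappa r'| <= nu * `|r - r'|)
  (kappaM : forall r, 0 <= kappa r <= nu * M)
  (ckappa : continuous kappa)
  (hM : forall x, boundary Omega x -> 0 <= h x <= M).

Notation p := (fun x => b x + c x * nu).

(** The right-hand side of the step from [v] to [u]. With kappa t = nu t - t^q and v = u the terms
    in nu cancel, leaving b u + c u^q. *)
Definition source v u : fn := fun x => p x * u x - c x * kappa (v x).

Definition solves v u U : Prop :=
  [/\ S2 u, (forall i, S2 (U i)), wg u U,
      H0 Omega (fun x => u x - h x) (fun i x => U i x - Gh i x) & weak_eq U (source v u)].

Let Q : R := `|Bm| + `|Cm| * nu.
Let mp : measurable_fun Omega p.
Proof. by apply: measurable_funD => //; exact: measurable_funM. Qed.
Let pQ : {ae mu, forall x, Omega x -> 0 <= p x <= Q}.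
Proof.
apply: filterS2 bB cC => x h1 h2 Ox; have /andP[b0 b1] := h1 Ox; have /andP[c0 c1] := h2 Ox.
rewrite addr_ge0 ?mulr_ge0//= /Q lerD//; first exact: le_trans (ler_norm _).
by rewrite ler_wpM2r//; exact: le_trans (ler_norm _).
Qed.
Let pabs : {ae mu, forall x, Omega x -> `|p x| <= Q}.
Proof. by apply: filterS pQ => x hx /hx /andP[? ?]; rewrite ger0_norm. Qed.
Let cabs : {ae mu, forall x, Omega x -> `|c x| <= Cm}.
Proof. by apply: filterS cC => x hx /hx /andP[? ?]; rewrite ger0_norm. Qed.

Let mkappa v : measurable_fun Omega v -> measurable_fun Omega (fun x => kappa (v x)).
Proof. by move=> mv; apply: measurableT_comp => //; exact: continuous_measurable_fun. Qed.

Lemma sqint_ckappa v : measurable_fun Omega v -> S2 (fun x => c x * kappa (v x)).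
Proof.
move=> mv; apply: (sqint_bmul mO mc cabs); apply: (@sqint_bounded _ _ _ _ _ mO muO _ (nu * M)).
  exact: mkappa.
by apply: aeW => x _; have /andP[? ?] := kappaM (v x); rewrite ger0_norm.
Qed.

Lemma sqint_source v u : measurable_fun Omega v -> S2 u -> S2 (source v u).
Proof.
by move=> mv su; apply: sqintB => //; [exact: (sqint_bmul mO mp pabs)|exact: sqint_ckappa].
Qed.

(** The solution is sought as h + w with w in [H0]; the contributions of [h] move to the right-hand
    side, with - a grad h as vector datum. *)
Lemma solve_exists v : S2 v -> exists u U, solves v u U.
Proof.
move=> sv; have mv := sqint_meas sv.
have sph := sqint_bmul mO mp pabs sh.
have sck := sqint_ckappa mv.
have saG i := sqintN mO (sqint_a (sGh i)).
have [w [W [hw ew]]] := linear_existence oOmega bOmega K00 ma aK mp pQ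
  (sqintB mO sck sph) saG.
have [sw sW _] := hw; have wgw := H0_wg oOmega bOmega hw.
exists (fun x => h x + w x), (fun i x => Gh i x + W i x); split.
- exact: sqintD.
- by move=> i; exact: sqintD.
- by apply: (wgD oOmega bOmega) => //; exact: (C1cl_wg oOmega bOmega).
- move: hw; congr H0; first by apply/funext => x; rewrite addrAC subrr add0r.
  by apply/funext => i; apply/funext => x; rewrite addrAC subrr add0r.
- move=> phi Phi hphi; have [sphi sPhi _] := hphi.
  have ssrc : S2 (source v (fun x => h x + w x)) by apply: sqint_source => //; exact: sqintD.
  split; first exact: sqint_mul.
  have := ew _ _ hphi.
  have -> : (fun i x => Gh i x + W i x) = (fun i x => 1 * Gh i x + W i x).
    by apply/funext => i; apply/funext => x; rewrite mul1r.
  rewrite (energy_lin oOmega K00 ma aK)// mul1r.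
  have -> : \sum_i \int[mu]_(x in Omega) (- (a x * Gh i x) * Phi i x) = - energy Gh Phi.
    rewrite (energyE oOmega K00 ma aK)// -sumrN; apply: eq_bigr => i _.
    rewrite -RintegralN//; last exact: (sqint_mul mO (sqint_a (sGh i)) (sPhi i)).
    by apply: eq_Rintegral => x _; rewrite mulNr.
  have -> : \int[mu]_(x in Omega) (source v (fun x => h x + w x) x * phi x) =
      \int[mu]_(x in Omega) (p x * w x * phi x) -
      \int[mu]_(x in Omega) ((c x * kappa (v x) - p x * h x) * phi x).
    rewrite -RintegralB//; last 2 first.
    - exact: (sqint_mul mO (sqint_bmul mO mp pabs sw) sphi).
    - exact: (sqint_mul mO (sqintB mO sck sph) sphi).
    by apply: eq_Rintegral => x _; rewrite /source; ring.
  by move=> e; lra.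
Qed.

Lemma solves_traces v u U : solves v u U -> traces Omega u U h.
Proof. by move=> [su sU _ hu _]; apply/tracesP. Qed.

(** The truncation is nonzero only where u < 0. There the source is nonpositive, since kappa >= 0,
    and so is the truncation; their product is nonnegative, as comparison requires. *)
Lemma solves_ge0 v u U : solves v u U -> {ae mu, forall x, Omega x -> 0 <= u x}.
Proof.
move=> su; have tu := solves_traces su; have [s1 s2 _ _ e] := su.
pose F (r : R) := - bump (- r); pose F' (r : R) := dbump (- r).
have dF (r : R) : is_derive r (1 : R) F (F' r).
  have d1 := is_derive_subr (is_derive_cstr 0 r (1 : R)) (is_derive_idr r).
  have d2 := is_derive_comp_real d1 (is_derive_bump (0 - r)).
  have d3 := is_derive_subr (is_derive_cstr 0 r (1 : R)) d2.
  have -> : F = fun y => 0 - (@bump R \o (fun y => 0 - y)) y.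
    by apply/funext => y; rewrite /F /= !sub0r.
  by apply: is_derive_eq d3 _; rewrite /F' !sub0r mulrN1 opprK.
have F01 r : 0 <= F' r <= 1 by rewrite /F' dbump_ge0 dbump_le1.
have FL (r r' : R) : `|F' r - F' r'| <= 4 * `|r - r'|.
  by apply: (le_trans (dbump_lip _ _)); rewrite -opprD normrN.
have Fh x : boundary Omega x -> F (h x) = 0.
  by move=> /hM /andP[h0 _]; rewrite /F bump_le0 ?oppr0// oppr_le0.
have cmp : {ae mu, forall x, Omega x -> F (u x) = 0}.
  apply: (comparison dF F01 FL Fh s1 s2 tu e).
  apply: filterS2 pQ cC => x h1 h2 Ox; have /andP[p0 _] := h1 Ox; have /andP[c0 _] := h2 Ox.
  rewrite /F mulrN oppr_ge0; have [u0|u0] := leP 0 (u x).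
    by rewrite bump_le0 ?mulr0// oppr_le0.
  apply: mulr_le0_ge0; last exact: bump_ge0.
  have /andP[k0 _] := kappaM (v x); rewrite /source subr_le0.
  apply: (@le_trans _ _ 0); last exact: mulr_ge0.
  by rewrite mulr_ge0_le0// ltW.
apply: filterS cmp => x hx Ox; rewrite leNgt; apply/negP => u0; have := hx Ox; rewrite /F => /eqP.
by rewrite oppr_eq0 gt_eqF// bump_gt0// oppr_gt0.
Qed.

(** Where u > M, the bound kappa <= nu M gives c kappa (v) <= c nu u, so the source is at least b u
    >= 0. *)
Lemma solves_le v u U : solves v u U -> {ae mu, forall x, Omega x -> u x <= M}.
Proof.
move=> su; have tu := solves_traces su; have [s1 s2 _ _ e] := su.
pose F (r : R) := bump (r - M); pose F' (r : R) := dbump (r - M).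
have dF (r : R) : is_derive r (1 : R) F (F' r).
  have d1 := is_derive_subr (is_derive_idr r) (is_derive_cstr M r (1 : R)).
  have d2 := is_derive_comp_real d1 (is_derive_bump (r - M)).
  by apply: is_derive_eq d2 _; rewrite /F' subr0 mulr1.
have F01 r : 0 <= F' r <= 1 by rewrite /F' dbump_ge0 dbump_le1.
have FL (r r' : R) : `|F' r - F' r'| <= 4 * `|r - r'|.
  by apply: (le_trans (dbump_lip _ _)); rewrite opprB addrA subrK.
have Fh x : boundary Omega x -> F (h x) = 0.
  by move=> /hM /andP[_ h1]; rewrite /F bump_le0// subr_le0.
have cmp : {ae mu, forall x, Omega x -> F (u x) = 0}.
  apply: (comparison dF F01 FL Fh s1 s2 tu e).
  apply: filterS2 bB cC => x h1 h2 Ox; have /andP[b0 _] := h1 Ox; have /andP[c0 _] := h2 Ox.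
  rewrite /F; have [u0|u0] := leP (u x) M.
    by rewrite bump_le0 ?mulr0// subr_le0.
  apply: mulr_ge0; last exact: bump_ge0.
  have /andP[_ k1] := kappaM (v x); rewrite /source.
  have h3 : 0 <= b x * u x by rewrite mulr_ge0// ltW// (le_lt_trans M0).
  have h4 : c x * kappa (v x) <= c x * (nu * u x).
    rewrite ler_wpM2l//; apply: (le_trans k1); rewrite ler_wpM2l//; exact: ltW.
  by move: h3 h4; lra.
apply: filterS cmp => x hx Ox; rewrite leNgt; apply/negP => u0; have := hx Ox; rewrite /F => /eqP.
by rewrite gt_eqF// bump_gt0// subr_gt0.
Qed.

Lemma solves_H0B v u U v' u' U' : solves v u U -> solves v' u' U' ->
  H0 Omega (fun x => u x - u' x) (fun i x => U i x - U' i x).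
Proof.
move=> [_ _ _ h1 _] [_ _ _ h2 _]; have := H0B oOmega bOmega h1 h2; congr H0.
  by apply/funext => x; ring.
by apply/funext => i; apply/funext => x; ring.
Qed.

Notation Y w := (\int[mu]_(x in Omega) (c x * nu * w x ^+ 2)).

Let Y_summable w : S2 w -> summable mu Omega (fun x => c x * nu * w x ^+ 2).
Proof.
move=> sw; rewrite (_ : (fun x => _) = fun x => nu * ((c x * w x) * w x)).
  by apply: (summableZ mO); exact: (sqint_mul mO (sqint_bmul mO mc cabs sw) sw).
by apply/funext => x; ring.
Qed.

Let Y_ge0 w : S2 w -> 0 <= Y w.
Proof.
move=> sw; apply: Rintegral_ge0_ae; [exact: summable_meas (Y_summable sw)|exact: Y_summable|].
by apply: filterS cC => x hx /hx /andP[c0 _]; exact: mulr_ge0 (mulr_ge0 c0 nu0) (sqr_ge0 _).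
Qed.

Let Y_le w : S2 w -> Y w <= `|Cm| * nu * N w.
Proof.
move=> sw; have s1 := ((sqintP mu Omega w).1 sw).2.
rewrite /nrm2 -RintegralZl//; apply: ae_le_Rintegral => //.
- exact: Y_summable.
- exact: (summableZ mO).
- apply: filterS cC => x hx /hx /andP[c0 c1]; rewrite ler_wpM2r ?sqr_ge0// ler_wpM2r//.
  exact: le_trans (ler_norm _).
Qed.

(** The Lipschitz bound on kappa and Young's inequality bound the coupling term by half of c nu (v -
    v')^2 plus half of c nu (u - u')^2. The latter is absorbed by the term c nu of the equation, of
    which half is left over; the term in b has the favourable sign. *)
Lemma contraction v u U v' u' U' : S2 v -> S2 v' -> solves v u U -> solves v' u' U' ->
  energy (fun i x => U i x - U' i x) (fun i x => U i x - U' i x) +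
  2^-1 * Y (fun x => u x - u' x) <= 2^-1 * Y (fun x => v x - v' x).
Proof.
move=> sv sv' hu hu'; have hw := solves_H0B hu hu'.
have [su sU _ _ eU] := hu; have [su' sU' _ _ eU'] := hu'.
have [s e] := energy_difference sU sU' hw eU eU'.
have y1 := Y_summable (sqintB mO su su'); have y2 := Y_summable (sqintB mO sv sv').
rewrite e -!RintegralZl// -lerBrDr -RintegralB//; [|exact: (summableZ mO)..].
rewrite -RintegralN//; apply: ae_le_Rintegral => //.
- exact: (summableN mO s).
- by apply: (summableB mO); exact: (summableZ mO).
apply: filterS2 bB cC => x h1 h2 Ox; have /andP[b0 _] := h1 Ox; have /andP[c0 _] := h2 Ox.
rewrite /source; have := kappa_lip (v x) (v' x).
set k := kappa (v x); set k' := kappa (v' x); set w := u x - u' x; set z := v x - v' x => hk.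
have -> : - ((p x * u x - c x * k - (p x * u' x - c x * k')) * w) =
    - (b x * w ^+ 2) - c x * nu * w ^+ 2 + c x * ((k - k') * w) by rewrite /w; ring.
have h3 : (k - k') * w <= nu * (2^-1 * (z ^+ 2 + w ^+ 2)).
  apply: (le_trans (ler_norm _)); rewrite normrM.
  apply: (@le_trans _ _ (nu * `|z| * `|w|)); first by rewrite ler_wpM2r.
  rewrite -mulrA ler_wpM2l//; have := sqr_ge0 (`|z| - `|w|).
  by rewrite -(@real_normK _ z) ?num_real// -(@real_normK _ w) ?num_real//; lra.
have h4 := ler_wpM2l c0 h3; have h5 := mulr_ge0 b0 (sqr_ge0 w).
by lra.
Qed.

(** * Geometric decay of the increments and passage to the limit *)

Section iteration.
Variables (u_ : nat -> fn) (U_ : nat -> 'I_n.+1 -> fn).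
Hypotheses (su0 : S2 (u_ 0%N))
  (u0M : {ae mu, forall x, Omega x -> 0 <= u_ 0%N x <= M})
  (uS : forall k, solves (u_ k) (u_ k.+1) (U_ k.+1)).

Let su k : S2 (u_ k). Proof. by case: k => // k; have [] := uS k. Qed.

Let uM k : {ae mu, forall x, Omega x -> 0 <= u_ k x <= M}.
Proof.
case: k => // k; apply: filterS2 (solves_ge0 (uS k)) (solves_le (uS k)) => x h1 h2 Ox.
by rewrite h1//= h2.
Qed.

Let e_ j k := energy (fun i x => U_ j i x - U_ k i x) (fun i x => U_ j i x - U_ k i x).
Let y_ j k := Y (fun x => u_ j x - u_ k x).

Lemma iteration_cauchy : exists rho A, [/\ 0 <= rho < 1, 0 <= A & forall j k,
  energy (fun i x => U_ (j + k).+1 i x - U_ k.+1 i x)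
    (fun i x => U_ (j + k).+1 i x - U_ k.+1 i x) <= rho ^+ k * A].
Proof.
have [C C0 hC] := poincare oOmega bOmega.
pose D := `|Cm| * nu * C / K0.
have D0 : 0 <= D by rewrite divr_ge0 ?mulr_ge0// ltW.
have yD j k : y_ j.+1 k.+1 <= D * e_ j.+1 k.+1.
  have hw := solves_H0B (uS j) (uS k); have [sw sW _] := hw.
  have h1 := Y_le sw; have h2 := hC _ _ hw; have h3 := energy_ge oOmega K00 ma aK sW.
  apply: (le_trans h1); apply: (@le_trans _ _ (`|Cm| * nu * (C * (K0^-1 * e_ j.+1 k.+1)))).
    rewrite ler_wpM2l ?mulr_ge0//; apply: (le_trans h2); apply: ler_wpM2l; first exact: ltW.
    by rewrite ler_pdivlMl.
  by rewrite /D le_eqVlt; apply/orP; left; apply/eqP; ring.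
have y0 j k : 0 <= y_ j k by exact: Y_ge0 (sqintB mO (su j) (su k)).
have ctr j k : e_ j.+1 k.+1 + 2^-1 * y_ j.+1 k.+1 <= 2^-1 * y_ j k.
  exact: contraction (su j) (su k) (uS j) (uS k).
(* Combining Y <= D X with X + Y / 2 <= Y' / 2 gives Y <= D / (D + 2) Y'. The constant [A] bounds
   Y_(j,0), because both functions take values in [0, M]. *)
pose rho := D / (D + 2); pose A := `|Cm| * nu * (M ^+ 2 * N (cst 1)).
have D2 : 0 < D + 2 by rewrite ltr_wpDl.
have rho0 : 0 <= rho by rewrite divr_ge0// ltW.
have s1 : S2 (cst 1).
  by apply: (@sqint_bounded _ _ _ _ _ mO muO _ 1) => //; apply: aeW => x _; rewrite normr1.
have yA j : y_ j 0%N <= A.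
  apply: (le_trans (Y_le (sqintB mO (su j) (su 0%N)))); rewrite ler_wpM2l ?mulr_ge0//.
  rewrite -nrm2Z//; apply: nrm2_le.
  - exact: mO.
  - exact: sqint_meas (sqintB mO (su j) (su 0%N)).
  - exact: sqintZ.
  - apply: filterS2 (uM j) (uM 0%N) => x h1 h2 Ox.
    have /andP[a0 a1] := h1 Ox; have /andP[b0 b1] := h2 Ox.
    by rewrite mulr1 (ger0_norm M0) ler_norml; apply/andP; split; lra.
(* Both indices decrease together until the pair (j, 0), which is bounded uniformly in j. *)
have yrho j k : y_ (j + k)%N k <= rho ^+ k * A.
  elim: k => [|k IH]; first by rewrite addn0 expr0 mul1r.
  rewrite addnS exprS -mulrA; apply: le_trans (ler_wpM2l rho0 IH).
  rewrite /rho mulrAC ler_pdivlMr//.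
  have := yD (j + k)%N k; have := ctr (j + k)%N k; have := y0 (j + k)%N k.
  have := y0 (j + k).+1 k.+1.
  move: (y_ (j + k).+1 k.+1) (y_ (j + k)%N k) (e_ (j + k).+1 k.+1) => s t r.
  move=> _ _ h1 h2; have h3 := ler_wpM2l D0 h1.
  by move: (D) h2 h3 => q h2 h3; lra.
exists rho, A; split.
- by rewrite rho0/= /rho ltr_pdivrMr// mul1r ltrDl.
- by rewrite /A !mulr_ge0// ?sqr_ge0// nrm2_ge0.
- move=> j k; have := ctr (j + k)%N k; have := yrho j k; have := y0 (j + k).+1 k.+1.
  have := y0 (j + k)%N k; rewrite -/(e_ (j + k).+1 k.+1).
  move: (e_ (j + k).+1 k.+1) (y_ (j + k).+1 k.+1) (y_ (j + k)%N k) (rho ^+ k * A).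
  by move=> q1 q2 q3 q4; lra.
Qed.

Lemma iteration_cvg : exists u U, [/\ solves u u U,
  N (fun x => u_ k x - u x) @[k --> \oo] --> 0 &
  forall i, N (fun x => U_ k.+1 i x - U i x) @[k --> \oo] --> 0].
Proof.
have [rho [A [/andP[rho0 rho1] A0 hE]]] := iteration_cauchy.
have [C C0 hC] := poincare oOmega bOmega.
have sU k i : S2 (U_ k.+1 i) by have [_ + _ _ _] := uS k; exact.
have swap (v v' : fn) : N (fun x => v x - v' x) = N (fun x => v' x - v x).
  by apply: eq_Rintegral => x _; ring.
have K0i : 0 < K0^-1 by rewrite invr_gt0.
have close e : 0 < e -> exists m0, forall j k, (m0 <= k)%N ->
    N (fun x => u_ (j + k).+1 x - u_ k.+1 x) < e /\
    forall i, N (fun x => U_ (j + k).+1 i x - U_ k.+1 i x) < e.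
  move=> e0; pose q := C * K0^-1 + K0^-1.
  have q0 : 0 < q by rewrite addr_gt0// mulr_gt0.
  have c0 : rho ^+ k * (A * q) @[k --> \oo] --> 0.
    rewrite -[X in _ --> X](mul0r (A * q)); apply: cvgM; last exact: cvg_cst.
    by apply: cvg_expr; rewrite ger0_norm.
  have p0 k : 0 <= rho ^+ k * (A * q) by rewrite !mulr_ge0 ?exprn_ge0// ltW.
  have [m0 hm] := (cvg0_ltP p0).1 c0 e e0; exists m0 => j k /hm hk.
  have hw := solves_H0B (uS (j + k)) (uS k); have [sw sW _] := hw.
  have h1 := energy_ge oOmega K00 ma aK sW; have h2 := hC _ _ hw; have h3 := hE j k.
  have h4 : \sum_i N (fun x => U_ (j + k).+1 i x - U_ k.+1 i x) <= K0^-1 * (rho ^+ k * A).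
    by rewrite ler_pdivlMl//; exact: le_trans h3.
  have rA : 0 <= rho ^+ k * A by rewrite mulr_ge0// exprn_ge0.
  have qE : rho ^+ k * (A * q) = C * (K0^-1 * (rho ^+ k * A)) + K0^-1 * (rho ^+ k * A).
    by rewrite /q; ring.
  have t1 : 0 <= K0^-1 * (rho ^+ k * A) by rewrite mulr_ge0// ltW.
  have t2 : 0 <= C * (K0^-1 * (rho ^+ k * A)) by rewrite mulr_ge0// ltW.
  rewrite qE in hk; split=> [|i].
    apply: le_lt_trans h2 _; apply: le_lt_trans (ler_wpM2l (ltW C0) h4) _.
    by apply: le_lt_trans hk; rewrite lerDl.
  apply: (@le_lt_trans _ _ (\sum_i N (fun x => U_ (j + k).+1 i x - U_ k.+1 i x))).
    by rewrite [leRHS](bigD1 i)//= lerDl; apply: sumr_ge0 => l _; exact: nrm2_ge0.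
  by apply: le_lt_trans h4 _; apply: le_lt_trans hk; rewrite lerDr.
have cau (F : nat -> fn) : (forall e, 0 < e -> exists m0, forall j k, (m0 <= k)%N ->
      N (fun x => F (j + k)%N x - F k x) < e) ->
    forall e, 0 < e -> exists m0, forall m k, (m0 <= m)%N -> (m0 <= k)%N ->
      N (fun x => F m x - F k x) < e.
  move=> hF e /hF[m0 hj]; exists m0 => m k mm mk.
  have [km|mk'] := leqP k m; first by rewrite -(subnK km); exact: hj.
  by rewrite swap -(subnK (ltnW mk')); exact: hj.
(* The sequences are shifted by one since the equation relates u_ and U_ from index 1 on. *)
have [u s_u cu] : exists2 u, S2 u & N (fun x => u_ k.+1 x - u x) @[k --> \oo] --> 0.
  apply: (sqint_complete mO (u_ := fun k => u_ k.+1)) => //.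
  by apply: (cau (fun k => u_ k.+1)) => e /close[m0 hj]; exists m0 => j k /(hj j)[].
have /choice[U hU] : forall i, exists U : fn, S2 U /\
    N (fun x => U_ k.+1 i x - U x) @[k --> \oo] --> 0.
  move=> i; have [U ? ?] : exists2 U, S2 U & N (fun x => U_ k.+1 i x - U x) @[k --> \oo] --> 0.
    apply: (sqint_complete mO (u_ := fun k => U_ k.+1 i)) => //.
    by apply: (cau (fun k => U_ k.+1 i)) => e /close[m0 hj]; exists m0 => j k /(hj j)[_ +]; exact.
  by exists U.
have s_U i : S2 (U i) by have [] := hU i.
have cU i : N (fun x => U_ k.+1 i x - U i x) @[k --> \oo] --> 0 by have [] := hU i.
have cu' : N (fun x => u_ k x - u x) @[k --> \oo] --> 0.
  by rewrite -(cvg_shiftS (fun k => N (fun x => u_ k x - u x))).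
exists u, U; split=> //; split=> //.
- apply: (wg_lim oOmega bOmega (u_ := fun k => u_ k.+1) (G_ := fun k => U_ k.+1)) => // k.
  by have [] := uS k.
- apply: (H0_closed oOmega bOmega) => [|i|e e0].
  + exact: sqintB.
  + exact: sqintB.
  + have : \forall k \near \oo, N (fun x => u_ k.+1 x - u x) < e /\
        forall i, N (fun x => U_ k.+1 i x - U i x) < e.
      near=> k; split; first by near: k; exact: near_lt cu e0.
      by near: k; apply: filter_forall => i; exact: near_lt (cU i) e0.
    move=> /filter_ex[k [h1 h2]].
    exists (fun x => u_ k.+1 x - h x), (fun i x => U_ k.+1 i x - Gh i x); split.
    * by have [] := uS k.
    * by move: h1; congr (_ < _); apply: eq_Rintegral => x _; ring.
    * by move=> i; move: (h2 i); congr (_ < _); apply: eq_Rintegral => x _; ring.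
- move=> phi Phi hphi; have [sphi sPhi _] := hphi.
  have ssrc v w : S2 v -> S2 w -> S2 (source v w).
    by move=> sv; apply: sqint_source; exact: sqint_meas sv.
  split; first by apply: sqint_mul => //; exact: ssrc.
  have c1 : energy (U_ k.+1) Phi @[k --> \oo] --> energy U Phi.
    have ci i : \int[mu]_(x in Omega) (U_ k.+1 i x * (a x * Phi i x)) -
        \int[mu]_(x in Omega) (U i x * (a x * Phi i x)) @[k --> \oo] --> 0.
      rewrite -[X in _ --> X](subrr (\int[mu]_(x in Omega) (U i x * (a x * Phi i x)))).
      apply: cvgB; last exact: cvg_cst.
      apply: (cvg_Rintegral_mul mO (u_ := fun k => U_ k.+1 i)) => //; exact: sqint_a.
    have := cvg_sum0 ci; set g := (fun m => _) => cg.
    have -> : (fun k => energy (U_ k.+1) Phi) = fun k => g k + energy U Phi.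
      apply/funext => k; rewrite /g !(energyE oOmega K00 ma aK)// -big_split/=.
      apply: eq_bigr => i _.
      rewrite (_ : \int[mu]_(x in Omega) (a x * U i x * Phi i x) =
        \int[mu]_(x in Omega) (U i x * (a x * Phi i x))); last first.
        by apply: eq_Rintegral => x _; ring.
      by rewrite subrK; apply: eq_Rintegral => x _; ring.
    rewrite -[X in _ --> X](add0r (energy U Phi)); apply: cvgD => //; exact: cvg_cst.
  (* The source is Lipschitz in L^2 in each of its two arguments, so it converges along u_k and
     u_(k+1) together. *)
  have c2 : \int[mu]_(x in Omega) (source (u_ k) (u_ k.+1) x * phi x) @[k --> \oo] -->
      \int[mu]_(x in Omega) (source u u x * phi x).
    apply: (cvg_Rintegral_mul mO (u_ := fun k => source (u_ k) (u_ k.+1))) => //.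
    - by move=> k; exact: ssrc.
    - exact: ssrc.
    have c3 : 2 * (Q ^+ 2 * N (fun x => u_ k.+1 x - u x)) +
        2 * (`|Cm| ^+ 2 * (nu ^+ 2 * N (fun x => u_ k x - u x))) @[k --> \oo] --> 0.
      have e0 : 2 * (Q ^+ 2 * 0) + 2 * (`|Cm| ^+ 2 * (nu ^+ 2 * 0)) = 0 by rewrite !mulr0 addr0.
      rewrite -[X in _ --> X]e0; apply: cvgD; apply: cvgM; try exact: cvg_cst.
        by apply: cvgM => //; exact: cvg_cst.
      by apply: cvgM; [exact: cvg_cst|apply: cvgM => //; exact: cvg_cst].
    apply: cvg_ge0_le c3 => k; rewrite nrm2_ge0/=.
    have sd := sqintB mO (su k.+1) s_u; have sd' := sqintB mO (su k) s_u.
    have mk := measurable_funB (mkappa (sqint_meas (su k))) (mkappa (sqint_meas s_u)).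
    have kd : {ae mu, forall x, Omega x ->
        `|kappa (u_ k x) - kappa (u x)| <= `|nu * (u_ k x - u x)|}.
      by apply: aeW => x _; rewrite normrM (ger0_norm nu0).
    have sk := sqint_le mO mk (sqintZ mO nu sd') kd.
    have cabs' : {ae mu, forall x, Omega x -> `|c x| <= `|Cm|}.
      by apply: filterS cabs => x hx /hx hc; exact: le_trans (ler_norm _).
    have Q0 : 0 <= Q by rewrite addr_ge0 ?mulr_ge0.
    have -> : N (fun x => source (u_ k) (u_ k.+1) x - source u u x) =
        N (fun x => p x * (u_ k.+1 x - u x) - c x * (kappa (u_ k x) - kappa (u x))).
      by apply: eq_Rintegral => x _; rewrite /source; congr (_ ^+ 2); ring.
    apply: le_trans (nrm2B_le mO (sqint_bmul mO mp pabs sd) (sqint_bmul mO mc cabs' sk)) _.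
    apply: lerD; apply: ler_wpM2l => //; first exact: nrm2_bmul.
    apply: le_trans (nrm2_bmul mO mc (normr_ge0 _) cabs' sk) _.
    apply: ler_wpM2l; first exact: sqr_ge0.
    by rewrite -nrm2Z//; apply: nrm2_le => //; exact: sqintZ.
  have c4 : energy (U_ k.+1) Phi @[k --> \oo] -->
      - \int[mu]_(x in Omega) (source u u x * phi x).
    rewrite (_ : (fun k => _) =
      fun k => - \int[mu]_(x in Omega) (source (u_ k) (u_ k.+1) x * phi x)).
      exact: cvgN.
    by apply/funext => k; have [_ _ _ _ /(_ _ _ hphi)[]] := uS k.
  exact: (cvg_unique (@Rhausdorff R) c1 c4).
Unshelve. all: by end_near. Qed.

End iteration.

(* Testing the equation with (1 - u / delta)_+, suitably smoothed, bounds the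
   measure of the zero set of u by that of the set where 0 < u < delta. *)
Lemma strong_positivity (h0 V : R) u U f : 0 < h0 -> 0 <= V ->
  (forall x, boundary Omega x -> h0 <= h x) ->
  S2 u -> (forall i, S2 (U i)) -> traces Omega u U h -> weak_eq U f ->
  {ae mu, forall x, Omega x -> 0 <= u x} ->
  {ae mu, forall x, Omega x -> f x <= V * u x} ->
  {ae mu, forall x, Omega x -> 0 < u x}.
Proof.
move=> h00 V0 hh0 su sU tu eU u0 fV; have mu_ := sqint_meas su.
have [C C0 hC] := poincare oOmega bOmega.
have msub (I : interval R) : measurable (Omega `&` u @^-1` [set` I]).
  by apply: mu_ => //; exact: measurable_itv.
pose Z := Omega `&` u @^-1` [set` `]-oo, (0:R)]].
pose A l := Omega `&` u @^-1` [set` `](0:R), l.+1%:R^-1[].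
have mZ : measurable Z by exact: msub.
have mA l : measurable (A l) by exact: msub.
have s1 : S2 (cst 1).
  by apply: (@sqint_bounded _ _ _ _ _ mO muO _ 1) => //; apply: aeW => x _; rewrite normr1.
(* The squared norm of [\1_B] times 1 is the measure of [B], which is how measures of sets are
   expressed below. *)
have sI B : measurable B -> S2 (fun x => \1_B x * cst 1 x) by move=> mB; exact: sqint_indic.
have cA : N (fun x => \1_(A l) x * cst 1 x) @[l --> \oo] --> 0.
  apply: cvg_nrm2_small => // x Ox; have [ux|ux] := leP (u x) 0.
    by exists 0%N => l _ [_ /=]; rewrite in_itv/= ltNge ux.
  exists (Num.truncn (u x)^-1) => l lt [_ /=]; rewrite in_itv/= ux/=.
  apply/negP; rewrite -leNgt invf_ple ?posrE ?ltr0n//.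
  by apply/ltW/(lt_le_trans (truncnS_gt _)); rewrite ler_nat.
suff bound : \forall l \near \oo, N (fun x => \1_Z x * cst 1 x) <=
    4 * (C * (K0^-1 * (V * N (fun x => \1_(A l) x * cst 1 x)))).
  have cb0 : 4 * (C * (K0^-1 * (V * N (fun x => \1_(A l) x * cst 1 x)))) @[l --> \oo] --> 0.
    have e0 : 4 * (C * (K0^-1 * (V * 0))) = 0 by rewrite !mulr0.
    rewrite -[X in _ --> X]e0; apply: cvgM; first exact: cvg_cst.
    apply: cvgM; first exact: cvg_cst; apply: cvgM; first exact: cvg_cst.
    by apply: cvgM => //; exact: cvg_cst.
  have NZ : N (fun x => \1_Z x * cst 1 x) <= 0.
    rewrite leNgt; apply/negP => N0.
    have [l [b1 b2]] : exists l, N (fun x => \1_Z x * cst 1 x) <=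
        4 * (C * (K0^-1 * (V * N (fun x => \1_(A l) x * cst 1 x)))) /\
        4 * (C * (K0^-1 * (V * N (fun x => \1_(A l) x * cst 1 x)))) < N (fun x => \1_Z x * cst 1 x).
      by apply: (@filter_ex _ \oo); apply: filterI bound _; exact: near_lt cb0 N0.
    by have := le_lt_trans b1 b2; rewrite ltxx.
  apply: filterS (nrm2_eq0 mO (sI _ mZ) NZ) => x hx Ox; rewrite ltNge; apply/negP => ux.
  have := hx Ox; rewrite indicE mem_set ?mul1r/=; last by split=> //=; rewrite in_itv.
  by move/eqP; rewrite oner_eq0.
have dh : \forall l \near \oo, l.+1%:R^-1 < h0.
  exact: near_lt (@cvg_harmonic R) h00.
near=> l; have dh0 : l.+1%:R^-1 < h0 by near: l.
set d : R := l.+1%:R^-1 in dh0 *.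
have d0 : 0 < d by rewrite invr_gt0 ltr0n.
(* A nondecreasing truncation with F' in [0, 1]. It vanishes for r >= d, in particular at the
   boundary values, which exceed h0 > d, and equals - d / 2 at r = 0. *)
pose F (r : R) := - (d * bump (1 - d^-1 * r)); pose F' (r : R) := dbump (1 - d^-1 * r).
have dF (r : R) : is_derive r (1 : R) F (F' r).
  have e1 := is_derive_mulr (is_derive_cstr d^-1 r (1 : R)) (is_derive_idr r).
  have e2 := is_derive_subr (is_derive_cstr 1 r (1 : R)) e1.
  have e3 := is_derive_comp_real e2 (is_derive_bump (1 - d^-1 * r)).
  have e4 := is_derive_mulr (is_derive_cstr (- d) r (1 : R)) e3.
  have -> : F = fun y => - d * (@bump R \o (fun y => 1 - d^-1 * y)) y.
    by apply/funext => y; rewrite /F /= mulNr.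
  by apply: is_derive_eq e4 _; rewrite /F'; field; rewrite gt_eqF.
have F01 r : 0 <= F' r <= 1 by rewrite /F' dbump_ge0 dbump_le1.
have FL (r r' : R) : `|F' r - F' r'| <= (4 * d^-1) * `|r - r'|.
  apply: (le_trans (dbump_lip _ _)).
  have -> : 1 - d^-1 * r - (1 - d^-1 * r') = d^-1 * (r' - r) by ring.
  by rewrite normrM [`|d^-1|]ger0_norm ?invr_ge0 ?(ltW d0)// distrC mulrA.
have Fh x : boundary Omega x -> F (h x) = 0.
  move=> /hh0 hx; rewrite /F bump_le0 ?mulr0 ?oppr0// subr_le0 ler_pdivlMl// mulr1.
  exact: ltW (lt_le_trans dh0 hx).
have FM r : `|F' r| <= 1 by have /andP[? ?] := F01 r; rewrite ger0_norm.
have sFu := chain_sqint oOmega bOmega dF FM su.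
have sFU i := chain_sqint_deriv oOmega FM FL su (sU i).
have hF : H0 Omega (fun x => F (u x)) (fun i x => F' (u x) * U i x).
  apply: (traces0_H0 oOmega bOmega cb) => //.
  by apply: (traces_comp oOmega bOmega dF FM FL _ Fh) => //; have [] := hGh.
have [sf e] := eU _ _ hF.
have e1 := truncated_energy (chain_continuous_deriv FL) F01 su sU.
have e2 : energy U (fun i x => F' (u x) * U i x) <=
    V * (d ^+ 2 * N (fun x => \1_(A l) x * cst 1 x)).
  have sA := ((sqintP mu Omega _).1 (sI _ (mA l))).2.
  rewrite e -(RintegralN mO sf) /nrm2 mulrA -RintegralZl//; apply: ae_le_Rintegral => //.
  - exact: (summableN mO).
  - exact: (summableZ mO).
  apply: filterS2 u0 fV => x h1 h2 Ox; have ux := h1 Ox; have fx := h2 Ox.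
  rewrite /F mulrN opprK; have B0 := bump_ge0 (1 - d^-1 * u x).
  have B1 := ltW (bump_lt1 (1 - d^-1 * u x)).
  have [ud|ud] := leP d (u x).
    have -> : bump (1 - d^-1 * u x) = 0.
      by rewrite bump_le0// subr_le0 ler_pdivlMl// mulr1.
    by rewrite !mulr0 mulr_ge0 ?sqr_ge0// mulr_ge0// sqr_ge0.
  (* On the zero set f <= V u = 0, so the integrand is nonpositive there; only the set where 0 < u <
     d has to be paid for. *)
  have [u00|upos] := eqVneq (u x) 0.
    apply: (@le_trans _ _ 0); last by rewrite mulr_ge0 ?sqr_ge0// mulr_ge0// sqr_ge0.
    apply: mulr_le0_ge0; first by rewrite u00 mulr0 in fx.
    by rewrite mulr_ge0// ltW.
  have -> : \1_(A l) x = 1 :> R.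
    by rewrite indicE mem_set//; split=> //=; rewrite in_itv/= lt_neqAle eq_sym upos ux.
  rewrite mulr1 expr1n mulr1.
  have -> : V * d ^+ 2 = d * (V * d) by ring.
  rewrite mulrCA.
  apply: ler_wpM2l; first exact: ltW.
  apply: (@le_trans _ _ (V * u x * bump (1 - d^-1 * u x))); first exact: ler_wpM2r.
  rewrite -mulrA ler_wpM2l//; apply: (@le_trans _ _ (u x * 1)); first exact: ler_wpM2l.
  by rewrite mulr1 ltW.
have e3 : N (fun x => F (u x)) <= C * (K0^-1 * (V * (d ^+ 2 * N (fun x => \1_(A l) x * cst 1 x)))).
  apply: (le_trans (hC _ _ hF)); apply: ler_wpM2l; first exact: ltW.
  by rewrite ler_pdivlMl//; exact: le_trans e1 e2.
(* On the zero set F(u) = - d / 2, because [bump 1 = 1 / 2]. The factor d^2 also appears in the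
   upper bound and cancels. *)
have e4 : d ^+ 2 * (4^-1 * N (fun x => \1_Z x * cst 1 x)) <= N (fun x => F (u x)).
  have -> : d ^+ 2 * (4^-1 * N (fun x => \1_Z x * cst 1 x)) =
      N (fun x => (d / 2) * (\1_Z x * cst 1 x)).
    by rewrite nrm2Z//; [field|exact: sI].
  apply: nrm2_le => //; first exact: sqint_meas (sqintZ mO (d / 2) (sI _ mZ)).
  apply: filterS u0 => x h1 Ox; have ux := h1 Ox; rewrite mulr1 indicE.
  have [|_] := boolP (x \in Z); last by rewrite mulr0 normr0.
  rewrite inE => -[_ /=]; rewrite in_itv/= => u00.
  have {}u00 : u x = 0 by apply/eqP; rewrite eq_le u00 ux.
  rewrite /F u00 mulr0 subr0 normrN mulr1 /bump /pos2 pos_gt0// expr1n.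
  by have -> : d * (1 / (1 + 1)) = d / 2 by field.
have := le_trans e4 e3; set NZ := N _; set NA := N _.
have -> : C * (K0^-1 * (V * (d ^+ 2 * NA))) = d ^+ 2 * (C * (K0^-1 * (V * NA))) by ring.
rewrite ler_pM2l ?exprn_gt0//; move: (C * _) => s; lra.
Unshelve. all: by end_near. Qed.

End monotone_iteration.

(** * The semilinear problem *)

Section power_nonlinearity.
Variable R : realType.
Implicit Types q r s t M : R.

(** The mean value theorem for s > 0. The case s = 0 is separate, since the derivative of the real
    power is available on positive reals; there t^q <= q t^q suffices. *)
Lemma powR_increment q s t : 1 < q -> 0 <= s <= t ->
  0 <= t `^ q - s `^ q <= q * t `^ (q - 1) * (t - s).
Proof.
move=> q1 /andP[s0 st]; have t0 := le_trans s0 st; have q0 : 0 < q by exact: lt_trans q1.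
apply/andP; split.
  by rewrite subr_ge0; apply: ge0_ler_powR; rewrite ?nnegrE// ltW.
move: s0; rewrite le_eqVlt => /orP[/eqP <-|s0].
  rewrite powR0 ?gt_eqF// !subr0 -mulrA [_ * t]mulrC mulr_powRB1//.
  by rewrite ler_peMl ?powR_ge0// ltW.
have dq (x : R) : 0 < x -> is_derive x (1 : R) (fun y => y `^ q) (q * x `^ (q - 1)).
  exact: is_derive1_powR.
have cq : {within `[s, t], continuous (fun y => y `^ q)}.
  apply: continuous_in_subspaceT => x; rewrite inE/= in_itv/= => /andP[sx _].
  apply/differentiable_continuous/derivable1_diffP.
  by have [] := dq x (lt_le_trans s0 sx).
have dst (x : R) : x \in `]s, t[ -> is_derive x (1 : R) (fun y => y `^ q) (q * x `^ (q - 1)).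
  by rewrite in_itv/= => /andP[sx _]; apply: dq; exact: lt_trans sx.
have [x xst ->] := MVT_segment st dst cq.
move: xst; rewrite in_itv/= => /andP[sx xt].
rewrite ler_wpM2r ?subr_ge0// ler_wpM2l ?(ltW q0)//.
apply: ge0_ler_powR => //; rewrite ?nnegrE//; first by rewrite subr_ge0 ltW.
exact: le_trans (ltW s0) sx.
Qed.

Definition clamp M t := Num.max 0 (Num.min t M).

Lemma clamp_id M t : 0 <= t <= M -> clamp M t = t.
Proof. by move=> /andP[t0 tM]; rewrite /clamp min_l// max_r. Qed.

Lemma clamp_ge0_le M t : 0 <= M -> 0 <= clamp M t <= M.
Proof. by move=> M0; rewrite /clamp le_max lexx/= ge_max M0/= ge_min lexx orbT. Qed.

Lemma clamp_increment M s t : 0 <= M -> s <= t -> 0 <= clamp M t - clamp M s <= t - s.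
Proof.
move=> M0 st; rewrite /clamp; case: (leP t M) => tM; case: (leP s M) => sM.
- by case: (leP 0 t) => ?; case: (leP 0 s) => ?; apply/andP; split; lra.
- by have := lt_le_trans sM (le_trans st tM); rewrite ltxx.
- by case: (leP 0 M) => ?; case: (leP 0 s) => ?; apply/andP; split; lra.
- by apply/andP; split; lra.
Qed.

(* On [0, M] this is nu t - t^q, where nu = q M^(q-1) is the least constant that
   makes it nondecreasing. *)
Definition shifted_power q M t := q * M `^ (q - 1) * clamp M t - clamp M t `^ q.

Lemma shifted_powerE q M t : 0 <= t <= M ->
  shifted_power q M t = q * M `^ (q - 1) * t - t `^ q.
Proof. by move=> tM; rewrite /shifted_power clamp_id. Qed.

(** The clamp is nondecreasing and 1-Lipschitz, which reduces the claim to [0, M], where the slope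
    of t^q is at most q M^(q-1). *)
Lemma shifted_power_increment q M s t : 1 < q -> 0 <= M -> s <= t ->
  0 <= shifted_power q M t - shifted_power q M s <= q * M `^ (q - 1) * (t - s).
Proof.
move=> q1 M0 st; have /andP[c0 c1] := clamp_increment M0 st.
have /andP[s0 sM] := clamp_ge0_le s M0; have /andP[t0 tM] := clamp_ge0_le t M0.
have /andP[p0 p1] : 0 <= clamp M t `^ q - clamp M s `^ q <=
    q * clamp M t `^ (q - 1) * (clamp M t - clamp M s).
  by apply: powR_increment => //; rewrite s0 -subr_ge0.
have q0 : 0 <= q by rewrite ltW// (lt_trans ltr01).
have qM0 : 0 <= q * M `^ (q - 1) by rewrite mulr_ge0// powR_ge0.
have h1 : q * clamp M t `^ (q - 1) * (clamp M t - clamp M s) <=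
    q * M `^ (q - 1) * (clamp M t - clamp M s).
  rewrite ler_wpM2r// ler_wpM2l//.
  by apply: ge0_ler_powR; rewrite ?nnegrE// subr_ge0 ltW.
have h2 := ler_wpM2l qM0 c1.
by rewrite /shifted_power; apply/andP; split; lra.
Qed.

Lemma shifted_power_lip q M s t : 1 < q -> 0 <= M ->
  `|shifted_power q M s - shifted_power q M t| <= q * M `^ (q - 1) * `|s - t|.
Proof.
move=> q1 M0; wlog st : s t / s <= t.
  by move=> h; have [/h//|/ltW/h] := leP s t; rewrite distrC [`|t - s|]distrC.
have /andP[h0 h1] := shifted_power_increment q1 M0 st.
by rewrite distrC ger0_norm// distrC [`|t - s|]ger0_norm// subr_ge0.
Qed.

Lemma shifted_power0 q M : 1 < q -> 0 <= M -> shifted_power q M 0 = 0.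
Proof.
move=> q1 M0; rewrite shifted_powerE ?lexx// mulr0 powR0 ?subrr// gt_eqF//.
exact: lt_trans q1.
Qed.

Lemma shifted_power_bound q M t : 1 < q -> 0 <= M ->
  0 <= shifted_power q M t <= q * M `^ (q - 1) * M.
Proof.
move=> q1 M0; have /andP[t0 tM] := clamp_ge0_le t M0.
have cE : shifted_power q M t = shifted_power q M (clamp M t).
  by rewrite /shifted_power (clamp_id (t := clamp M t)) ?t0.
have := shifted_power_increment q1 M0 t0; rewrite shifted_power0// !subr0 -cE => /andP[h0 h1].
rewrite h0/=; apply: (le_trans h1); rewrite ler_wpM2l// mulr_ge0 ?powR_ge0//.
by rewrite ltW// (lt_trans ltr01).
Qed.

End power_nonlinearity.

(** [F] is required to be continuous only at the values that [u] takes on [A]; this covers real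
    powers of a positive function. *)
Lemma within_continuous_comp_in (R : realType) (T : topologicalType) (A : set T) (u : T -> R)
    (F : R -> R) : {within A, continuous u} -> (forall x, A x -> {for u x, continuous F}) ->
  {within A, continuous (fun x => F (u x))}.
Proof.
move=> cu cF x; rewrite /continuous_at; have cx := cu x.
have [Ax|nAx] := pselect (A x).
  exact: (@continuous_comp (subspace A) _ _ u F x cx (cF x Ax)).
case: _ / (nbhs_subspaceP A x) => // _.
by move=> B /nbhs_singleton //= Bx; rewrite nbhs_simpl => y ->.
Qed.

Lemma C1cl_powR (R : realType) n (Omega : set 'rV[R]_n.+1) g Gg (K r : R) : 0 <= K ->
  (forall x, closure Omega x -> K < g x) -> C1cl Omega g Gg ->
  C1cl Omega (fun x => g x `^ r) (fun i x => r * g x `^ (r - 1) * Gg i x).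
Proof.
move=> K0 gK [cg dg].
have g0 x : closure Omega x -> 0 < g x by move=> /gK; exact: le_lt_trans.
have cp (s : R) x : closure Omega x -> {for g x, continuous (fun t => t `^ s)}.
  move=> /g0 gx; apply/differentiable_continuous/derivable1_diffP.
  by have [] := is_derive1_powR s gx.
split=> [|i]; first by apply: (within_continuous_comp_in (F := fun t => t `^ r) cg) => x; exact: cp.
have [dgi cGi] := dg i; split.
  move=> x Ox; have := is_derive1_powR r (g0 x (subset_closure Ox)).
  by apply: is_derive_comp_real; exact: dgi.
apply: within_continuous_mul => //; apply: within_continuous_mul.
  exact: within_continuous_cst.
by apply: (within_continuous_comp_in (F := fun t => t `^ (r - 1)) cg) => x; exact: cp.
Qed.

Lemma lipschitz_measurable (R : realType) n (Omega : set 'rV[R]_n.+1) (a : 'rV[R]_n.+1 -> R) :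
  open Omega -> [lipschitz a x | x in closure Omega] -> measurable_fun Omega a.
Proof.
move=> oO la; apply: rV_continuous_measurable => //.
apply: within_open_continuous => // x Ox.
have [k k0 hk] : exists2 k : R, 0 < k & k.-lipschitz_(closure Omega) a.
  by have [k [k0 hk]] := pinfty_ex_gt0 la; exists k.
move=> B /nbhs_ballP[e /= e0 he].
have hO : \forall y \near x, Omega y by exact: open_nbhs_nbhs.
have hB : \forall y \near x, ball x (e / k) y by apply: nbhsx_ballx; rewrite divr_gt0.
change (nbhs x (a @^-1` B)).
apply: filterS2 hO hB => y Oy; rewrite -ball_normE /= => xy; apply: he.
have := hk (x, y) (conj (subset_closure Ox) (subset_closure Oy)) => /= h.
rewrite -ball_normE /=.
by apply: (le_lt_trans h); rewrite -ltr_pdivlMl// mulrC.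
Qed.

Section semilinear_problem.
Variables (R : realType) (n : nat) (Omega : set 'rV[R]_n.+1).
Hypotheses (oOmega : open Omega) (bOmega : bounded_set Omega) (cb : C2_boundary Omega).
Notation mu := (leb_rV R n.+1).
Notation fn := ('rV[R]_n.+1 -> R).
Implicit Types (u v w phi f : fn) (G H U V Phi : 'I_n.+1 -> fn) (i : 'I_n.+1).
Let mO : measurable Omega. Proof. exact: mOmega oOmega. Qed.
Let muO : (mu Omega < +oo)%E. Proof. exact: muOmega oOmega bOmega. Qed.

Notation S2 := (sqint mu Omega).
Notation N := (nrm2 mu Omega).

Variables (a b c g : fn) (K0 K1 theta : R).
Hypotheses (K00 : 0 < K0) (K10 : 0 < K1) (ma : measurable_fun Omega a)
  (aK : forall x, Omega x -> K0 <= a x <= K1)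
  (bL : Linfty Omega b) (cL : Linfty Omega c)
  (b0 : {ae mu, forall x, Omega x -> 0 <= b x})
  (c0 : {ae mu, forall x, Omega x -> 0 <= c x})
  (g_C1 : C1_closure Omega g)
  (gK : forall x, closure Omega x -> K0 < g x < K1)
  (theta1 : theta < -1).

Notation h := (bdry_datum g theta).
Notation M := (h_max Omega g theta).
Notation nu := (nu_max Omega g theta).
Notation q := (- theta).
Notation kappa := (shifted_power q M).

Let q1 : 1 < q. Proof. by move: theta1; lra. Qed.

Let nuE : nu = q * M `^ (q - 1).
Proof. by rewrite /nu_max; congr (_ * _ `^ _); ring. Qed.

Let r0 : 2 / (1 + theta) < 0.
Proof. by rewrite nmulr_llt0// invr_lt0; move: theta1; lra. Qed.

(** The exponent is negative, so the power decreases and the upper bound K1 of g becomes a positive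
    lower bound of the datum. *)
Lemma bdry_datum_ge x : closure Omega x -> K1 `^ (2 / (1 + theta)) <= h x.
Proof.
move=> /gK /andP[gK0 gK1]; rewrite /bdry_datum.
have g0 := lt_trans K00 gK0; set r := 2 / _.
have e y : y `^ r = (y `^ (- r))^-1 by rewrite powRN invrK.
rewrite !e lef_pV2 ?posrE ?powR_gt0//.
by apply: ge0_ler_powR; rewrite ?nnegrE ?ltW// oppr_gt0.
Qed.

Let hmin := K1 `^ (2 / (1 + theta)).
Let hmin0 : 0 < hmin. Proof. exact: powR_gt0. Qed.

Lemma bdry_datum_C1cl : exists Gh, C1cl Omega h Gh.
Proof.
have [Gg hg] := (C1_closureP Omega g).1 g_C1.
by eexists; apply: (C1cl_powR _ (ltW K00) _ hg) => x /gK /andP[].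
Qed.

Lemma bdry_datum_le_h_max x : boundary Omega x -> h x <= M.
Proof.
move=> bx; have [Gh [ch _]] := bdry_datum_C1cl.
have [B B0 hB] := compact_image_bounded (compact_closure bOmega) ch.
apply: ub_le_sup; last by exists x.
exists B => _ [y [cy _] <-]; apply: le_trans (hB y cy); exact: ler_norm.
Qed.

Lemma h_max_ge0 : 0 <= M.
Proof.
have [[x bx]|nb] := pselect (boundary Omega !=set0).
  apply: le_trans (bdry_datum_le_h_max bx).
  by apply: le_trans (bdry_datum_ge bx.1); exact: ltW hmin0.
(* The supremum of the empty set is 0 by convention. *)
rewrite /h_max (_ : _ @` _ = set0) ?sup0//.
by apply/seteqP; split=> // t [x bx _]; case: nb; exists x.
Qed.

Let M0 := h_max_ge0.

Let hM x : boundary Omega x -> 0 <= h x <= M.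
Proof.
move=> bx; rewrite bdry_datum_le_h_max// andbT.
by apply: le_trans (bdry_datum_ge bx.1); exact: ltW hmin0.
Qed.

Let nu0 : 0 <= nu.
Proof. by rewrite nuE mulr_ge0 ?powR_ge0// ltW// (lt_trans ltr01 q1). Qed.

Let kappa_lip r r' : `|kappa r - kappa r'| <= nu * `|r - r'|.
Proof. by rewrite nuE; exact: shifted_power_lip. Qed.

Let kappaM r : 0 <= kappa r <= nu * M.
Proof. by rewrite nuE; exact: shifted_power_bound. Qed.

Let ckappa : continuous kappa.
Proof. exact: chain_continuous_deriv kappa_lip. Qed.

Let kappaE t : 0 <= t <= M -> kappa t = nu * t - t `^ q.
Proof. by move=> tM; rewrite nuE shifted_powerE. Qed.

Lemma Linfty_ge0_bounded f : Linfty Omega f -> {ae mu, forall x, Omega x -> 0 <= f x} ->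
  exists B, {ae mu, forall x, Omega x -> 0 <= f x <= B}.
Proof.
move=> [_ [B hB]] f0; exists B; apply: filterS2 hB f0 => x h1 h2 Ox.
by rewrite h2//=; exact: le_trans (ler_norm _) (h1 Ox).
Qed.

Let mb : measurable_fun Omega b. Proof. by case: bL. Qed.
Let mc : measurable_fun Omega c. Proof. by case: cL. Qed.

(** The work left is to match two formulations: the iterates with the unclamped power, and [solves]
    with the clamped one. They have the same right-hand side wherever the previous iterate lies in
    [0, M], a property that propagates from one iterate to the next. *)
Lemma linear_iteration_converges :
  (exists Psi_ : nat -> fn, iterates Omega a b c g theta Psi_ /\
     forall Psi'_, iterates Omega a b c g theta Psi'_ ->
       forall k, ae_equal Omega (Psi'_ k) (Psi_ k)) /\
  exists Psi : fn,
    [/\ positive_weak_solution Omega a b c g theta Psi,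
        forall Psi', positive_weak_solution Omega a b c g theta Psi' -> ae_equal Omega Psi' Psi &
        forall Psi_, iterates Omega a b c g theta Psi_ ->
          (forall k, {ae mu, forall x, Omega x -> 0 <= Psi_ k x}) /\ cvg_H1 Omega Psi_ Psi].
Proof.
have [Gh hGh] := bdry_datum_C1cl.
have [Bm bB] := Linfty_ge0_bounded bL b0.
have [Cm cC] := Linfty_ge0_bounded cL c0.
pose sol := solves Omega a h Gh b c nu kappa.
have sol_ge0 v u U : sol v u U -> {ae mu, forall x, Omega x -> 0 <= u x}.
  exact: (solves_ge0 oOmega bOmega cb K00 ma aK hGh bB cC nu0 kappaM hM).
have sol_le v u U : sol v u U -> {ae mu, forall x, Omega x -> u x <= M}.
  exact: (solves_le oOmega bOmega cb K00 ma aK hGh bB cC nu0 M0 kappaM hM).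
have sol_01 v u U : sol v u U -> {ae mu, forall x, Omega x -> 0 <= u x <= M}.
  move=> hs; apply: filterS2 (sol_ge0 _ _ _ hs) (sol_le _ _ _ hs) => x h1 h2 Ox.
  by rewrite h1//= h2.
have trP u U : S2 u -> (forall i, S2 (U i)) -> traces Omega u U h <->
    H0 Omega (fun x => u x - h x) (fun i x => U i x - Gh i x).
  exact: (tracesP oOmega bOmega cb hGh).
have msource v u : S2 v -> S2 u -> measurable_fun Omega (source b c nu kappa v u).
  move=> sv su; apply: sqint_meas.
  apply: (sqint_source oOmega bOmega mb bB mc cC nu0 kappaM ckappa) => //.
  exact: sqint_meas sv.
have sol_weak v u U f : sol v u U -> S2 v -> measurable_fun Omega f ->
    {ae mu, forall x, Omega x -> source b c nu kappa v u x = f x} ->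
    weak_solution Omega a f h u.
  move=> [su sU wu hu eU] sv mf ff; apply/(weak_solutionP oOmega bOmega K00 ma aK).
  exists U; split=> //; first exact/trP.
  exact: (weak_eq_ae oOmega mf ff eU).
have weak_sol v u f : weak_solution Omega a f h u -> S2 v ->
    {ae mu, forall x, Omega x -> f x = source b c nu kappa v u x} -> exists U, sol v u U.
  move=> /(weak_solutionP oOmega bOmega K00 ma aK)[U [su wu tu eU]] sv ff.
  have sU i : S2 (U i) by exact: wg_sqint wu.
  exists U; split=> //; first exact/trP.
  exact: (weak_eq_ae oOmega (msource _ _ sv su) ff eU).
have s0 : S2 (cst 0).
  by apply: (@sqint_bounded _ _ _ _ _ mO muO _ 0) => //; apply: aeW => x _; rewrite normr0.
(* As [shifted_power] vanishes at 0, the equation of Psi_0 is the step from the zero function. *)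
have source0 u x : source b c nu kappa (cst 0) u x = (b x + c x * nu) * u x.
  by rewrite /source/= shifted_power0// mulr0 subr0.
have sourceS v u x : 0 <= v x <= M -> source b c nu kappa v u x =
    (b x + c x * nu) * u x + c x * (v x `^ q - nu * v x).
  by move=> vM; rewrite /source kappaE//; ring.
have mpow v (s : R) : measurable_fun Omega v -> measurable_fun Omega (fun x => v x `^ s).
  by move=> mv; exact: (measurableT_comp (measurable_powR s) mv).
(* The iterates preceded by the zero function, so that every Psi_k, including Psi_0, is a step from
   its predecessor. *)
pose prev (Psi_ : nat -> fn) k : fn := if k is j.+1 then Psi_ j else cst 0.
have iter_sol Psi_ : iterates Omega a b c g theta Psi_ ->
    exists U_ : nat -> 'I_n.+1 -> fn, forall k, sol (prev Psi_ k) (prev Psi_ k.+1) (U_ k.+1).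
  move=> [h0 hS].
  have key k : S2 (prev Psi_ k) /\ {ae mu, forall x, Omega x -> 0 <= prev Psi_ k x <= M}.
    elim: k => [|k [sk k01]]; first by split=> //; apply: aeW => x _ /=; rewrite lexx.
    suff [U hU] : exists U, sol (prev Psi_ k) (prev Psi_ k.+1) U.
      by split; [have [] := hU|exact: sol_01 hU].
    case: k sk k01 => [|k] sk k01.
      by apply: (weak_sol _ _ _ h0) => //; apply: aeW => x _; rewrite source0.
    apply: (weak_sol _ _ _ (hS k)) => //.
    by apply: filterS k01 => x k01 Ox; rewrite sourceS// k01.
  have /choice[U_ hU] : forall k, exists U, sol (prev Psi_ k) (prev Psi_ k.+1) U.
    case=> [|k].
      by apply: (weak_sol _ _ _ h0) => //; apply: aeW => x _; rewrite source0.
    apply: (weak_sol _ _ _ (hS k)); first by have [] := key k.+1.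
    by apply: filterS (key k.+1).2 => x k01 Ox; rewrite sourceS// k01.
  by exists (fun k => U_ k.-1).
have iter_cvg Psi_ : iterates Omega a b c g theta Psi_ ->
    exists (u : fn) (U : 'I_n.+1 -> fn) (U_ : nat -> 'I_n.+1 -> fn),
      [/\ sol u u U, forall k, sol (prev Psi_ k) (Psi_ k) (U_ k),
      N (fun x => Psi_ k x - u x) @[k --> \oo] --> 0 &
      forall i, N (fun x => U_ k i x - U i x) @[k --> \oo] --> 0].
  move=> /iter_sol[U_ hU].
  have p01 : {ae mu, forall x, Omega x -> 0 <= prev Psi_ 0%N x <= M}.
    by apply: aeW => x _ /=; rewrite lexx.
  have [u [U [h1 h2 h3]]] := iteration_cvg oOmega bOmega cb K00 ma aK hGh mb bB mc cC nu0
    M0 kappa_lip kappaM ckappa hM s0 p01 hU.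
  exists u, U, (fun k => U_ k.+1); split=> //.
  by have := h2; rewrite -(cvg_shiftS (fun k => N (fun x => prev Psi_ k x - u x))).
have iter_unique Psi_ Psi'_ : iterates Omega a b c g theta Psi_ ->
    iterates Omega a b c g theta Psi'_ -> forall k, ae_equal Omega (Psi'_ k) (Psi_ k).
  move=> /iter_sol[U_ hU] /iter_sol[U'_ hU'].
  suff key k : {ae mu, forall x, Omega x -> prev Psi'_ k x = prev Psi_ k x}.
    by move=> k; exact: key k.+1.
  elim: k => [|k IH]; first exact: aeW.
  have [_ s2 _ _ e2] := hU k; have [_ s2' _ _ e2'] := hU' k.
  apply: (weak_eq_unique oOmega bOmega K00 ma aK s2' s2 _ e2' e2).
    exact: (solves_H0B oOmega bOmega (hU' k) (hU k)).
  (* Both steps start from the same value almost everywhere, so the terms in kappa cancel and the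
     sources differ by (b + c nu) (s - s'). *)
  apply: filterS3 IH b0 c0 => x h1 h2 h3 Ox; rewrite /source h1//.
  set t := c x * kappa _; set s := prev Psi'_ k.+1 x; set s' := prev Psi_ k.+1 x.
  have -> : ((b x + c x * nu) * s - t - ((b x + c x * nu) * s' - t)) * (s - s') =
    (b x + c x * nu) * (s - s') ^+ 2 by ring.
  by rewrite mulr_ge0 ?sqr_ge0// addr_ge0 ?h2// mulr_ge0 ?h3.
have iter_exists : exists Psi_, iterates Omega a b c g theta Psi_.
  (* The choice function has to be total; its value at functions outside L^2 is arbitrary. *)
  have /choice[T hT] : forall v : fn, exists z : fn * ('I_n.+1 -> fn), S2 v -> sol v z.1 z.2.
    move=> v; have [sv|nsv] := pselect (S2 v); last by exists (cst 0, fun=> cst 0).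
    have [u [U hU]] := solve_exists oOmega bOmega K00 ma aK hGh mb bB mc cC nu0 kappaM ckappa sv.
    by exists (u, U).
  pose w := fix w k : fn := if k is j.+1 then (T (w j)).1 else (T (cst 0)).1.
  have wsol k : sol (prev w k) (w k) (T (prev w k)).2 /\ S2 (w k).
    elim: k => [|k [IH sk]].
      by have h1 := hT _ s0; split=> //; have [] := h1.
    by have h1 := hT _ sk; split=> //; have [] := h1.
  exists w; split=> [|k].
    apply: (sol_weak _ _ _ _ (wsol 0%N).1) => //.
      apply: measurable_funM; last exact: sqint_meas (wsol 0%N).2.
      by apply: measurable_funD => //; exact: measurable_funM.
    by apply: aeW => x _; rewrite source0.
  have mw j := sqint_meas (wsol j).2.
  apply: (sol_weak _ _ _ _ (wsol k.+1).1); first exact: (wsol k).2.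
    apply: measurable_funD.
      apply: measurable_funM => //.
      by apply: measurable_funD => //; exact: measurable_funM.
    apply: measurable_funM => //; apply: measurable_funB; first exact: mpow.
    exact: measurable_funM.
  by apply: filterS (sol_01 _ _ _ (wsol k).1) => x w01 Ox; rewrite sourceS// w01.
have [Phi_ hPhi] := iter_exists.
split; first by exists Phi_; split=> // Psi'_ /(iter_unique _ _ hPhi).
have powE t : 0 <= t -> `|t| `^ (- (1 + theta)) * t = t `^ q.
  move=> t0; rewrite ger0_norm// mulrC.
  have -> : - (1 + theta) = q - 1 by ring.
  by rewrite mulr_powRB1// (lt_trans ltr01 q1).
pose fsol u : fn := fun x => b x * u x + c x * `|u x| `^ (- (1 + theta)) * u x.
have mfsol u : measurable_fun Omega u -> measurable_fun Omega (fsol u).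
  move=> mu_; apply: measurable_funD; first exact: measurable_funM.
  apply: measurable_funM => //; apply: measurable_funM => //.
  by apply: (@mpow (fun x => `|u x|)); exact: measurableT_comp.
have fsolE u x : 0 <= u x <= M -> source b c nu kappa u u x = fsol u x.
  move=> /[dup] uM /andP[u0 _]; rewrite sourceS// /fsol -mulrA powE//; ring.
have fixpoint u U : sol u u U -> weak_eq Omega a U (fsol u) /\
    positive_weak_solution Omega a b c g theta u.
  move=> hs; have [su sU wu hu eU] := hs; have tu := (trP _ _ su sU).2 hu.
  have ff : {ae mu, forall x, Omega x -> source b c nu kappa u u x = fsol u x}.
    by apply: filterS (sol_01 _ _ _ hs) => x u01 Ox; rewrite fsolE// u01.
  have mf := mfsol _ (sqint_meas su).
  have eF := weak_eq_ae oOmega mf ff eU.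
  split=> //; split; first exact: (sol_weak _ _ _ _ hs su mf ff).
  (* On [0, M] one has b u + c u^q <= (|Bm| + |Cm| M^(q-1)) u, the linear bound required of the
     right-hand side. *)
  apply: (strong_positivity oOmega bOmega cb K00 ma aK hGh
    (h0 := hmin) (V := `|Bm| + `|Cm| * M `^ (q - 1)) _ _ _ su sU tu eF) => //.
  - by rewrite addr_ge0// mulr_ge0// powR_ge0.
  - by move=> x [cx _]; exact: bdry_datum_ge.
  - exact: sol_ge0 hs.
  - apply: filterS3 (sol_01 _ _ _ hs) bB cC => x h1 h2 h3 Ox.
    have /andP[u0 uM] := h1 Ox; have /andP[_ bm] := h2 Ox; have /andP[c00 cm] := h3 Ox.
    rewrite /fsol -mulrA powE// mulrDl; apply: lerD.
      by rewrite ler_wpM2r//; exact: le_trans (ler_norm _).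
    rewrite -(@mulr_powRB1 _ (u x) q)//; last exact: lt_trans ltr01 q1.
    rewrite mulrCA -mulrA mulrC -mulrA; apply: ler_pM => //.
    + by rewrite mulr_ge0// powR_ge0.
    + exact: le_trans (ler_norm _).
    + rewrite ler_wpM2r//; apply: ge0_ler_powR; rewrite ?nnegrE// subr_ge0; exact: ltW.
have [Psi [U [U_ [hs _ _ _]]]] := iter_cvg _ hPhi.
have [su sU _ hu _] := hs; have [eF posPsi] := fixpoint _ _ hs; have [_ pos] := posPsi.
have unique Psi' : positive_weak_solution Omega a b c g theta Psi' -> ae_equal Omega Psi' Psi.
  move=> [/(weak_solutionP oOmega bOmega K00 ma aK)[U' [su' wu' tu' eU']] pos'].
  have sU' i : S2 (U' i) by exact: wg_sqint wu'.
  have hu' := (trP _ _ su' sU').1 tu'.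
  apply: (weak_eq_unique oOmega bOmega K00 ma aK sU' sU _ eU' eF).
    have := H0B oOmega bOmega hu' hu; congr H0; first by apply/funext => x; ring.
    by apply/funext => i; apply/funext => x; ring.
  apply: filterS2 (filterI pos pos') (filterI b0 c0) => x [h1 h2] [h3 h4] Ox.
  have u0 := ltW (h1 Ox); have u0' := ltW (h2 Ox); have bx := h3 Ox; have cx := h4 Ox.
  rewrite /fsol -!(mulrA (c x)) !powE//.
  (* The competitor comes with no upper bound, so the unclamped right-hand sides are compared: t |->
     t^q is nondecreasing on [0, +oo). *)
  set t := Psi' x in u0' *; set s := Psi x in u0 *.
  have -> : (b x * t + c x * t `^ q - (b x * s + c x * s `^ q)) * (t - s) =
    b x * (t - s) ^+ 2 + c x * ((t `^ q - s `^ q) * (t - s)) by ring.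
  rewrite addr_ge0//; first by rewrite mulr_ge0// sqr_ge0.
  have q0 : 0 <= q by rewrite ltW// (lt_trans ltr01 q1).
  rewrite mulr_ge0//; have [st|ts] := leP s t.
    by rewrite mulr_ge0// subr_ge0//; apply: ge0_ler_powR; rewrite ?nnegrE.
  by rewrite mulr_le0// subr_le0 ?(ltW ts)//; apply: ge0_ler_powR; rewrite ?nnegrE// ltW.
exists Psi; split; [exact: posPsi|exact: unique|].
(* A given sequence of iterates converges to a limit of its own, which is a positive solution and so
   equals [Psi] almost everywhere. *)
move=> Psi_ hPsi; have [u [W [W_ [hsu hW cu cW]]]] := iter_cvg _ hPsi.
split=> [k|]; first exact: sol_ge0 (hW k).
have [s_u sW wgu _ _] := hsu.
have uPsi := unique _ (fixpoint _ _ hsu).2.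
have sPsi_ k : S2 (Psi_ k) by have [] := hW k.
apply: (cvg_H1P oOmega bOmega (G_ := W_) (G := W) sPsi_ _ su _).2.
- by move=> k; have [] := hW k.
- exact: (wg_ae oOmega bOmega s_u su uPsi wgu).
- split=> //; rewrite (_ : (fun k => _) = fun k => N (fun x => Psi_ k x - u x))//.
  apply/funext => k; apply: nrm2_ae_eq => //.
  + exact: sqint_meas (sqintB mO (sPsi_ k) su).
  + exact: sqint_meas (sqintB mO (sPsi_ k) s_u).
  + by apply: filterS uPsi => x h1 Ox; rewrite h1.
Qed.

End semilinear_problem.

(** Convergence is asserted for every sequence of iterates, in H^1; the existence of such a sequence
    is part of the conclusion, so that this is not vacuous. The nonnegativity of the iterates
    ensures that the real power in their equations has its usual meaning almost everywhere. *)
Theorem theorem5p2 (R : realType) (d : nat) (hd : d = 2%N \/ d = 3%N)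
  (Omega : set 'rV[R]_d)
  (Omega_nonempty : Omega !=set0) (Omega_open : open Omega)
  (Omega_connected : connected Omega) (Omega_bounded : bounded_set Omega)
  (Omega_simply_connected : simply_connected Omega)
  (Omega_C2 : C2_boundary Omega)
  (K0 K1 : R) (hK0 : 0 < K0) (hK1 : 0 < K1)
  (a sigma g c : 'rV[R]_d -> R) (theta mu : R)
  (a_lipschitz : [lipschitz a x | x in closure Omega])
  (a_bounds : forall x, closure Omega x -> K0 < a x < K1)
  (sigma_Linfty : Linfty Omega sigma)
  (sigma_bounds : {ae lebesgue_rV d, forall x, Omega x -> K0 < sigma x < K1})
  (g_C1 : C1_closure Omega g)
  (g_bounds : forall x, closure Omega x -> K0 < g x < K1)
  (c_Linfty : Linfty Omega c)
  (htheta : theta < -1) :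
  let b := fun x => - (2 / (1 + theta)) * mu * sigma x in
  {ae lebesgue_rV d, forall x, Omega x -> 0 <= b x} ->
  {ae lebesgue_rV d, forall x, Omega x -> 0 <= c x} ->
  (exists Psi_ : nat -> 'rV[R]_d -> R,
     iterates Omega a b c g theta Psi_ /\
     forall Psi'_, iterates Omega a b c g theta Psi'_ ->
       forall n, ae_equal Omega (Psi'_ n) (Psi_ n)) /\
  exists Psi : 'rV[R]_d -> R,
    [/\ positive_weak_solution Omega a b c g theta Psi,
        forall Psi', positive_weak_solution Omega a b c g theta Psi' ->
          ae_equal Omega Psi' Psi &
        forall Psi_, iterates Omega a b c g theta Psi_ ->
          (forall n, {ae lebesgue_rV d, forall x, Omega x -> 0 <= Psi_ n x}) /\
          cvg_H1 Omega Psi_ Psi].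
Proof.
(* Coordinates are split off one at a time, which asks for a dimension of the form n.+1. *)
have [n dE] : exists n, d = n.+1 by case: hd => ->; [exists 1%N|exists 2%N].
subst d => b b0 c0.
have aK x : Omega x -> K0 <= a x <= K1.
  by move=> /subset_closure /a_bounds /andP[h1 h2]; rewrite !ltW.
have bL : Linfty Omega b.
  have [ms [B hB]] := sigma_Linfty; split; first exact: measurable_funM.
  exists (`|- (2 / (1 + theta)) * mu| * B); apply: filterS hB => x hx Ox.
  by rewrite /b normrM ler_wpM2l// hx.
exact: (linear_iteration_converges Omega_open Omega_bounded Omega_C2 hK0 hK1
  (lipschitz_measurable Omega_open a_lipschitz) aK bL c_Linfty b0 c0 g_C1 g_bounds htheta).
Qed.
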